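(* Let $\overline{\chi}\in(0,1)$ and assume the following two hypotheses for the fixed direction $\mathbf{u}\in S^{d-1}$. (Upper tail concentration) There exist $\theta_0>0$ and $c_0>0$ such that, if $K$ is large enough, then for any $a\in[\overline{\chi},1]$ and any $\mathbf{v}\in H_{\mathbf{u}}$ with $|K\mathbf{v}-K\mathbf{u}|<K^{\frac{\overline{\chi}+1+c_0}{2}}$, $$\mathbb{P}\Big(T_{\mathrm{Cyl}_{\mathbf{v}}([-2K,2K],K^{\frac{a+1}{2}})}(\mathbf{0},K\mathbf{v})>K\mu(\mathbf{v})+K^{a}\Big)\le e^{-K^{\theta_0(a-\overline{\chi})}}.$$ (Directional finite curvature) There is a constant $C>0$ such that for any $\mathbf{u}^{\perp}\in\mathrm{span}\{\tilde{\mathbf{u}}_2,\dots,\tilde{\mathbf{u}}_d\}$, $\mu(\mathbf{u}+\mathbf{u}^{\perp})-\mu(\mathbf{u})\le C|\mathbf{u}^{\perp}|^2$. Then: (1) For any $\varepsilon>0$ there exists $\delta>0$ such that if $N\in\mathbb{N}$ is large enough, then for any $a\in[\overline{\chi}+\varepsilon,1]$ and any $\mathbf{v}\in H_{\mathbf{u}}$ with $|N\mathbf{v}-N\mathbf{u}|<N^{\frac{\overline{\chi}+1+\delta}{2}}$, $$\mathbb{P}\Big(T_{\mathrm{Cyl}_{\mathbf{v}}(\mathbb{R},N^{\frac{a+1}{2}})}(\mathbf{0},N\mathbf{v})>N\mu(\mathbf{v})+N^{a}\Big)\le \exp\Big(-N^{\frac{d(1-\varepsilon)}{1-\overline{\chi}}(a-\overline{\chi})}\Big).$$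 In particular, $$\mathbb{P}\big(T(\mathbf{0},N\mathbf{u})>N\mu(\mathbf{u})+N^{a}\big)\le \exp\Big(-N^{\frac{d(1-\varepsilon)}{1-\overline{\chi}}(a-\overline{\chi})}\Big).$$ (2) For any $\varepsilon>0$, if $\zeta>0$ is small enough, then $$\limsup_{N\to\infty}N^{-d}\log\mathbb{P}\big(T(\mathbf{0},N\mathbf{u})>N\mu(\mathbf{u})+\zeta N\big)\le-\zeta^{(1+\varepsilon)\frac{d}{1-\overline{\chi}}}.$$
   Context: First-passage percolation setting. Let $d\ge2$. To each nearest-neighbor edge $e$ of $\mathbb{Z}^d$ assign a nonnegative random weight $\tau_e$; the $(\tau_e)$ are i.i.d., nondegenerate, satisfy $\mathbb{P}(\tau_e=0)<p_c(d)$ (the critical probability of Bernoulli bond percolation on $\mathbb{Z}^d$), and are bounded: $\mathbb{P}(\tau_e\le C)=1$ for some $C>0$. For a lattice path $\gamma$ put $T(\gamma)=\sum_{e\in\gamma}\tau_e$. For $\mathbf{x},\mathbf{y}\in\mathbb{Z}^d$, $T(\mathbf{x},\mathbf{y})=\inf_{\gamma:\mathbf{x}\to\mathbf{y}}T(\gamma)$; for $\mathbf{x},\mathbf{y}\in\mathbb{R}^d$, $T(\mathbf{x},\mathbf{y}):=T(\lfloor\mathbf{x}\rfloor,\lfloor\mathbf{y}\rfloor)$, where $\lfloor\mathbf{x}\rfloor$ is the unique point of $\mathbb{Z}^d$ with $\mathbf{x}\in\lfloor\mathbf{x}\rfloor+[0,1)^d$. For $A\subset\mathbb{R}^d$, $T_A(\mathbf{x},\mathbf{y})$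 is the infimum of $T(\gamma)$ over lattice paths $\gamma$ contained in $A$ from $\lfloor\mathbf{x}\rfloor$ to $\lfloor\mathbf{y}\rfloor$. The time constant $\mu$ is the norm on $\mathbb{R}^d$ determined by $\mu(\mathbf{x})=\lim_{N\to\infty}T(\mathbf{0},N\mathbf{x})/N$ (a.s. and in $L^1$) for $\mathbf{x}\in\mathbb{Z}^d$, and $\mathbb{B}_d=\{\mathbf{x}\in\mathbb{R}^d:\mu(\mathbf{x})\le1\}$. $|\cdot|$ is the Euclidean norm and $S^{d-1}$ the Euclidean unit sphere. Fix $\mathbf{u}\in S^{d-1}$. $H_{\mathbf{u}}$ is a tangent (supporting) hyperplane at $\mathbf{u}$ to the boundary of $\mu(\mathbf{u})\mathbb{B}_d$ (ties broken by a predetermined rule), and $\{\tilde{\mathbf{u}}_1,\dots,\tilde{\mathbf{u}}_d\}$ is a fixed orthonormal basis of $\mathbb{R}^d$ with $\mathbf{u}+\mathrm{span}\{\tilde{\mathbf{u}}_2,\dots,\tilde{\mathbf{u}}_d\}=H_{\mathbf{u}}$ and $\tilde{\mathbf{u}}_1\cdot\mathbf{u}>0$. For $\mathbf{v}\in\mathbb{R}^d\setminus\{\mathbf{0}\}$, $I\subset\mathbb{R}$, $h>0$, the tilted cylinder is $$\mathrm{Cyl}_{\mathbf{v}}(I,h)=\Big\{y_1\mathbf{v}+\sum_{i=2}^dy_i\tilde{\mathbf{u}}_i:\ y_1\in I,\ |y_i|\le h\Big\}.$$ *)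

(* Defs.v *)
From HB Require Import structures.
From mathcomp Require Import all_boot all_order all_algebra.
From mathcomp Require Import all_classical all_reals all_analysis.
Set Implicit Arguments.
Unset Strict Implicit.
Unset Printing Implicit Defensive.
Import Order.TTheory GRing.Theory Num.Theory.
Import numFieldNormedType.Exports.
Local Open Scope classical_set_scope.
Local Open Scope ring_scope.

Definition dot (R : realType) (d : nat) (x y : 'rV[R]_d) : R :=
  \sum_(i < d) x ord0 i * y ord0 i.

Definition enorm (R : realType) (d : nat) (x : 'rV[R]_d) : R :=
  Num.sqrt (dot x x).

Definition orthonormal_basis (R : realType) (d : nat)
    (b : 'I_d -> 'rV[R]_d) : Prop :=
  forall i j : 'I_d, dot (b i) (b j) = (i == j)%:R.

(** The basis vectors are numbered from 0 here, so [b] at index 0 is the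
    first vector and this is the span of all the other ones. *)
Definition tail_span (R : realType) (d : nat)
    (b : 'I_d -> 'rV[R]_d) : {vspace 'rV[R]_d} :=
  <<[seq b i | i : 'I_d <- enum 'I_d & (0 < i)%N]>>%VS.

(** [H] is a hyperplane through the point [x] of [A], and [A] lies on one side
    of [H]; in particular [x] is a boundary point of [A]. *)
Definition supporting_hyperplane (R : realType) (d : nat)
    (A : set 'rV[R]_d) (x : 'rV[R]_d) (H : set 'rV[R]_d) : Prop :=
  A x /\
  exists n : 'rV[R]_d, [/\ n != 0,
    H = [set y | dot n y = dot n x] &
    forall y, A y -> dot n y <= dot n x].

Definition is_norm (R : realType) (d : nat) (mu : 'rV[R]_d -> R) : Prop :=
  [/\ forall x y, mu (x + y) <= mu x + mu y,
      forall (c : R) x, mu (c *: x) = `|c| * mu x &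
      forall x, mu x = 0 -> x = 0].

Definition unit_ball (R : realType) (d : nat) (mu : 'rV[R]_d -> R) :
  set 'rV[R]_d := [set x | mu x <= 1].

Definition Cyl (R : realType) (d : nat) (b : 'I_d -> 'rV[R]_d)
    (v : 'rV[R]_d) (I : set R) (h : R) : set 'rV[R]_d :=
  [set x | exists (y1 : R) (y : 'I_d -> R),
    [/\ I y1,
        forall i : 'I_d, (0 < i)%N -> `|y i| <= h &
        x = y1 *: v + \sum_(i < d | (0 < i)%N) y i *: b i]].

Notation vertex d := 'rV[int]_d.

Definition unit_vec (d : nat) (i : 'I_d) : vertex d := delta_mx ord0 i.

(** [(x, i)] stands for the undirected edge between [x] and [x + unit_vec i];
    every nearest-neighbour edge is represented exactly once. *)
Definition edge (d : nat) : Type := (vertex d * 'I_d)%type.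

Definition adjacent (d : nat) (x y : vertex d) : bool :=
  [exists i : 'I_d, (y == x + unit_vec i) || (x == y + unit_vec i)].

(** This list has exactly one element when [adjacent x y], and is empty
    otherwise. *)
Definition edges_between (d : nat) (x y : vertex d) : seq (edge d) :=
  [seq (x, i) | i <- enum 'I_d & y == x + unit_vec i] ++
  [seq (y, i) | i <- enum 'I_d & x == y + unit_vec i].

(** The path that starts at [x] and then visits the vertices in [s]. *)
Definition lattice_path (d : nat) (x y : vertex d) (s : seq (vertex d)) :
  Prop := path (@adjacent d) x s /\ last x s = y.

Definition path_edges (d : nat) (x : vertex d) (s : seq (vertex d)) :
  seq (edge d) := flatten (pairmap (@edges_between d) x s).

Definition of_lattice (R : realType) (d : nat) (z : vertex d) : 'rV[R]_d :=
  map_mx intr z.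

Definition lattice_floor (R : realType) (d : nat) (x : 'rV[R]_d) : vertex d :=
  map_mx Num.floor x.

(** The sets [A] used below are convex, so that a path whose vertices are in
    [A] is also contained in [A] as a polygonal curve. *)
Definition path_within (R : realType) (d : nat) (A : set 'rV[R]_d)
    (x : vertex d) (s : seq (vertex d)) : Prop :=
  forall z : vertex d, z \in x :: s -> A (of_lattice R z).

Definition path_time (R : realType) (d : nat) (t : edge d -> R)
    (x : vertex d) (s : seq (vertex d)) : R :=
  \sum_(e <- path_edges x s) t e.

(** Extended-real valued: the infimum is +oo if no path is contained in [A]. *)
Definition passage_time_in (R : realType) (d : nat) (t : edge d -> R)
    (A : set 'rV[R]_d) (x y : 'rV[R]_d) : \bar R :=
  ereal_inf [set (path_time t (lattice_floor x) s)%:E | s in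
    [set s | lattice_path (lattice_floor x) (lattice_floor y) s /\
             path_within A (lattice_floor x) s]].

Definition passage_time (R : realType) (d : nat) (t : edge d -> R)
    (x y : 'rV[R]_d) : \bar R := passage_time_in t setT x y.

Definition mutually_independent (R : realType) (dO dT : measure_display)
    (Omega : measurableType dO) (T : measurableType dT)
    (P : probability Omega R) (I : choiceType) (X : I -> {RV P >-> T}) : Prop :=
  forall (s : seq I) (B : I -> set T), uniq s ->
    (forall i, measurable (B i)) ->
    P (\bigcap_(i in [set` s]) (X i @^-1` B i)) =
    (\prod_(i <- s) P (X i @^-1` B i))%E.

Definition identically_distributed (R : realType) (dO dT : measure_display)
    (Omega : measurableType dO) (T : measurableType dT)
    (P : probability Omega R) (I : Type) (X : I -> {RV P >-> T}) : Prop :=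
  forall (i j : I) (B : set T), measurable B ->
    P (X i @^-1` B) = P (X j @^-1` B).

Definition open_cluster (d : nat) (o : edge d -> bool) (x : vertex d) :
  set (vertex d) :=
  [set y | exists s, lattice_path x y s /\ all o (path_edges x s)].

(** The law of an i.i.d. Bernoulli([p]) family being unique, it does not matter
    on which probability space the model is realized. *)
Definition no_percolation (R : realType) (d : nat) (p : R) : Prop :=
  forall (dO : measure_display) (Omega : measurableType dO)
    (P : probability Omega R) (o : edge d -> {RV P >-> bool}),
    mutually_independent o ->
    (forall e, P (o e @^-1` [set true]) = p%:E) ->
    P [set w | infinite_set (open_cluster (fun e => o e w) 0)] = 0%E.

Definition critical_probability (R : realType) (d : nat) : R :=
  sup [set p : R | 0 <= p <= 1 /\ no_percolation d p].

Definition is_time_constant (R : realType) (d : nat) (dO : measure_display)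
    (Omega : measurableType dO) (P : probability Omega R)
    (tau : edge d -> {RV P >-> R}) (mu : 'rV[R]_d -> R) : Prop :=
  is_norm mu /\
  forall z : vertex d,
    let x := of_lattice R z in
    let X (N : nat) (w : Omega) : \bar R :=
      (passage_time (fun e => tau e w) 0 (N%:R *: x) * (N%:R^-1)%:E)%E in
    {ae P, forall w, X N w @[N --> \oo] --> (mu x)%:E} /\
    (\int[P]_w `|X N w - (mu x)%:E|)%E @[N --> \oo] --> 0%E.

Definition upper_tail_concentration (R : realType) (d : nat)
    (dO : measure_display) (Omega : measurableType dO)
    (P : probability Omega R) (tau : edge d -> {RV P >-> R})
    (mu : 'rV[R]_d -> R) (u : 'rV[R]_d) (H : set 'rV[R]_d)
    (b : 'I_d -> 'rV[R]_d) (chi : R) : Prop :=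
  exists theta0 c0 : R, [/\ 0 < theta0, 0 < c0 &
    \forall K \near +oo, forall (a : R) (v : 'rV[R]_d),
      chi <= a <= 1 -> H v ->
      enorm (K *: v - K *: u) < K `^ ((chi + 1 + c0) / 2) ->
      (P [set w | (K * mu v + K `^ a)%R%:E <
            passage_time_in (fun e => tau e w)
              (Cyl b v `[(- (2 * K))%R, (2 * K)%R]%classic
                (K `^ ((a + 1) / 2))%R)
              0%R (K *: v)%R]
       <= (expR (- K `^ (theta0 * (a - chi))))%R%:E)%E].

Definition finite_curvature (R : realType) (d : nat)
    (mu : 'rV[R]_d -> R) (u : 'rV[R]_d) (b : 'I_d -> 'rV[R]_d) : Prop :=
  exists C : R, 0 < C /\
    forall w : 'rV[R]_d, w \in tail_span b ->
      mu (u + w) - mu u <= C * enorm w ^+ 2.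

(* Main.v *)
Require Import Defs.
From HB Require Import structures.
From mathcomp Require Import all_boot all_order all_algebra.
From mathcomp Require Import all_classical all_reals all_analysis.
From mathcomp Require Import ring lra zify.
Set Implicit Arguments.
Unset Strict Implicit.
Unset Printing Implicit Defensive.
Import Order.TTheory GRing.Theory Num.Theory.
Import numFieldNormedType.Exports.
Local Open Scope classical_set_scope.
Local Open Scope ring_scope.

(** Two amplifications of the concentration hypothesis.  First, a stretch of
    length [K] is cut into many blocks; excesses of blocks at distance at least
    five are independent, and an induction on [K] turns the stretched
    exponential tail of the hypothesis into a tail that is exponential in the
    excess divided by [K ^ X], for any [X > chi].  Second, of order [(N / K) ^ d]
    disjoint blocks of length [K = zeta ^ - kap], arranged in parallel lines in
    the middle of a cylinder of length [N], must all behave badly on average for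
    the excess to exceed [zeta * N].  The lines are joined to the two endpoints
    by tilted segments of length [N / Lam ^ 2]; finite curvature makes the tilt
    cost a small multiple of [zeta * N], and the segments are controlled at the
    relative excess [zeta * Lam ^ 2 / 4].  Iterating, the relative excess grows
    until the deterministic bound on the passage time applies. *)

(** A block of length k fluctuates by k^X with X close to chi, whereas a relative excess zeta
    amounts to zeta * k on it. It is therefore visible on blocks of length zeta^(-kap) as soon as
    kap * (1 - X) > 1; so kap may approach 1 / (1 - chi), and the number of blocks turns into N^d *
    zeta^(d / (1 - chi)). The first claim is the case zeta = N^(a - 1). The lateral scale is
    sqrt(zeta): a slope of this order costs about zeta per unit length by curvature, and blocks are
    at most about k * sqrt(zeta) wide, so that of order N / k of them fit side by side in each
    direction. Such slopes must stay within the range of the concentration hypothesis at the block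
    scale, which is possible because c0 is positive. The obstacle is that all lines share both
    endpoints: a bad event there cannot be multiplied over the lines, only summed. The sum is
    affordable since replacing N by N / Lam^2 and zeta by zeta * Lam^2 / 4 at least doubles N *
    zeta^Pw when Pw > 1 and Lam is large. *)

(** * Sigma-algebras generated by sets of coordinates *)

Section CoordinateSigmaAlgebras.
Variables (R : realType) (E : countType).
Local Notation config := (E -> R).

Definition coordinate_sets (F : set E) : set (set config) :=
  [set A | exists2 e, F e &
    exists2 B : set R, measurable B & A = [set t | B (t e)]].

Definition sigma_on (F : set E) : set (set config) := <<s coordinate_sets F>>.

Definition rect (s : seq E) (B : E -> set R) : set config :=
  [set t | forall e, e \in s -> B e (t e)].

(** The pi-system of events on finitely many coordinates, on which [mutually_independent] can be
    evaluated directly. *)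
Definition rects (F : set E) : set (set config) :=
  [set A | exists s B, [/\ uniq s, forall e, measurable (B e),
    forall e, e \in s -> F e & A = rect s B]].

(** Points are always configurations on all of [E]; only the sigma-algebra depends on [F], so that
    events over different coordinate sets live in one type. *)
Definition config_space (F : set E) := g_sigma_algebraType (coordinate_sets F).

HB.instance Definition _ F := Measurable.on (config_space F).

Lemma sigma_onS F G : F `<=` G -> sigma_on F `<=` sigma_on G.
Proof. by move=> FG; apply: sub_sigma_algebra2 => A [e /FG Ge eB]; exists e. Qed.

Lemma sigma_onT F : sigma_on F setT.
Proof. exact: (@measurableT _ (config_space F)). Qed.

(** The indices are enumerated by their codes, with the full event at codes that decode to
    nothing. *)
Lemma sigma_on_bigcap (J : countType) F (A : J -> set config) (D : set J) :
  (forall j, D j -> sigma_on F (A j)) ->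
  sigma_on F [set t | forall j, D j -> A j t].
Proof.
move=> sA; pose B (n : nat) : set config :=
  if unpickle n is Some j then [set t | D j -> A j t] else setT.
have -> : [set t | forall j, D j -> A j t] = \bigcap_n B n.
  apply/seteqP; split => [t At n _|t Bt j Dj].
    by rewrite /B; case: unpickle => [j|//]; exact: At.
  by have /= := Bt (pickle j) I; rewrite /B pickleK; apply.
apply: (@bigcapT_measurable _ (config_space F)) => n; rewrite /B.
case: unpickle => [j|]; last exact: sigma_onT.
have [Dj|nDj] := pselect (D j).
  rewrite (_ : mkset _ = A j); first exact: sA.
  by apply/seteqP; split => t /= At //; exact: At.
rewrite (_ : mkset _ = setT); first exact: sigma_onT.
by apply/seteqP; split => t //= _ /nDj.
Qed.

Lemma sigma_on_coordinate F e (B : set R) :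
  F e -> measurable B -> sigma_on F [set t | B (t e)].
Proof. by move=> Fe mB; apply: sub_sigma_algebra; exists e => //; exists B. Qed.

Lemma sigma_on_rects F : sigma_on F = <<s rects F>>.
Proof.
rewrite eqEsubset; split; apply: smallest_sub; try exact: smallest_sigma_algebra.
  move=> _ [e Fe [B mB ->]]; apply: sub_sigma_algebra.
  exists [:: e], (fun=> B); split => //; first by move=> j /[!inE] /eqP ->.
  apply/seteqP; split => [t Bt j /[!inE] /eqP -> //|t]; apply.
  by rewrite inE.
move=> _ [s [B [_ mB sF ->]]].
apply: (@sigma_on_bigcap _ F (fun e => [set t | B e (t e)]) [set` s]) => e es.
exact: sigma_on_coordinate (sF _ es) _.
Qed.

Lemma rects_setI F : setI_closed (rects F).
Proof.
move=> _ _ [s [B [us mB sF ->]]] [s' [B' [us' mB' sF' ->]]].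
exists (undup (s ++ s')), (fun e => (if e \in s then B e else setT) `&`
  (if e \in s' then B' e else setT)); split.
- exact: undup_uniq.
- by move=> e; apply: measurableI; case: ifP.
- by move=> e; rewrite mem_undup mem_cat => /orP[/sF|/sF'].
- apply/seteqP; split => t /=.
    move=> [st s't] e _; split; case: ifP => //; [exact: st|exact: s't].
  move=> H; split => e es; have := H e; rewrite mem_undup mem_cat es ?orbT.
    by case=> // + _; apply.
  by case=> //= _; rewrite es; apply.
Qed.

Lemma rectsT F : rects F setT.
Proof. by exists [::], (fun=> setT); split => //; apply/seteqP; split. Qed.

End CoordinateSigmaAlgebras.

(** * Product rules extended from pi-systems *)

Section Independence.
Variables (R : realType) (dT : measure_display) (T : measurableType dT).
Variables (Q : probability T R).

Lemma sub_generated_measurable (G : set (set T)) :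
  G `<=` measurable -> <<s G>> `<=` measurable.
Proof. by apply: smallest_sub => //; exact: sigma_algebra_measurable. Qed.

Lemma eq_probability_generated (Q' : {measure set T -> \bar R})
    (G : set (set T)) : G `<=` measurable -> setI_closed G -> G setT ->
  (forall A, G A -> Q A = Q' A) -> forall A, <<s G>> A -> Q A = Q' A.
Proof.
move=> Gm GI GT QQ'.
apply: (g_sigma_algebra_measure_unique G Gm (fun=> setT)) => //.
  by apply/seteqP; split => // t _; exists 0%N.
by move=> _; apply: (@le_lt_trans _ _ 1%E); rewrite ?ltry ?probability_le1.
Qed.

(** For fixed [A] both sides are finite measures in [B], the restriction of [Q] to [A] and a
    multiple of [Q], and they agree on a pi-system containing the whole space. *)
Lemma product_rule_generated (A : set T) (G : set (set T)) :
  measurable A -> G `<=` measurable -> setI_closed G -> G setT ->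
  (forall B, G B -> Q (A `&` B) = (Q A * Q B)%E) ->
  forall B, <<s G>> B -> Q (A `&` B) = (Q A * Q B)%E.
Proof.
move=> mA Gm GI GT AG B sB.
have QA : Q A = (fine (Q A))%:E by rewrite fineK // fin_num_measure.
have QA0 : 0 <= fine (Q A) by rewrite fine_ge0.
rewrite setIC [in RHS]QA.
transitivity (mrestr Q mA B) => //.
transitivity (mscale (NngNum QA0) Q B) => //.
apply: (g_sigma_algebra_measure_unique G Gm (fun=> setT)) => //.
- by apply/seteqP; split => // t _; exists 0%N.
- by move=> C /AG; rewrite setIC [in RHS]QA.
- move=> _; rewrite /mrestr; apply: (@le_lt_trans _ _ 1%E); rewrite ?ltry //.
  by apply: probability_le1; exact: measurableI.
Qed.

Lemma independent_generated (G1 G2 : set (set T)) :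
  G1 `<=` measurable -> G2 `<=` measurable ->
  setI_closed G1 -> setI_closed G2 -> G1 setT -> G2 setT ->
  (forall A B, G1 A -> G2 B -> Q (A `&` B) = (Q A * Q B)%E) ->
  forall A B, <<s G1>> A -> <<s G2>> B -> Q (A `&` B) = (Q A * Q B)%E.
Proof.
move=> G1m G2m G1I G2I G1T G2T G12 A B sA sB.
have mA := sub_generated_measurable G1m sA.
apply: (@product_rule_generated A G2) => // {}B {sB} GB.
rewrite setIC muleC.
by apply: (@product_rule_generated B G1) => // [|C GC];
  [exact: G2m|rewrite setIC muleC; exact: G12].
Qed.

End Independence.

(** * Joint law of the weights: independence and invariance *)

Lemma sigma_on_relabel (R : realType) (E : countType) (f : E -> E)
    (F G : set E) (A : set (E -> R)) : (forall e, F e -> G (f e)) ->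
  sigma_on F A -> sigma_on G [set t : E -> R | A (t \o f)].
Proof.
move=> FG; pose h (t : E -> R) := t \o f.
suff : sigma_on F `<=` image_set_system setT h (sigma_on G).
  by move=> /[apply]; rewrite /image_set_system /= setTI.
apply: smallest_sub; first exact/sigma_algebra_image/smallest_sigma_algebra.
move=> _ [e Fe [B mB ->]]; rewrite /image_set_system /= setTI.
exact: (sigma_on_coordinate (FG _ Fe)).
Qed.

Section Law.
Variables (R : realType) (E : countType).
Variables (dO : measure_display) (Omega : measurableType dO).
Variables (P : probability Omega R).

Definition joint (X : E -> {RV P >-> R}) (w : Omega) : config_space R [set: E] :=
  fun e => X e w.

Lemma measurable_joint X : measurable_fun setT (joint X).
Proof.
apply: (@measurability _ _ _ (config_space R [set: E]) _ _
  (@coordinate_sets R E setT)) => // _ [_ [e _ [B mB ->]] <-].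
by rewrite setTI; exact: (measurable_funPTI (X e)).
Qed.

HB.instance Definition _ X :=
  isMeasurableFun.Build _ _ _ _ (joint X) (measurable_joint X).

Definition law X : probability (config_space R [set: E]) R :=
  distribution P (joint X).

Lemma sigma_on_measurable F (A : set (E -> R)) : sigma_on F A ->
  measurable (A : set (config_space R [set: E])).
Proof. by apply: sigma_onS. Qed.

Lemma rects_measurable F (A : set (E -> R)) : rects F A ->
  measurable (A : set (config_space R [set: E])).
Proof.
move=> FA; apply: (@sigma_on_measurable F).
by rewrite sigma_on_rects; exact: sub_sigma_algebra.
Qed.

Lemma law_rect X s (B : E -> set R) :
  mutually_independent X -> uniq s -> (forall e, measurable (B e)) ->
  law X (rect s B) = (\prod_(e <- s) P (X e @^-1` B e))%E.
Proof. by move=> iX us mB; rewrite -iX. Qed.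

Lemma law_independent X (F G : set E) (A B : set (E -> R)) :
  mutually_independent X -> (forall e, F e -> ~ G e) ->
  sigma_on F A -> sigma_on G B -> law X (A `&` B) = (law X A * law X B)%E.
Proof.
move=> iX FG; rewrite !sigma_on_rects.
apply: (@independent_generated _ _ (config_space R setT)); try exact: rects_setI;
  try exact: rectsT; try exact: rects_measurable.
move=> _ _ [s [C [us mC sF ->]]] [s' [C' [us' mC' sG ->]]].
have ss' e : e \in s -> e \notin s'.
  by move=> /sF Fe; apply/negP => /sG; exact: FG.
rewrite !law_rect //.
(* As [s] and [s'] are disjoint, one family of sets describes both rectangles. *)
pose B' e := if e \in s then C e else C' e.
rewrite (_ : _ `&` _ = rect (s ++ s') B'); last first.
  apply/seteqP; split => [t [ts ts'] e|t tB]; rewrite /B'.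
    rewrite mem_cat; case: ifP => //= [es _|es es']; [exact: ts|exact: ts'].
  split=> e es; have := tB e; rewrite mem_cat es /B' ?orbT => /(_ isT).
    by rewrite es.
  by case: ifP => // /ss'; rewrite es.
rewrite law_rect //.
- rewrite big_cat /=; congr (_ * _)%E; apply: eq_big_seq => e es.
    by rewrite /B' es.
  by rewrite /B'; case: ifP => // /ss'; rewrite es.
- rewrite cat_uniq us us' andbT /=; apply/hasPn => e es'.
  by apply/negP => /ss'; rewrite es'.
- by move=> e; rewrite /B'; case: ifP.
Qed.

(** Independence and equal marginals determine the law on rectangles. With [f] a lattice translation
    this is the stationarity of the weights. *)
Lemma law_relabel X (f g : E -> E) (A : set (E -> R)) :
  mutually_independent X -> identically_distributed X ->
  cancel f g -> cancel g f -> sigma_on setT A ->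
  law X A = law (X \o f) A.
Proof.
move=> iX idX fK gK; rewrite sigma_on_rects.
have iXf : mutually_independent (X \o f).
  move=> s B us mB; have := iX (map f s) (B \o g).
  rewrite map_inj_uniq; last exact: can_inj fK.
  move=> /(_ us (fun e => mB (g e))); rewrite big_map /=.
  under [X in _ = X -> _]eq_bigr do rewrite fK.
  move=> <-; congr (P _); apply/seteqP; split => w /= Bw e.
    by move=> /mapP[e' es' ->]; rewrite fK; exact: Bw.
  by move=> es; have := Bw (f e) (map_f f es); rewrite fK.
apply: (@eq_probability_generated _ _ (config_space R setT));
  try exact: rects_setI; try exact: rectsT; try exact: rects_measurable.
move=> _ [s [C [us mC sF ->]]].
rewrite law_rect //; transitivity (law (X \o f) (rect s C)) => //; rewrite law_rect //; apply: eq_bigr => e _; exact: idX.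
Qed.

End Law.

(** * Probabilities of events of the weight configuration *)

Section Probability.
Variables (R : realType) (E : countType).
Variables (dO : measure_display) (Omega : measurableType dO).
Variables (P : probability Omega R) (X : E -> {RV P >-> R}) (C : R).

Definition iid_weights := [/\ mutually_independent X,
  identically_distributed X, forall e w, 0 <= X e w &
  forall e, P [set w | X e w <= C] = 1%E].

Definition prob (A : set (E -> R)) : R := fine (P [set w | A (X ^~ w)]).

Hypothesis hX : iid_weights.

Lemma prob_law (A : set (E -> R)) : prob A = fine (law X A). Proof. by []. Qed.

Lemma prob_fineK (A : set (E -> R)) : sigma_on setT A -> (prob A)%:E = P [set w | A (X ^~ w)].
Proof.
move=> mA; rewrite /prob fineK // -[P _]/(law X A).
exact: (@fin_num_measure _ (config_space R setT)).
Qed.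

Lemma prob_ge0 (A : set (E -> R)) : 0 <= prob A. Proof. exact: fine_ge0. Qed.

Lemma prob_le1 (A : set (E -> R)) : sigma_on setT A -> prob A <= 1.
Proof.
move=> mA; rewrite -lee_fin prob_fineK // -[P _]/(law X A).
exact: (@probability_le1 _ (config_space R setT)).
Qed.

Lemma prob_indep (F G : set E) (A B : set (E -> R)) : (forall e, F e -> ~ G e) ->
  sigma_on F A -> sigma_on G B -> prob (A `&` B) = prob A * prob B.
Proof.
case: hX => iX _ _ _ FG sA sB.
rewrite !prob_law (law_independent iX FG) // fineM //.
  by apply: (@fin_num_measure _ (config_space R setT)); exact: sigma_onS sA.
by apply: (@fin_num_measure _ (config_space R setT)); exact: sigma_onS sB.
Qed.

Lemma prob_relabel (f g : E -> E) (A : set (E -> R)) : cancel f g -> cancel g f ->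
  sigma_on setT A -> prob [set t : E -> R | A (t \o f)] = prob A.
Proof.
case: hX => iX idX _ _ fK gK mA.
by rewrite [RHS]prob_law (law_relabel iX idX fK gK).
Qed.

Lemma unbounded_negligible :
  P.-negligible (~` [set w | forall e, 0 <= X e w <= C]).
Proof.
case: hX => _ _ X0 XC.
pose N (n : nat) : set Omega :=
  if unpickle n is Some e then ~` [set w | X e w <= C] else set0.
apply: (@negligibleS _ _ _ _ (\bigcup_n N n)).
  move=> w /= /existsNP[e /negP]; rewrite X0 /= => XCw.
  by exists (pickle e) => //; rewrite /N pickleK /=; apply/negP.
apply: negligible_bigcup => n; rewrite /N.
case: unpickle => [e|]; last exact: negligible_set0.
have m : measurable [set w | X e w <= C].
  rewrite (_ : mkset _ = X e @^-1` `]-oo, C]); first exact: measurable_funPTI.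
  by apply/seteqP; split => w /=; rewrite in_itv.
exists (~` [set w | X e w <= C]); split => //; first exact: measurableC.
transitivity (1 - P [set w | (X e w <= C)%R])%E; first exact: probability_setC.
by rewrite XC subee.
Qed.

(** There are countably many weights, so almost surely all of them are in [0, C]. Comparing events
    on such configurations only lets deterministic path bounds enter the probability estimates. *)
Lemma le_prob (A B : set (E -> R)) : sigma_on setT A -> sigma_on setT B ->
  (forall t, (forall e, 0 <= t e <= C) -> A t -> B t) -> prob A <= prob B.
Proof.
move=> mA mB AB; rewrite -lee_fin !prob_fineK //.
have [N [mN PN subN]] := unbounded_negligible.
have mXA D : sigma_on setT D -> measurable [set w | D (X ^~ w)].
  by move=> mD; exact: (measurable_funPTI (joint X) mD).
apply: (@le_trans _ _ (P ([set w | B (X ^~ w)] `|` N))).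
  apply: le_measure; rewrite ?inE; [exact: mXA|by apply: measurableU => //; exact: mXA|].
  move=> w Aw; have [bw|nbw] := pselect (forall e, 0 <= X e w <= C).
    by left; exact: AB.
  by right; exact: subN.
apply: (le_trans (measureU2 _ _ _)) => //; first exact: mXA.
rewrite -[leRHS]adde0; apply: leeD; first exact: lexx.
by move/eqP: PN; rewrite eq_le => /andP[].
Qed.

Lemma prob_union (J : finType) (D : pred J) (A : set (E -> R)) (B : J -> set (E -> R)) :
  sigma_on setT A -> (forall j, sigma_on setT (B j)) ->
  (forall t, (forall e, 0 <= t e <= C) -> A t -> exists2 j, D j & B j t) ->
  prob A <= \sum_(j | D j) prob (B j).
Proof.
move=> mA mB AB.
have mU (s : seq J) : sigma_on setT [set t | exists2 j, j \in s & B j t].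
  rewrite (_ : mkset _ = ~` [set t | forall j, j \in s -> (~` B j) t]).
    apply: (@measurableC _ (config_space R setT)).
    apply: (@sigma_on_bigcap _ _ _ _ (fun j => ~` B j) [set` s]) => j _.
    by apply: (@measurableC _ (config_space R setT)); exact: mB.
  apply/seteqP; split => [t [j js Bj] /(_ j js)//|t /= /existsNP[j]].
  by move=> /not_implyP[js /contrapT]; exists j.
apply: (@le_trans _ _ (prob [set t | exists2 j, j \in enum D & B j t])).
  apply: le_prob => // t bt /(AB t bt)[j Dj Bj]; exists j => //.
  by rewrite mem_enum.
rewrite (_ : \sum_(j | D j) _ = \sum_(j <- enum D) prob (B j)); last by rewrite big_enum.
elim: (enum D) => [|j s IH].
  rewrite big_nil /prob (_ : mkset _ = set0) ?measure0 //.
  by apply/seteqP; split => // w [].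
rewrite big_cons; apply: le_trans (lerD (lexx _) IH).
rewrite -lee_fin EFinD !prob_fineK //.
have mXA D' : sigma_on setT D' -> measurable [set w | D' (X ^~ w)].
  by move=> mD; exact: (measurable_funPTI (joint X) mD).
rewrite (_ : mkset _ = [set w | B j (X ^~ w)] `|`
  [set w | exists2 j, j \in s & B j (X ^~ w)]).
  by apply: measureU2; [exact: mXA|exact: (mXA _ (mU s))].
apply/seteqP; split => [w [i /[!inE] /orP[/eqP ->|is_] Bi]|w]; first by left.
  by right; exists i.
case=> [Bj|[i is_ Bi]]; first by exists j; rewrite ?mem_head.
by exists i; rewrite // inE is_ orbT.
Qed.

Lemma prob_bigcap (J : finType) (D : pred J) (F : J -> set E)
    (A : J -> set (E -> R)) :
  (forall j, sigma_on (F j) (A j)) ->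
  (forall i j e, D i -> D j -> i != j -> F i e -> ~ F j e) ->
  prob [set t | forall j, D j -> A j t] = \prod_(j | D j) prob (A j).
Proof.
move=> sA dF.
suff H (s : seq J) : uniq s -> (forall j, j \in s -> D j) ->
    prob [set t | forall j, j \in s -> A j t] = \prod_(j <- s) prob (A j).
  rewrite (_ : \prod_(j | D j) _ = \prod_(j <- enum D) prob (A j));
    last by rewrite big_enum.
  rewrite -H ?enum_uniq //; last by move=> j; rewrite mem_enum.
  by congr prob; apply/seteqP; split => t At j Dj; apply: At;
    move: Dj; rewrite mem_enum.
elim: s => [_ _|j s IH /andP[js us] sD].
  rewrite big_nil (_ : mkset _ = setT); last by apply/seteqP; split.
  by rewrite /prob (_ : mkset _ = setT) ?probability_setT.
rewrite big_cons -IH //; last by move=> i is_; apply: sD; rewrite inE is_ orbT.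
pose G e := exists2 i, i \in s & F i e.
rewrite -(@prob_indep (F j) G) //.
- congr prob; apply/seteqP; split => [t At|t [Aj As] i].
    split; first by apply: At; rewrite mem_head.
    by move=> i is_; apply: At; rewrite inE is_ orbT.
  by rewrite inE => /orP[/eqP ->|/As].
- move=> e Fj [i is_ Fi]; apply: (dF j i e) => //.
  + by apply: sD; rewrite mem_head.
  + by apply: sD; rewrite inE is_ orbT.
  + by apply: contraNneq js => ->.
- apply: (@sigma_on_bigcap _ _ _ _ A [set` s]) => i is_.
  by apply: sigma_onS (sA i) => e Fi; exists i.
Qed.

End Probability.

(** * Lattice paths with a time bound, their measurability and translation *)

Section Paths.
Variables (R : realType) (d : nat).
Implicit Types (x y z : vertex d) (A : set (vertex d)) (t : edge d -> R).

(** A bound on the time of one path rather than on an infimum: such bounds add up under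
    concatenation, and the negation is a countable intersection over paths. *)
Definition reach t A x y (c : R) : Prop := exists s,
  [/\ lattice_path x y s, forall z, z \in x :: s -> A z & path_time t x s <= c].

Lemma path_time_cat t x s s' :
  path_time t x (s ++ s') = path_time t x s + path_time t (last x s) s'.
Proof. by rewrite /path_time /path_edges pairmap_cat flatten_cat big_cat. Qed.

Lemma path_time_cons t x y s :
  path_time t x (y :: s) = \sum_(e <- edges_between x y) t e + path_time t y s.
Proof. by rewrite /path_time /path_edges /= big_cat. Qed.

Lemma reach_refl t A x c : A x -> 0 <= c -> reach t A x x c.
Proof.
move=> Ax c0; exists [::]; split => //; first by move=> z /[!inE] /eqP ->.
by rewrite /path_time big_nil.
Qed.

Lemma reach_trans t A y x z c c' :
  reach t A x y c -> reach t A y z c' -> reach t A x z (c + c').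
Proof.
move=> [s [[ps <-] sA sc]] [s' [[ps' <-] sA' sc']]; exists (s ++ s'); split.
- by split; rewrite ?cat_path ?ps ?ps' // last_cat.
- move=> w; rewrite -cat_cons mem_cat => /orP[/sA//|ws'].
  by apply: sA'; rewrite inE ws' orbT.
- by rewrite path_time_cat lerD.
Qed.

Lemma reachW t A A' x y c c' : A `<=` A' -> c <= c' ->
  reach t A x y c -> reach t A' x y c'.
Proof.
move=> AA' cc' [s [ps sA sc]]; exists s; split => //; last exact: le_trans cc'.
by move=> z /sA/AA'.
Qed.

Definition shift_edge z (e : edge d) : edge d := (e.1 + z, e.2).

Lemma edges_between_shift z x y :
  edges_between (x + z) (y + z) = [seq shift_edge z e | e <- edges_between x y].
Proof.
rewrite /edges_between map_cat -!map_comp; congr (_ ++ _); congr map;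
  apply: eq_filter => i; rewrite [RHS]/= -addrA [z + _]addrC addrA;
  exact: (inj_eq (addIr z)).
Qed.

Lemma path_time_shift t z x s :
  path_time t (x + z) [seq y + z | y <- s] = path_time (t \o shift_edge z) x s.
Proof.
elim: s x => [|y s IH] x /=; first by rewrite /path_time !big_nil.
by rewrite !path_time_cons IH edges_between_shift big_map.
Qed.

Lemma adjacent_shift z x y : Defs.adjacent (x + z) (y + z) = Defs.adjacent x y.
Proof.
apply: eq_existsb => i; congr (_ || _);
  rewrite -addrA [z + _]addrC addrA; exact: (inj_eq (addIr z)).
Qed.

Lemma reach_shift t A z x y c : reach (t \o shift_edge z) A x y c ->
  reach t [set w | A (w - z)] (x + z) (y + z) c.
Proof.
move=> [s [[ps <-] sA sc]]; exists [seq w + z | w <- s]; split.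
- split; last exact: last_map.
  rewrite (_ : path _ _ _ = path (relpre (+%R^~ z) (@Defs.adjacent d)) x s);
    last exact: path_map.
  apply: sub_path ps => v w.
  by rewrite /= adjacent_shift.
- move=> w; rewrite -(map_cons (fun w => w + z)) => /mapP[v vs ->] /=.
  by rewrite addrK; exact: sA.
- by rewrite path_time_shift.
Qed.

(** The edges available to a path within [A]; regions without a common vertex therefore carry
    independent events. *)
Definition edges_in A : set (edge d) :=
  [set e | A e.1 /\ A (e.1 + unit_vec e.2)].

Lemma edges_between_in A x y e :
  A x -> A y -> e \in edges_between x y -> edges_in A e.
Proof.
move=> Ax Ay; rewrite mem_cat => /orP[] /mapP[i] /[!mem_filter] /andP[/eqP xy _].
  by move=> ->; split; rewrite //= -xy.
by move=> ->; split; rewrite //= -xy.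
Qed.

Lemma path_edges_in A x s e : (forall z, z \in x :: s -> A z) ->
  e \in path_edges x s -> edges_in A e.
Proof.
elim: s x => [//|y s IH] x sA; rewrite /path_edges /= mem_cat => /orP[].
  by apply: edges_between_in; apply: sA; rewrite !inE eqxx ?orbT.
by apply: IH => z zs; apply: sA; rewrite inE zs orbT.
Qed.

Lemma sigma_on_sum (F : set (edge d)) (r : seq (edge d)) c :
  (forall e, e \in r -> F e) ->
  sigma_on F [set t : edge d -> R | c < \sum_(e <- r) t e].
Proof.
move=> rF; pose S (t : config_space R F) : R := \sum_(e <- r | e \in r) t e.
have mS : measurable_fun setT S.
  rewrite /S; elim: {1}r => [|e r' IH].
    rewrite (_ : (fun _ => _) = cst 0); first exact: measurable_cst.
    by apply/funext => t; rewrite big_nil.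
  have [er|er] := boolP (e \in r); last first.
    apply: eq_measurable_fun IH => t _; by rewrite big_cons (negbTE er).
  apply: (@eq_measurable_fun _ _ (config_space R F) R setT
    ((fun t => t e) \+ (fun t => \sum_(e <- r' | e \in r) t e))).
    by move=> t _; rewrite big_cons er.
  apply: measurable_realfun.measurable_funD IH.
  move=> _ B mB; rewrite setTI; apply: (sigma_on_coordinate (rF _ er) mB).
have := mS (@measurableT _ _) _ (measurable_itv `]c, +oo[).
rewrite setTI; congr (sigma_on F _); apply/seteqP.
by split => t /=; rewrite in_itv /= andbT /S -big_seq.
Qed.

Lemma sigma_on_reach A x y c :
  sigma_on (edges_in A) [set t | ~ reach t A x y c].
Proof.
rewrite (_ : mkset _ = [set t | forall s, lattice_path x y s /\
    (forall z, z \in x :: s -> A z) -> c < path_time t x s]).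
  by apply: (@sigma_on_bigcap _ _ _ _
    (fun s => [set t : edge d -> R | c < path_time t x s])) => s [_ sA];
    apply: sigma_on_sum => e; exact: path_edges_in.
apply/seteqP; split => t.
  move=> nr s [ps sA]; rewrite ltNge; apply/negP => sc.
  by apply: nr; exists s.
by move=> H [s [ps sA sc]]; have := H s (conj ps sA); rewrite ltNge sc.
Qed.

Lemma sigma_on_reachT A x y c : sigma_on setT [set t | ~ reach t A x y c].
Proof. by apply: sigma_onS (@sigma_on_reach A x y c). Qed.

Definition norm1 n (x : 'rV[R]_n) : R := \sum_i `|x ord0 i|.

Lemma norm1D n (x y : 'rV[R]_n) : norm1 (x + y) <= norm1 x + norm1 y.
Proof.
by rewrite /norm1 -big_split; apply: ler_sum => i _; rewrite mxE ler_normD.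
Qed.

Lemma norm1N n (x : 'rV[R]_n) : norm1 (- x) = norm1 x.
Proof. by apply: eq_bigr => i _; rewrite mxE normrN. Qed.

Lemma norm1Z n a (x : 'rV[R]_n) : norm1 (a *: x) = `|a| * norm1 x.
Proof. by rewrite mulr_sumr; apply: eq_bigr => i _; rewrite mxE normrM. Qed.

Lemma norm1_ge0 n (x : 'rV[R]_n) : 0 <= norm1 x.
Proof. exact: sumr_ge0. Qed.

Definition dist x y : nat := (\sum_i `|x ord0 i - y ord0 i|)%N.

Lemma dist_norm1 x y :
  (dist x y)%:R = norm1 (of_lattice R x - of_lattice R y).
Proof.
rewrite /dist natr_sum; apply: eq_bigr => i _.
by rewrite natr_absz intr_norm !mxE rmorphB.
Qed.

Lemma edges_between_size x y : (size (edges_between x y) <= d.*2)%N.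
Proof.
rewrite size_cat -addnn !size_map !size_filter.
by apply: leq_add; rewrite -[leqRHS]card_ord cardE; exact: count_size.
Qed.

Lemma dist_eq0 x y : (dist x y == 0)%N = (x == y).
Proof.
apply/eqP/eqP => [|->]; last by rewrite /dist big1 // => i _; rewrite subrr.
move=> /eqP; rewrite /dist sum_nat_eq0 => /forallP H.
by apply/rowP => i; have := H i; rewrite /= absz_eq0 subr_eq0 => /eqP.
Qed.

Lemma dist_step x y n : dist x y = n.+1 ->
  exists2 z, Defs.adjacent x z & dist z y = n.
Proof.
move=> xyn.
have [i xyi] : exists i, x ord0 i != y ord0 i.
  apply/existsP; rewrite -[X in is_true X]negbK negb_exists.
  apply/negP => /forallP H; suff xy : x = y.
    by have := dist_eq0 x y; rewrite xyn xy eqxx.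
  by apply/rowP => i; apply/eqP; rewrite -[_ == _]negbK H.
have key z : (forall j, j != i -> z ord0 j = x ord0 j) ->
    (`|x ord0 i - y ord0 i| = `|z ord0 i - y ord0 i|.+1)%N -> dist z y = n.
  move=> zx zi; move: xyn; rewrite /dist (bigD1 i) //= zi addSn => -[<-].
  rewrite (bigD1 i) //=.
  by congr (_ + _)%N; apply: eq_bigr => j ji; rewrite zx.
have [lt|ge] := ltrP (x ord0 i) (y ord0 i).
  exists (x + unit_vec i).
    by apply/existsP; exists i; rewrite eqxx.
  apply: key => [j ji|]; rewrite !mxE ?eqxx /=.
    by rewrite (negbTE ji) addr0.
  by lia.
exists (x - unit_vec i).
  by apply/existsP; exists i; rewrite subrK eqxx orbT.
apply: key => [j ji|]; rewrite !mxE ?eqxx /=.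
  by rewrite (negbTE ji) subr0.
by lia.
Qed.

(** A shortest path comes closer to [y] at each step and so stays in the ball about [y]. The factor
    [d.*2] bounds the number of edges listed between two vertices. *)
Lemma reach_dist t A C x y : 0 <= C -> (forall e, 0 <= t e <= C) ->
  (forall z, (dist z y <= dist x y)%N -> A z) ->
  reach t A x y ((dist x y)%:R * (d.*2%:R * C)).
Proof.
move=> C0 tC; move: {2}(dist x y) (erefl (dist x y)) => n.
elim: n x => [|n IH] x xyn xA.
  have /eqP xy : x == y by rewrite -dist_eq0 xyn.
  rewrite -xy; apply: reach_refl; last by rewrite !mulr_ge0.
  by apply: xA; rewrite xy.
have [z xz zy] := dist_step xyn.
rewrite xyn -add1n natrD mulrDl mul1r; apply: (@reach_trans _ _ z); last first.
  by rewrite -zy; apply: IH => // w wz; apply: xA; rewrite (leq_trans wz) // zy xyn.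
exists [:: z]; split.
- by split=> //=; rewrite xz.
- by move=> w; rewrite !inE => /orP[/eqP ->|/eqP ->]; apply: xA; rewrite ?zy ?xyn.
- rewrite path_time_cons /path_time big_nil addr0.
  apply: (@le_trans _ _ (\sum_(e <- edges_between x z) C)).
    by apply: ler_sum => e _; case/andP: (tC e).
  rewrite big_const_seq count_predT iter_addr_0 -[leLHS]mulr_natl ler_wpM2r // ler_nat.
  exact: edges_between_size.
Qed.

End Paths.

(** * Scalar product, 1-norm and rounding to the lattice *)

Section Dot.
Variables (R : realType) (n : nat).
Implicit Types x y z : 'rV[R]_n.

Lemma dotC x y : dot x y = dot y x.
Proof. by apply: eq_bigr => i _; rewrite mulrC. Qed.

Lemma dotDr x y z : dot x (y + z) = dot x y + dot x z.
Proof. by rewrite /dot -big_split; apply: eq_bigr => i _; rewrite mxE mulrDr. Qed.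

Lemma dotZr a x y : dot x (a *: y) = a * dot x y.
Proof. by rewrite /dot mulr_sumr; apply: eq_bigr => i _; rewrite mxE mulrCA. Qed.

Lemma dot0r x : dot x 0 = 0.
Proof. by rewrite /dot big1 // => i _; rewrite mxE mulr0. Qed.

Lemma dotNr x y : dot x (- y) = - dot x y.
Proof. by rewrite -scaleN1r dotZr mulN1r. Qed.

Lemma dot_sumr (J : Type) (r : seq J) (Q : pred J) x (y : J -> 'rV[R]_n) :
  dot x (\sum_(j <- r | Q j) y j) = \sum_(j <- r | Q j) dot x (y j).
Proof. by elim/big_rec2 : _ => [|j a w _ <-]; rewrite ?dot0r ?dotDr. Qed.

Lemma dot_ge0 x : 0 <= dot x x.
Proof. by apply: sumr_ge0 => i _; rewrite -expr2 sqr_ge0. Qed.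

Lemma enorm_sqr x : enorm x ^+ 2 = dot x x.
Proof. by rewrite sqr_sqrtr ?dot_ge0. Qed.

Lemma coord_le1 x i : dot x x = 1 -> `|x ord0 i| <= 1.
Proof.
move=> x1; rewrite -(@expr_le1 _ 2) // real_normK ?num_real // -x1 /dot (bigD1 i) //=.
by rewrite expr2 lerDl sumr_ge0 // => j _; rewrite -expr2 sqr_ge0.
Qed.

Lemma dot_le_norm1 x y : dot x x = 1 -> `|dot x y| <= norm1 y.
Proof.
move=> x1; apply: le_trans (ler_norm_sum _ _ _) _; apply: ler_sum => i _.
by rewrite normrM -[leRHS]mul1r ler_wpM2r ?coord_le1.
Qed.

Lemma norm1_unit x : dot x x = 1 -> norm1 x <= n%:R.
Proof.
move=> x1; rewrite -[leRHS]mulr1 mulr_natl -[in leRHS](card_ord n) -sumr_const.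
by apply: ler_sum => i _; exact: coord_le1.
Qed.

Lemma norm1_floor x : norm1 (of_lattice R (lattice_floor x) - x) <= n%:R.
Proof.
rewrite -[leRHS]mulr1 mulr_natl -[in leRHS](card_ord n) -sumr_const.
apply: ler_sum => i _; rewrite !mxE.
have := floor_le_tmp (x ord0 i); have := floorD1_gt (x ord0 i).
rewrite intrD ler_norml => h1 h2; apply/andP; split; lra.
Qed.

Lemma of_latticeD (x y : vertex n) : of_lattice R (x + y) = of_lattice R x + of_lattice R y.
Proof. exact: map_mxD. Qed.

Lemma of_latticeB (x y : vertex n) : of_lattice R (x - y) = of_lattice R x - of_lattice R y.
Proof. exact: map_mxB. Qed.

Lemma of_lattice0 : of_lattice R (0 : vertex n) = 0.
Proof. exact: map_mx0. Qed.

Lemma lattice_floor0 : lattice_floor (0 : 'rV[R]_n) = 0.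
Proof. by apply/rowP => i; rewrite !mxE floor0. Qed.

End Dot.

(** * Coordinates adapted to the tilted cylinders *)

Section Frame.
Variables (R : realType) (m : nat).
Variables (u : 'rV[R]_m.+1) (b : 'I_m.+1 -> 'rV[R]_m.+1).
Implicit Types (x y : 'rV[R]_m.+1) (c : 'I_m -> R).

Definition tangent j := b (lift ord0 j).

Definition hvec c := u + \sum_j c j *: tangent j.

(* [ax x] and [lat c j x] are the coordinates [y_1] and [y_(j + 2)] of [x] in the
   frame [hvec c, u~_2, ..., u~_d] of a tilted cylinder; [c] ranges over the
   offsets that parametrize the hyperplane [H_u]. *)
Definition ax x := dot (b ord0) x / dot (b ord0) u.

Definition lat c j x := dot (tangent j) x - ax x * (dot (tangent j) u + c j).

Definition tube c (a1 a2 h : R) : set 'rV[R]_m.+1 :=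
  [set x | a1 <= ax x <= a2 /\ forall j, `|lat c j x| <= h].

Lemma axD x y : ax (x + y) = ax x + ax y.
Proof. by rewrite /ax dotDr mulrDl. Qed.
Lemma axZ a x : ax (a *: x) = a * ax x.
Proof. by rewrite /ax dotZr mulrA. Qed.
Lemma axN x : ax (- x) = - ax x.
Proof. by rewrite /ax dotNr mulNr. Qed.
Lemma latD c j x y : lat c j (x + y) = lat c j x + lat c j y.
Proof. rewrite /lat axD dotDr; ring. Qed.
Lemma latZ c j a x : lat c j (a *: x) = a * lat c j x.
Proof. rewrite /lat axZ dotZr; ring. Qed.
Lemma latN c j x : lat c j (- x) = - lat c j x.
Proof. rewrite /lat axN dotNr; ring. Qed.
Lemma lat_change c c' j x : lat c' j x = lat c j x + ax x * (c j - c' j).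
Proof. rewrite /lat; ring. Qed.

Hypothesis hb : orthonormal_basis b.

Lemma dot_tangent j k : dot (tangent j) (tangent k) = (j == k)%:R.
Proof. by rewrite hb (inj_eq lift_inj). Qed.

Lemma dot0_tangent j : dot (b ord0) (tangent j) = 0.
Proof. by rewrite hb. Qed.

Lemma dot_tangent_sum j c : dot (tangent j) (\sum_k c k *: tangent k) = c j.
Proof.
rewrite dot_sumr (bigD1 j) //= dotZr dot_tangent eqxx mulr1 big1 ?addr0 // => k kj.
by rewrite dotZr dot_tangent eq_sym (negbTE kj) mulr0.
Qed.

Lemma dot0_tangent_sum c : dot (b ord0) (\sum_k c k *: tangent k) = 0.
Proof. by rewrite dot_sumr big1 // => k _; rewrite dotZr dot0_tangent mulr0. Qed.

(** A square matrix with orthonormal rows also has orthonormal columns. *)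
Lemma orthonormal_expansion x : x = \sum_i dot (b i) x *: b i.
Proof.
pose B := \matrix_(i < m.+1, j < m.+1) b i ord0 j.
have BB : B *m B^T = 1%:M.
  apply/matrixP => i j; rewrite !mxE -(hb i j).
  by apply: eq_bigr => k _; rewrite !mxE.
have : x = x *m B^T *m B by rewrite -mulmxA (mulmx1C BB) mulmx1.
move=> {1}->; apply/rowP => j; rewrite mxE summxE; apply: eq_bigr => i _.
rewrite !mxE; congr (_ * _); apply: eq_bigr => k _; by rewrite !mxE mulrC.
Qed.

Lemma tangent_expansion x : dot (b ord0) x = 0 ->
  x = \sum_j dot (tangent j) x *: tangent j.
Proof.
by move=> x0; rewrite {1}[x]orthonormal_expansion big_ord_recl x0 scale0r add0r.
Qed.

Lemma sum_tail_tangent (y : 'I_m.+1 -> R) :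
  \sum_(i < m.+1 | (0 < i)%N) y i *: b i =
  \sum_j y (lift ord0 j) *: tangent j.
Proof. by rewrite big_mkcond big_ord_recl /= add0r. Qed.

Lemma mem_tail_span x : (x \in tail_span b) = (dot (b ord0) x == 0).
Proof.
apply/idP/eqP => [xb|x0].
  have := coord_span (X := in_tuple [seq b i | i : 'I_m.+1 <- enum 'I_m.+1 & (0 < i)%N]) xb.
  move=> ->; rewrite dot_sumr big1 // => i _; rewrite dotZr.
  have /mapP[k] : (in_tuple [seq b i | i : 'I_m.+1 <- enum 'I_m.+1 & (0 < i)%N])`_i
      \in [seq b i | i : 'I_m.+1 <- enum 'I_m.+1 & (0 < i)%N].
    by apply: mem_nth; rewrite ltn_ord.
  rewrite mem_filter => /andP[k0 _] ->; rewrite hb -val_eqE /= eq_sym.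
  by rewrite (gtn_eqF k0) mulr0.
rewrite (tangent_expansion x0); apply: rpred_sum => j _; apply: rpredZ.
apply: memv_span; apply: map_f; by rewrite mem_filter mem_enum.
Qed.

Lemma enorm_tangent_sum c : enorm (\sum_j c j *: tangent j) <= \sum_j `|c j|.
Proof.
have S0 : 0 <= \sum_j `|c j| by apply: sumr_ge0.
rewrite -(@ler_pXn2r _ 2) ?nnegrE ?sqrtr_ge0 // enorm_sqr.
rewrite dot_sumr.
under eq_bigr do rewrite dotZr dotC dot_tangent_sum.
rewrite expr2 mulr_suml; apply: ler_sum => j _.
apply: le_trans (ler_norm _) _; rewrite normrM ler_wpM2l //.
by rewrite (bigD1 j) //= lerDl sumr_ge0.
Qed.

Lemma tangent_sum_enorm c j : `|c j| <= enorm (\sum_j c j *: tangent j).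
Proof.
rewrite -(@ler_pXn2r _ 2) ?nnegrE ?sqrtr_ge0 // enorm_sqr.
rewrite dot_sumr.
under eq_bigr do rewrite dotZr dotC dot_tangent_sum.
rewrite real_normK ?num_real // (bigD1 j) //= expr2 lerDl.
by apply: sumr_ge0 => k _; rewrite -expr2 sqr_ge0.
Qed.

Hypothesis b0u : 0 < dot (b ord0) u.

Lemma ax_hvec c : ax (hvec c) = 1.
Proof. by rewrite /ax /hvec dotDr dot0_tangent_sum addr0 divff // gt_eqF. Qed.

Lemma lat_hvec c j : lat c j (hvec c) = 0.
Proof. by rewrite /lat ax_hvec dotDr dot_tangent_sum mul1r subrr. Qed.

Lemma ax_tangent_sum c : ax (\sum_k c k *: tangent k) = 0.
Proof. by rewrite /ax dot0_tangent_sum mul0r. Qed.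

Lemma Cyl_tube c a1 a2 h : Cyl b (hvec c) `[a1, a2]%classic h = tube c a1 a2 h.
Proof.
apply/seteqP; split => x.
  move=> [y1 [y [/= + hy ->]]]; rewrite in_itv /= sum_tail_tangent => y1a; split.
    by rewrite axD axZ ax_hvec ax_tangent_sum mulr1 addr0.
  move=> j; rewrite latD latZ lat_hvec mulr0 add0r /lat ax_tangent_sum.
  by rewrite (dot_tangent_sum j (fun j => y (lift ord0 j))) mul0r subr0 hy.
move=> [xa xl]; exists (ax x), (fun i => if unlift ord0 i is Some j then lat c j x else 0).
split.
- by rewrite /= in_itv.
- move=> i i0; case: unliftP i0 => [j ->//|->//].
- rewrite sum_tail_tangent.
  pose y := x - ax x *: hvec c.
  have y0 : dot (b ord0) y = 0.
    rewrite dotDr dotNr dotZr; have := ax_hvec c; rewrite /ax => /divr1_eq ->.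
    by rewrite divfK ?subrr // gt_eqF.
  apply/eqP; rewrite addrC -subr_eq -/y; apply/eqP.
  rewrite [LHS](tangent_expansion y0); apply: eq_bigr => j _; congr (_ *: _).
  rewrite liftK /y /lat dotDr dotNr dotZr /hvec dotDr dot_tangent_sum; ring.
Qed.

(* Bounds the linear forms [ax] and [lat c j] in the 1-norm, as well as the
   dimension. *)
Definition distortion : R :=
  1 + norm1 u + m.+1%:R + (norm1 u + 1) / dot (b ord0) u.

Lemma distortion_ge1 : 1 <= distortion.
Proof.
rewrite /distortion -!addrA lerDl !addr_ge0 ?norm1_ge0 //.
by rewrite divr_ge0 ?addr_ge0 ?norm1_ge0 // ltW.
Qed.

Lemma ax_bound x : `|ax x| <= distortion * norm1 x.
Proof.
rewrite /ax normrM normfV [`|dot _ u|]gtr0_norm // mulrC.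
apply: ler_pM => //; first by rewrite invr_ge0 ltW.
  rewrite /distortion mulrDl mul1r; have := norm1_ge0 u => u0.
  have := divr_ge0 u0 (ltW b0u); have : 0 <= m.+1%:R :> R by []. lra.
by apply: dot_le_norm1; rewrite hb.
Qed.

Lemma lat_bound c j x : `|c j| <= 1 -> `|lat c j x| <= distortion * norm1 x.
Proof.
move=> cj; have u0 := norm1_ge0 u; have x0 := norm1_ge0 x.
have ax1 : `|ax x| <= norm1 x / dot (b ord0) u.
  rewrite /ax normrM normfV [`|dot _ u|]gtr0_norm //.
  by rewrite ler_wpM2r ?invr_ge0 ?(ltW b0u) // dot_le_norm1 // hb.
have t1 : dot (tangent j) (tangent j) = 1 by rewrite dot_tangent eqxx.
apply: le_trans (ler_normB _ _) _; rewrite normrM.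
apply: (@le_trans _ _ (norm1 x + norm1 x / dot (b ord0) u * (norm1 u + 1))).
  apply: lerD; first exact: dot_le_norm1.
  apply: ler_pM => //; apply: le_trans (ler_normD _ _) _.
  by apply: lerD => //; exact: dot_le_norm1.
rewrite /distortion !mulrDl mul1r [_ / _ * _]mulrAC [norm1 x * _]mulrC.
rewrite -[_ / _ * norm1 x]mulrA [_^-1 * norm1 x]mulrC.
set k := (dot (b ord0) u)^-1.
have ux := mulr_ge0 u0 x0.
have mx : 0 <= m.+1%:R * norm1 x by rewrite mulr_ge0.
rewrite -subr_ge0 (_ : _ - _ = norm1 u * norm1 x + m.+1%:R * norm1 x); last ring.
exact: addr_ge0.
Qed.

Definition cnorm c : R := \sum_j `|c j|.

Lemma cnorm_ge0 c : 0 <= cnorm c. Proof. exact: sumr_ge0. Qed.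

Lemma coord_le_cnorm c j : `|c j| <= cnorm c.
Proof. by rewrite /cnorm (bigD1 j) //= lerDl sumr_ge0. Qed.

Lemma norm1_hvec c : cnorm c <= 1 -> norm1 (hvec c) <= distortion.
Proof.
move=> c1; apply: le_trans (norm1D _ _) _.
apply: (@le_trans _ _ (norm1 u + m.+1%:R)).
  rewrite lerD2l; apply: (@le_trans _ _ (\sum_j norm1 (c j *: tangent j))).
    elim/big_rec2 : _ => [|j a w _ ih].
      by rewrite /norm1 big1 // => i _; rewrite mxE normr0.
    by apply: le_trans (norm1D _ _) _; rewrite lerD2l.
  apply: (@le_trans _ _ (\sum_j `|c j| * m.+1%:R)).
    apply: ler_sum => j _; rewrite norm1Z ler_wpM2l // norm1_unit //.
    by rewrite dot_tangent eqxx.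
  by rewrite -mulr_suml -[leRHS]mul1r ler_wpM2r.
have : 0 <= (norm1 u + 1) / dot (b ord0) u.
  by rewrite divr_ge0 ?addr_ge0 ?norm1_ge0 // ltW.
rewrite /distortion; lra.
Qed.

End Frame.

(** * The time constant on the supporting hyperplane *)

Section TimeConstant.
Variables (R : realType) (m : nat).
Variables (u : 'rV[R]_m.+1) (b : 'I_m.+1 -> 'rV[R]_m.+1).
Variables (mu : 'rV[R]_m.+1 -> R) (H : set 'rV[R]_m.+1).
Hypothesis hb : orthonormal_basis b.
Hypothesis b_span : [set u + w | w in [set` tail_span b]] = H.
Hypothesis mu_norm : is_norm mu.

Lemma is_norm0 : mu 0 = 0.
Proof. by case: mu_norm => _ muZ _; rewrite -(scale0r 0) muZ normr0 mul0r. Qed.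

Lemma is_norm_ge0 x : 0 <= mu x.
Proof.
case: mu_norm => muD muZ _; have := muD x (- x).
by rewrite subrr is_norm0 -scaleN1r muZ normrN normr1 mul1r; lra.
Qed.

Lemma hyperplane_hvec c : H (hvec u b c).
Proof.
rewrite -b_span; exists (\sum_j c j *: tangent b j) => //=.
by rewrite (mem_tail_span hb) dot0_tangent_sum.
Qed.

Lemma hyperplane_hvecP v : H v -> exists c, v = hvec u b c.
Proof.
rewrite -b_span => -[w /=]; rewrite (mem_tail_span hb) => /eqP w0 <-.
by exists (fun j => dot (tangent b j) w); rewrite /hvec -tangent_expansion.
Qed.

(** If a point v of the hyperplane had a smaller norm than u, its multiple of norm [mu u] would
    belong to the ball but lie strictly beyond the hyperplane. *)
Lemma time_constant_minimum :
  supporting_hyperplane [set mu u *: x | x in unit_ball mu] u H ->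
  u != 0 -> forall c, mu u <= mu (hvec u b c).
Proof.
case: mu_norm => muD muZ mu0 [_ [n [n0 Hn nA]]] u0 c; rewrite leNgt; apply/negP => lt.
have Hv := hyperplane_hvec c; set v := hvec u b c in lt Hv.
have mu_gt0 : 0 < mu u.
  rewrite lt_neqAle is_norm_ge0 andbT eq_sym; apply: contra u0 => /eqP/mu0 ->.
  exact: eqxx.
have A x : mu x <= mu u -> dot n x <= dot n u.
  move=> xu; apply: nA; exists ((mu u)^-1 *: x).
    by rewrite /unit_ball /= muZ ger0_norm ?invr_ge0 ?is_norm_ge0 // ler_pdivrMl // mulr1.
  by rewrite scalerA mulfV ?gt_eqF // scale1r.
have nv : dot n v = dot n u by move: Hv; rewrite Hn.
have nu_ge0 : 0 <= dot n u.
  have := A (- u); rewrite -scaleN1r muZ normrN normr1 mul1r => /(_ (lexx _)).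
  by rewrite dotZr; lra.
(* Were [n] orthogonal to [u], the multiple of [n] of norm [mu u] would force [dot n n <= 0]. *)
have [nu|nu] := eqVneq (dot n u) 0.
  have nn : 0 < mu n.
    rewrite lt_neqAle is_norm_ge0 andbT eq_sym; apply: contra n0 => /eqP/mu0 ->.
    exact: eqxx.
  have := A ((mu u / mu n) *: n).
  rewrite muZ ger0_norm ?divr_ge0 ?is_norm_ge0 // divfK ?gt_eqF // => /(_ (lexx _)).
  rewrite dotZr nu pmulr_rle0 ?divr_gt0 // -enorm_sqr => n2.
  have : enorm n ^+ 2 = 0 by apply/eqP; rewrite eq_le n2 sqr_ge0.
  rewrite enorm_sqr => nn0; move/negP: n0; apply; apply/eqP/rowP => i.
  rewrite mxE; apply/eqP; rewrite -sqrf_eq0 expr2.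
  move/eqP: nn0; rewrite /dot psumr_eq0; last by move=> j _; rewrite -expr2 sqr_ge0.
  by move/allP/(_ i); rewrite mem_index_enum => /(_ isT).
have nu_gt0 : 0 < dot n u by rewrite lt_neqAle eq_sym nu.
have [v0|v0] := eqVneq (mu v) 0.
  by have := nu_gt0; rewrite -nv (mu0 _ v0) dot0r ltxx.
have v_gt0 : 0 < mu v by rewrite lt_neqAle eq_sym v0 is_norm_ge0.
have := A ((mu u / mu v) *: v).
rewrite muZ ger0_norm ?divr_ge0 ?is_norm_ge0 // divfK // => /(_ (lexx _)).
rewrite dotZr nv -[leRHS]mul1r ler_pM2r // ler_pdivrMr // mul1r leNgt.
by rewrite lt.
Qed.

Lemma time_constant_curvature : finite_curvature mu u b ->
  exists2 C : R, 0 < C & forall c, mu (hvec u b c) <= mu u + C * cnorm c ^+ 2.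
Proof.
move=> [C [C0 hC]]; exists C => // c.
have := hC (\sum_j c j *: tangent b j).
rewrite (mem_tail_span hb) dot0_tangent_sum // eqxx => /(_ isT) h.
have : C * enorm (\sum_j c j *: tangent b j) ^+ 2 <= C * cnorm c ^+ 2.
  rewrite ler_pM2l // lerXn2r ?nnegrE ?sqrtr_ge0 ?cnorm_ge0 //.
  exact: enorm_tangent_sum.
by move: h; rewrite /hvec; lra.
Qed.

End TimeConstant.

(** * Gluing paths, and tubes around lattice approximations of segments *)

Section Reach.
Variables (R : realType) (d : nat).
Implicit Types (t : edge d -> R) (A : set (vertex d)).

Lemma reach_chain t A (x : nat -> vertex d) (y : nat -> R) n : A (x 0%N) ->
  (forall i, (i < n)%N -> reach t A (x i) (x i.+1) (y i)) ->
  reach t A (x 0%N) (x n) (\sum_(i < n) y i).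
Proof.
move=> A0; elim: n => [|n IH] xy; first by rewrite big_ord0; exact: reach_refl.
rewrite big_ord_recr /=; apply: reach_trans (xy n _); last exact: ltnSn.
by apply: IH => i ilt; apply: xy; rewrite ltnS ltnW.
Qed.

(** Meant for joining two lattice points that differ by rounding errors only. *)
Lemma reach_link t A C x y (l : R) : 0 <= C -> (forall e, 0 <= t e <= C) ->
  norm1 (of_lattice R x - of_lattice R y) <= l ->
  (forall z, norm1 (of_lattice R z - of_lattice R y) <= l -> A z) ->
  reach t A x y (l * (d.*2%:R * C)).
Proof.
move=> C0 tC xyl lA; have q0 : 0 <= d.*2%:R * C by rewrite mulr_ge0.
apply: reachW (@reach_dist _ _ t A C x y C0 tC _); first by [].
  by rewrite dist_norm1 ler_wpM2r.
move=> z zxy; apply: lA; apply: le_trans xyl.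
by rewrite -!dist_norm1 ler_nat.
Qed.

Definition slow A x y (s : R) : set (edge d -> R) := [set t | ~ reach t A x y s].

Lemma sigma_on_slow A x y s : sigma_on (edges_in A) (slow A x y s).
Proof. exact: sigma_on_reach. Qed.

Lemma sigma_on_slowT A x y s : sigma_on setT (slow A x y s).
Proof. exact: sigma_on_reachT. Qed.

End Reach.

Section Tubes.
Variables (R : realType) (m : nat).
Variables (u : 'rV[R]_m.+1) (b : 'I_m.+1 -> 'rV[R]_m.+1).
Hypothesis hb : orthonormal_basis b.
Hypothesis b0u : 0 < dot (b ord0) u.
Local Notation D := (distortion u b).
Local Notation hvec := (hvec u b).
Local Notation V := (vertex m.+1).
Local Notation "'L' x" := (of_lattice R x) (at level 8, x at level 8).

Definition ltube c (z : V) (a1 a2 h : R) : set V :=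
  [set w | tube u b c a1 a2 h (L w - L z)].

Definition pt c (s : R) : V := lattice_floor (s *: hvec c).

Lemma D_ge1 : 1 <= D. Proof. exact: distortion_ge1. Qed.

Lemma dim_le_D : m.+1%:R <= D.
Proof.
have := norm1_ge0 u; have : 0 <= (norm1 u + 1) / dot (b ord0) u.
  by rewrite divr_ge0 ?addr_ge0 ?norm1_ge0 // ltW.
rewrite /distortion; lra.
Qed.

Lemma pt0 c : pt c 0 = 0.
Proof. by rewrite /pt scale0r lattice_floor0. Qed.

Lemma norm1_pt c s : norm1 (L (pt c s) - s *: hvec c) <= D.
Proof. exact: le_trans (norm1_floor _) dim_le_D. Qed.

Lemma ltubeS c z a1 a2 h a1' a2' h' : a1' <= a1 -> a2 <= a2' -> h <= h' ->
  ltube c z a1 a2 h `<=` ltube c z a1' a2' h'.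
Proof.
move=> a1a a2a hh w [/andP[w1 w2] wl]; split; last first.
  by move=> j; apply: le_trans (wl j) hh.
by rewrite (le_trans a1a w1) (le_trans w2 a2a).
Qed.

Lemma ltube_shift c z a1 a2 h :
  ltube c z a1 a2 h = [set w | ltube c 0 a1 a2 h (w - z)].
Proof. by apply/seteqP; split => w; rewrite /ltube /= of_latticeB of_lattice0 subr0. Qed.

Lemma ltube_trans c z z' a1 a2 h a1' a2' h' w :
  ltube c z a1 a2 h w -> ltube c z' a1' a2' h' z ->
  ltube c z' (a1 + a1') (a2 + a2') (h + h') w.
Proof.
move=> [/andP[w1 w2] wl] [/andP[z1 z2] zl].
rewrite /ltube /tube /= (_ : L w - L z' = (L w - L z) + (L z - L z')); last first.
  by rewrite addrA subrK.
split; first by rewrite axD !lerD.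
by move=> j; rewrite latD (le_trans (ler_normD _ _)) // lerD.
Qed.

(** Distances to a point of the axis become tube coordinates, because [D] bounds the forms [ax] and
    [lat c j] in the 1-norm. *)
Lemma ltube_near c z s l w : cnorm c <= 1 ->
  norm1 (L w - L z - s *: hvec c) <= l ->
  ltube c z (s - D * l) (s + D * l) (D * l) w.
Proof.
move=> c1 wl; have D0 : 0 <= D by rewrite (le_trans _ D_ge1).
have Dl : D * norm1 (L w - L z - s *: hvec c) <= D * l by rewrite ler_wpM2l.
rewrite /ltube /tube /=; split.
  have := le_trans (ax_bound hb b0u (L w - L z - s *: hvec c)) Dl.
  by rewrite axD axN axZ (ax_hvec hb b0u) mulr1 ler_norml => /andP[? ?]; lra.
move=> j; have cj : `|c j| <= 1 by apply: le_trans (coord_le_cnorm c j) c1.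
have := le_trans (lat_bound hb b0u (L w - L z - s *: hvec c) cj) Dl.
by rewrite latD latN latZ (lat_hvec hb b0u) mulr0 subr0.
Qed.

Lemma ltube_pt c s : cnorm c <= 1 ->
  ltube c 0 (s - D ^+ 2) (s + D ^+ 2) (D ^+ 2) (pt c s).
Proof.
by move=> c1; apply: ltube_near => //; rewrite of_lattice0 subr0; exact: norm1_pt.
Qed.

Lemma norm1_ptB c s s' : cnorm c <= 1 ->
  norm1 (L (pt c s) - L (pt c s')) <= 2 * D + `|s - s'| * D.
Proof.
move=> c1; have -> : L (pt c s) - L (pt c s') = (L (pt c s) - s *: hvec c) +
   (- (L (pt c s') - s' *: hvec c) + (s - s') *: hvec c).
  rewrite scalerBl opprB; apply/rowP => i; rewrite !mxE; ring.
apply: le_trans (norm1D _ _) _; rewrite [2 * D]mulrDl mul1r -addrA; apply: lerD.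
  exact: norm1_pt.
apply: le_trans (norm1D _ _) _; rewrite norm1N; apply: lerD; first exact: norm1_pt.
by rewrite norm1Z ler_wpM2l // norm1_hvec.
Qed.

(** The cost of bridging a distance [3 * D]: three roundings to the lattice, or two roundings and a
    unit step along the axis. *)
Definition link_cost (C : R) : R := 3 * D * (m.+1.*2%:R * C).
(* Above this length the roundings to lattice points are negligible. *)
Definition coarse : R := 8 * D ^+ 2.

(** The path follows the axis in unit steps and a last step of length at most one; the factor 2
    covers the extra step. *)
Lemma reach_bounded C t c z K h : 0 <= C -> (forall e, 0 <= t e <= C) ->
  cnorm c <= 1 -> coarse <= K -> coarse <= h ->
  reach t (ltube c z (- (2 * K)) (2 * K) h) z (z + pt c K) (2 * link_cost C * K).
Proof.
move=> C0 tC c1 K1 h1; set A := ltube _ _ _ _ _.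
have D1 := D_ge1; have DD : D <= D ^+ 2 by rewrite expr2 ler_peMl ?(le_trans ler01).
have K8 : 8 <= K by move: K1; rewrite /coarse; lra.
have q0 : 0 <= m.+1.*2%:R * C by rewrite mulr_ge0.
have zpt s w l : 0 <= s <= K -> l <= 3 * D ->
    norm1 (L w - L (z + pt c s)) <= l -> A w.
  move=> /andP[s0 sK] l3 wl.
  have : norm1 (L w - L z - s *: hvec c) <= 4 * D.
    have -> : L w - L z - s *: hvec c = (L w - L (z + pt c s)) + (L (pt c s) - s *: hvec c).
      by rewrite of_latticeD opprD !addrA subrK.
    apply: le_trans (norm1D _ _) _; have := norm1_pt c s; lra.
  move=> /(ltube_near c1); apply: ltubeS; move: K1 h1; rewrite /coarse expr2; nra.
have step s s' : 0 <= s <= K -> 0 <= s' <= K -> `|s - s'| <= 1 ->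
    reach t A (z + pt c s) (z + pt c s') (link_cost C).
  move=> s0 s0' ss'; apply: (@reach_link _ _ t A C) => //.
    rewrite !of_latticeD opprD addrACA subrr add0r.
    apply: le_trans (norm1_ptB _ _ c1) _.
    have : `|s - s'| * D <= 1 * D by rewrite ler_wpM2r // (le_trans ler01).
    lra.
  by move=> w; apply: zpt s0' _.
have K0 : 0 <= K by lra.
pose n := Num.truncn K; have /andP[nK Kn] := truncn_itv K0.
have := @reach_chain _ _ t A (fun i => z + pt c i%:R) (fun=> link_cost C) n.
rewrite /= pt0 addr0 sumr_const card_ord => /(_ _ _)/(reach_trans (z := z + pt c K)) H.
apply: (reachW _ _ (H _ _ _ (step n%:R K _ _ _))) => //.
- have : n%:R * link_cost C <= K * link_cost C.
    by rewrite ler_wpM2r // !mulr_ge0 // (le_trans ler01).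
  have : 8 * link_cost C <= K * link_cost C.
    by rewrite ler_wpM2r // !mulr_ge0 // (le_trans ler01).
  have : 0 <= link_cost C by rewrite !mulr_ge0 // (le_trans ler01).
  rewrite -[_ *+ _]mulr_natl; lra.
- apply: (zpt 0 z 0); rewrite ?lexx //=; first lra.
  by rewrite pt0 addr0 subrr /norm1 big1 // => i _; rewrite mxE normr0.
- move=> i ilt; apply: step.
  + by rewrite ler0n (le_trans _ nK) // ler_nat ltnW.
  + by rewrite ler0n (le_trans _ nK) // ler_nat.
  + by rewrite -natr1 opprD addrA subrr add0r normrN normr1.
- by rewrite ler0n nK.
- by rewrite K0 lexx.
- by rewrite distrC ger0_norm ?subr_ge0 // lerBlDr addrC natr1 ltW.
Qed.

End Tubes.

(** * Lines of consecutive blocks *)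

Lemma modn5_gap (i j : nat) : i = j %[mod 5] -> (i < j)%N -> (i + 5 <= j)%N.
Proof.
move=> /eqP ij lt; move: ij; rewrite eq_sym eqn_mod_dvd ?(ltnW lt) //.
by move=> /dvdnP[[|q]]; lia.
Qed.

Section Line.
Variables (R : realType) (m : nat).
Variables (u : 'rV[R]_m.+1) (b : 'I_m.+1 -> 'rV[R]_m.+1).
Hypothesis hb : orthonormal_basis b.
Hypothesis b0u : 0 < dot (b ord0) u.
Local Notation D := (distortion u b).
Local Notation V := (vertex m.+1).
Local Notation "'L' x" := (of_lattice R x) (at level 8, x at level 8).
Local Notation ltube := (ltube u b).
Local Notation pt := (pt u b).
Variables (c : 'I_m -> R) (c1 : cnorm c <= 1).

Lemma ltube_add_pt z s : ltube c z (s - D ^+ 2) (s + D ^+ 2) (D ^+ 2) (z + pt c s).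
Proof. by rewrite ltube_shift /= [z + _]addrC addrK; exact: (ltube_pt hb b0u). Qed.

Lemma ltube_near_pt z s w : norm1 (L w - L (z + pt c s)) <= 3 * D ->
  ltube c z (s - 4 * D ^+ 2) (s + 4 * D ^+ 2) (4 * D ^+ 2) w.
Proof.
move=> wz; have {}wz : norm1 (L w - L z - s *: hvec u b c) <= 4 * D.
  have -> : L w - L z - s *: hvec u b c =
      (L w - L (z + pt c s)) + (L (pt c s) - s *: hvec u b c).
    by rewrite of_latticeD opprD !addrA subrK.
  apply: le_trans (norm1D _ _) _; have := norm1_pt b0u c s; lra.
have -> : 4 * D ^+ 2 = D * (4 * D) by ring.
exact: (ltube_near hb b0u c1 wz).
Qed.

Variables (k h : R) (k1 : coarse u b <= k) (h1 : coarse u b <= h).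

Lemma coarse_bounds : [/\ 0 < D ^+ 2, 8 * D ^+ 2 <= k & 8 * D ^+ 2 <= h].
Proof. by split => //; rewrite exprn_gt0 // (lt_le_trans ltr01) ?D_ge1. Qed.

Definition block (z : V) : set V := ltube c z (- (2 * k)) (2 * k) h.

Lemma norm1_pt_link z s : norm1 (L (z + pt c s + pt c k) - L (z + pt c (s + k))) <= 3 * D.
Proof.
rewrite !of_latticeD (_ : _ - _ = (L (pt c s) - s *: hvec u b c) +
  ((L (pt c k) - k *: hvec u b c) - (L (pt c (s + k)) - (s + k) *: hvec u b c))).
  apply: le_trans (norm1D _ _) _; have := norm1_pt b0u c s.
  have := norm1D (L (pt c k) - k *: hvec u b c) (- (L (pt c (s + k)) - (s + k) *: hvec u b c)).
  rewrite norm1N; have := norm1_pt b0u c k; have := norm1_pt b0u c (s + k); lra.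
by apply/rowP => i; rewrite !mxE; ring.
Qed.

(** Rounding is not additive: the end of a block differs from the start of the next one by at most
    [3 * D], which costs one link per block. *)
Lemma line_reach C t z n (y : nat -> R) : 0 <= C -> (forall e, 0 <= t e <= C) ->
  (forall i, (i < n)%N -> reach t (block (z + pt c (i%:R * k)))
     (z + pt c (i%:R * k)) (z + pt c (i%:R * k) + pt c k) (y i)) ->
  reach t (ltube c z (- (3 * k)) ((n%:R + 3) * k) (2 * h))
    z (z + pt c (n%:R * k)) (\sum_(i < n) (y i + link_cost u b C)).
Proof.
have [D0 k8 h8] := coarse_bounds; have k0 : 0 < k by lra.
move=> C0 tC yB; set A := ltube _ _ _ _ _.
have le_nk i : (i <= n)%N -> 0 <= i%:R * k <= n%:R * k.
  by move=> ilt; rewrite mulr_ge0 ?(ltW k0) //= ler_wpM2r ?(ltW k0) // ler_nat.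
have := @reach_chain _ _ t A (fun i => z + pt c (i%:R * k)) (fun i => y i + link_cost u b C) n.
rewrite /= mul0r pt0 addr0; apply.
  have := ltube_add_pt z 0; rewrite pt0 addr0; apply: ltubeS; try lra.
  have := le_nk 0%N isT; rewrite mul0r => /andP[_]; lra.
move=> i ilt; have /andP[i0 iN] := le_nk i (ltnW ilt).
have /andP[i0' iN'] := le_nk i.+1 ilt.
have ik : i.+1%:R * k = i%:R * k + k by rewrite -natr1 mulrDl mul1r.
apply: reach_trans (reachW _ (lexx _) (yB i ilt)) _.
  move=> w wB; have := ltube_trans wB (ltube_add_pt z (i%:R * k)).
  by apply: ltubeS; lra.
rewrite ik; apply: (@reach_link _ _ t A C) => //; first exact: norm1_pt_link.
by move=> w /ltube_near_pt; apply: ltubeS; lra.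
Qed.

(** A block extends [2 * k] to either side of its starting point, so starting points [5 * k] apart
    leave a gap of [k], more than the rounding errors [2 * D ^+ 2]. *)
Lemma block_disjoint z (i j : nat) e : (i + 5 <= j)%N ->
  edges_in (block (z + pt c (i%:R * k))) e ->
  ~ edges_in (block (z + pt c (j%:R * k))) e.
Proof.
have [D0 k8 h8] := coarse_bounds.
move=> ij [[/andP[_ i2] _] _] [[/andP[j1 _] _] _].
have [/andP[_ i1] _] := ltube_add_pt z (i%:R * k).
have [/andP[j2 _] _] := ltube_add_pt z (j%:R * k).
have : (i%:R + 5) * k <= j%:R * k by rewrite ler_wpM2r -?natrD ?ler_nat //; lra.
move: i1 i2 j1 j2; rewrite !axD !axN mulrDl; lra.
Qed.

Variables (dO : measure_display) (Omega : measurableType dO).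
Variables (P : probability Omega R) (tau : edge m.+1 -> {RV P >-> R}) (C : R).
Hypotheses (C0 : 0 <= C) (hX : iid_weights tau C).

Lemma prob_slow_shift z w a1 a2 h' s :
  prob tau (slow (ltube c z a1 a2 h') z (z + w) s) <=
  prob tau (slow (ltube c 0 a1 a2 h') 0 w s).
Proof.
have sK : cancel (@shift_edge m.+1 z) (shift_edge (- z)).
  by move=> [x i]; rewrite /shift_edge /= addrK.
have sK' : cancel (@shift_edge m.+1 (- z)) (shift_edge z).
  by move=> [x i]; rewrite /shift_edge /= subrK.
rewrite -[leRHS](prob_relabel hX sK sK' (sigma_on_slowT _ _ _ _)).
apply: (le_prob hX); first exact: sigma_on_slowT.
  by apply: (@sigma_on_relabel _ _ (shift_edge z) setT setT) => //;
    exact: sigma_on_slowT.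
move=> t _ nr /reach_shift; rewrite -ltube_shift add0r [w + z]addrC.
exact: nr.
Qed.

Variables (e T rate : R) (M : nat) (e0 : 0 < e) (rate0 : 0 <= rate).
Hypothesis tail : forall y : nat, (0 < y)%N ->
  prob tau (slow (block 0) 0 (pt c k) (T + y%:R * e)) <= expR (- (rate * y%:R)).
Hypothesis det : forall t, (forall e, 0 <= t e <= C) ->
  reach t (block 0) 0 (pt c k) (T + M%:R * e).

Lemma block_tail z (y : nat) :
  prob tau (slow (block z) z (z + pt c k) (T + y%:R * e)) <= expR (- (rate * y%:R)).
Proof.
apply: le_trans (prob_slow_shift _ _ _ _ _ _) _.
case: y => [|y]; last exact: tail.
rewrite mulr0 oppr0 expR0; exact: prob_le1 (sigma_on_slowT _ _ _ _).
Qed.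

Lemma block_det z t : (forall e, 0 <= t e <= C) ->
  reach t (block z) z (z + pt c k) (T + M%:R * e).
Proof.
move=> tC; have := @reach_shift _ _ t (block 0) z 0 (pt c k) (T + M%:R * e).
rewrite -ltube_shift add0r [_ + z]addrC; apply.
by apply: det => f /=.
Qed.

(** If [y] is the least level for which time [T + y%:R * e] suffices, then the level before it
    fails; at [y = 0] there is no such level and nothing is imposed. *)
Definition slow_block z (i y : nat) : set (edge m.+1 -> R) :=
  if y is y'.+1 then slow (block (z + pt c (i%:R * k))) (z + pt c (i%:R * k))
    (z + pt c (i%:R * k) + pt c k) (T + y'%:R * e)
  else setT.

Lemma sigma_on_slow_block z i y :
  sigma_on (edges_in (block (z + pt c (i%:R * k)))) (slow_block z i y).
Proof. by case: y => [|y]; [exact: sigma_onT|exact: sigma_on_slow]. Qed.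

Lemma prob_slow_block z i y :
  prob tau (slow_block z i y) <= expR (- (rate * (y.-1)%:R)).
Proof.
case: y => [|y]; last exact: block_tail.
rewrite /= mulr0 oppr0 expR0; apply: prob_le1; exact: sigma_onT.
Qed.

(* Blocks whose indices agree modulo 5 are independent, so the fifth power of
   the probability is at most the product over all the blocks. *)
Lemma prob_slow_blocks z n (y : 'I_n -> nat) :
  prob tau [set t | forall i : 'I_n, slow_block z i (y i) t] <=
  expR (- (rate * (\sum_i (y i).-1)%:R) / 5).
Proof.
set S := mkset _.
have mS (Q : pred 'I_n) :
    sigma_on setT [set t | forall i : 'I_n, Q i -> slow_block z i (y i) t].
  apply: (@sigma_on_bigcap _ _ _ _ (fun i : 'I_n => slow_block z i (y i)) Q) => i _.
  exact: sigma_onS (@sigma_on_slow_block z i (y i)).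
have mST : sigma_on setT S.
  by have := mS predT; congr sigma_on; apply/seteqP; split => t /= St i; [exact: St|move=> _; exact: St].
have pr (r : 'I_5) : prob tau S <= \prod_(i < n | inord (i %% 5) == r) prob tau (slow_block z i (y i)).
  rewrite -(prob_bigcap hX (F := fun i : 'I_n => edges_in (block (z + pt c (i%:R * k))))).
  - by apply: (le_prob hX) => // t _ St i _; exact: St.
  - by move=> i; exact: sigma_on_slow_block.
  - move=> i j f /eqP ir /eqP jr ij.
    have ij5 : i = j %[mod 5].
      by have := congr1 val (etrans ir (esym jr)); rewrite /= !inordK ?ltn_mod.
    have [lt|ge] := ltnP i j.
      by apply: block_disjoint; exact: modn5_gap.
    have lt : (j < i)%N by rewrite ltn_neqAle ge andbT eq_sym.
    move=> Fi Fj; apply: (block_disjoint _ Fj Fi).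
    exact: modn5_gap (esym ij5) lt.
rewrite -(@ler_pXn2r _ 5) ?nnegrE ?expR_ge0 ?prob_ge0 // -expRM_natl.
rewrite (_ : 5 * _ = - (rate * (\sum_i (y i).-1)%:R)); last first.
  by rewrite mulrCA mulfV ?mulr1.
apply: (@le_trans _ _ (\prod_(r < 5) prob tau S)).
  by rewrite prodr_const card_ord.
apply: (@le_trans _ _ (\prod_(r < 5) \prod_(i < n | inord (i %% 5) == r) prob tau (slow_block z i (y i)))).
  by apply: ler_prod => r _; rewrite prob_ge0 pr.
rewrite [leLHS](_ : _ = \prod_(i < n) prob tau (slow_block z i (y i))); last first.
  by rewrite [RHS](partition_big (fun i : 'I_n => inord (i %% 5) : 'I_5) predT).
apply: (@le_trans _ _ (\prod_(i < n) expR (- (rate * (y i).-1%:R)))).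
  by apply: ler_prod => i _; rewrite prob_ge0 prob_slow_block.
by rewrite -expR_sum sumrN -mulr_sumr natr_sum.
Qed.

(** A union bound over the vectors of least levels of the blocks. By [det] each level is at most
    [M], and if the line misses its budget the sum of the levels is large. *)
Lemma slow_line_bound z n s :
  prob tau (slow (ltube c z (- (3 * k)) ((n%:R + 3) * k) (2 * h))
    z (z + pt c (n%:R * k)) (n%:R * T + s)) <=
  M.+1%:R ^+ n * expR (- (rate * ((s - n%:R * link_cost u b C) / e - n%:R)) / 5).
Proof.
(* One level per block is lost, since a block of least level l is only known to fail at l - 1. *)
set q := (_ - n%:R).
set S := slow _ _ _ _.
pose good (y : {ffun 'I_n -> 'I_M.+1}) := q <= (\sum_i (y i).-1)%:R.
have mB (y : {ffun 'I_n -> 'I_M.+1}) :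
    sigma_on setT [set t | forall i : 'I_n, slow_block z i (y i) t].
  have := @sigma_on_bigcap _ _ _ setT (fun i : 'I_n => slow_block z i (y i)) setT.
  move=> H; rewrite (_ : mkset _ = [set t | forall j : 'I_n, setT j -> slow_block z j (y j) t]).
    by apply: H => i _; exact: sigma_onS (@sigma_on_slow_block z i (y i)).
  by apply/seteqP; split => t St i //=; exact: St.
apply: le_trans (prob_union hX (D := good)
  (B := fun y => [set t | forall i : 'I_n, slow_block z i (y i) t]) _ mB _) _.
- exact: sigma_on_slowT.
- move=> t tC St.
  have ex i : exists l : nat, (l <= M)%N && `[< reach t (block (z + pt c (i%:R * k)))
      (z + pt c (i%:R * k)) (z + pt c (i%:R * k) + pt c k) (T + l%:R * e) >].
    by exists M; rewrite leqnn; apply/asboolP; exact: block_det.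
  pose lv i := ex_minn (ex i).
  have lvP i : [/\ (lv i <= M)%N, reach t (block (z + pt c (i%:R * k)))
      (z + pt c (i%:R * k)) (z + pt c (i%:R * k) + pt c k) (T + (lv i)%:R * e) &
      slow_block z i (lv i) t].
    rewrite /lv; case: ex_minnP => l /andP[lM /asboolP lr] lmin; split => //.
    case: l lM lr lmin => //= l lM _ lmin rl.
    have := lmin l; rewrite ltnn => H; suff : false by [].
    by apply: H; rewrite (ltnW lM); apply/asboolP.
  exists [ffun i : 'I_n => inord (lv i)]; last first.
    move=> i; rewrite ffunE inordK; first by case: (lvP i).
    by rewrite ltnS; case: (lvP i).
  rewrite /good (eq_bigr (fun i : 'I_n => (lv i).-1)); last first.
    by move=> i _; rewrite ffunE inordK // ltnS; case: (lvP i).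
  rewrite leNgt; apply/negP => lt; apply: St.
  have := @line_reach C t z n (fun i => T + (lv i)%:R * e) C0 tC.
  move=> /(_ (fun i _ => let: And3 _ r _ := lvP i in r)).
  apply: reachW => //.
  have -> : \sum_(i < n) (T + (lv i)%:R * e + link_cost u b C) =
      n%:R * T + (\sum_(i < n) (lv i)%:R) * e + n%:R * link_cost u b C.
    by rewrite !big_split /= !sumr_const !card_ord -mulr_suml
      !mulr_natl.
  have le_lv : \sum_(i < n) (lv i)%:R <= (\sum_(i < n) (lv i).-1)%:R + n%:R :> R.
    have n1 : n = (\sum_(i < n) 1)%N by rewrite sum1_card card_ord.
    rewrite -natrD [X in (_ + X)%N]n1 -big_split /= -natr_sum ler_nat.
    by apply: leq_sum => i _; rewrite addn1 leqSpred.
  have : (\sum_(i < n) (lv i)%:R) * e <= s - n%:R * link_cost u b C.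
    rewrite -ler_pdivlMr //; apply: (le_trans le_lv); move: lt; rewrite /q; lra.
  lra.
apply: (@le_trans _ _ (\sum_(y : {ffun 'I_n -> 'I_M.+1}) expR (- (rate * q) / 5))).
  rewrite [leRHS](bigID good) /= -[leLHS]addr0; apply: lerD; last first.
    by apply: sumr_ge0 => y _; exact: expR_ge0.
  apply: ler_sum => y gy; apply: le_trans (prob_slow_blocks _ _) _.
  by rewrite ler_expR ler_wpM2r ?invr_ge0 // lerN2 ler_wpM2l.
by rewrite sumr_const card_ffun !card_ord -[_ *+ _]mulr_natl natrX.
Qed.

End Line.

(** * Real powers and logarithms *)

Section PowerBounds.
Variable R : realType.
Implicit Types x y w K A p r s : R.

Lemma powRDp x r s : 0 < x -> x `^ (r + s) = x `^ r * x `^ s.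
Proof. by move=> x0; rewrite powRD // (gt_eqF x0) implybT. Qed.

Lemma le_powR_base r x y : 0 <= r -> 0 <= x -> x <= y -> x `^ r <= y `^ r.
Proof.
by move=> r0 x0 xy; apply: ge0_ler_powR; rewrite ?nnegrE // (le_trans x0).
Qed.

Lemma powR_le_inv r x w : 0 < r -> 0 <= x -> 0 <= w ->
  (x <= w `^ r^-1) = (x `^ r <= w).
Proof.
move=> r0 x0 w0; apply/idP/idP => [xw|xw].
  apply: le_trans (le_powR_base (ltW r0) x0 xw) _.
  by rewrite -powRrM mulVf ?gt_eqF // powRr1.
rewrite -[leLHS](powRr1 x0) -(@mulfV _ r) ?gt_eqF // powRrM.
by apply: le_powR_base; rewrite ?invr_ge0 ?powR_ge0 // ltW.
Qed.

Lemma near_pinfty_ex (Q : R -> Prop) (A : R) : (\forall K \near +oo, Q K) ->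
  exists2 K0, A <= K0 & forall K, K0 <= K -> Q K.
Proof.
move=> [M [_ MQ]]; exists (Num.max A (M + 1)); first by rewrite le_max lexx.
by move=> K; rewrite ge_max => /andP[_ MK]; apply: MQ; lra.
Qed.

Lemma near_powR_ge A p : 0 < p -> \forall K \near +oo, A <= K `^ p.
Proof.
move=> p0; exists (Num.max A 0 `^ p^-1); split; first exact: num_real.
move=> K AK; have A0 : 0 <= Num.max A 0 by rewrite le_max lexx orbT.
apply: (@le_trans _ _ (Num.max A 0)); first by rewrite le_max lexx.
rewrite -[leLHS](powRr1 A0) -(@mulVf _ p) ?gt_eqF // powRrM.
by apply: le_powR_base; rewrite ?powR_ge0 ?ltW.
Qed.

Lemma ln_le_id x : 0 < x -> ln x <= x.
Proof.
move=> x0; have := @le_ln1Dx R (x - 1); rewrite addrCA subrr addr0 => h.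
by apply: le_trans (h _) _; lra.
Qed.

Lemma near_ln_le p : 0 < p -> \forall K \near +oo, ln K <= K `^ p.
Proof.
move=> p0; have p20 : 0 < p / 2 by rewrite divr_gt0.
near=> K.
have K0 : 0 < K by near: K; apply: nbhs_pinfty_gt; exact: num_real.
have lnK : (p / 2) * ln K <= K `^ (p / 2) by rewrite -ln_powR; by rewrite ln_le_id ?powR_gt0.
have K2 : (p / 2)^-1 <= K `^ (p / 2) by near: K; apply: near_powR_ge.
rewrite (splitr p) powRDp //; move: lnK; rewrite mulrC -ler_pdivlMr // => lnK.
by apply: (le_trans lnK); rewrite ler_wpM2l ?powR_ge0.
Unshelve. all: by end_near. Qed.

Lemma powR_split x r : 0 < x -> x `^ r * x `^ (1 - r) = x.
Proof.
by move=> x0; rewrite -powRDp // addrC subrK powRr1 // ltW.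
Qed.

Lemma powR_ge1 x r : 1 <= x -> 0 <= r -> 1 <= x `^ r.
Proof. by move=> x1 r0; rewrite -(powRr0 x); exact: ler_powR. Qed.

Lemma powR_le1 x r : 1 <= x -> r <= 0 -> x `^ r <= 1.
Proof. by move=> x1 r0; rewrite -(powRr0 x); exact: ler_powR. Qed.

Lemma powR_le_cancel r x y : 0 < r -> 0 <= x -> 0 <= y -> x `^ r <= y `^ r -> x <= y.
Proof.
move=> r0 x0 y0 xy; rewrite leNgt; apply/negP => yx.
by have := gt0_ltr_powR r0 y0 x0 yx; rewrite ltNge xy.
Qed.

End PowerBounds.

(** * Choice of the number of blocks and of levels *)

Lemma tail_exponent (R : realType) (n nX n1 y rate l g lnM : R) : n = nX * n1 -> 15 <= nX ->
  0 <= n -> lnM <= g -> 1 <= g -> n1 * (15 * g) <= rate * y -> 0 < rate ->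
  0 <= l -> rate * (l + 1) <= 1 -> 0 <= y ->
  n * lnM + - (rate * (y * nX - n * l - n)) / 5 <= - (rate * y).
Proof.
move=> nE nX15 n0 lnMg g1 n1w r0 l0 rl y0.
(* The gain is a fifth of [nX * (rate * y)], which is at least [3 * (n * g)]: ample for the entropy
   [n * lnM] and the linking loss, while [15 <= nX] leaves room for [rate * y]. *)
have h1 : n * lnM <= n * g by rewrite ler_wpM2l.
have h2 : 15 * (n * g) <= nX * (rate * y).
  rewrite (_ : 15 * (n * g) = nX * (n1 * (15 * g))); last by rewrite nE; ring.
  by rewrite ler_wpM2l // (le_trans _ nX15).
have h3 : rate * (l + 1) * n <= 1 * n by rewrite ler_wpM2r.
have h4 : n * 1 <= n * g by rewrite ler_wpM2l.
have h5 : 15 * (rate * y) <= nX * (rate * y).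
  by rewrite ler_wpM2r // mulr_ge0 // ltW.
have h6 : 0 <= rate * y by rewrite mulr_ge0 // ltW.
move: h1 h2 h3 h4 h5 h6; clear; move: (n * g) (n * lnM) => p q.
rewrite (_ : rate * (y * nX - n * l - n) = nX * (rate * y) - rate * (l + 1) * n); last ring.
move: (nX * (rate * y)) (rate * (l + 1) * n) (rate * y) => *; lra.
Qed.

(* The number [n] of blocks for the excess [y]: the excess per block, measured
   in units of the scale [K / n], is of order [K ^ (th / 2)]. *)
Lemma tail_scale (R : realType) (X th K K1 y rate cost : R) :
  let g := K `^ (th / 2) in
  0 < X < 1 -> 0 < rate -> 1 <= K1 -> 0 < K -> 0 <= y -> 0 <= cost ->
  1 <= g -> 15 * (5 + 15 `^ X^-1) `^ (1 - X) <= g ->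
  K `^ th < rate * y -> y < cost * K `^ (1 - X) ->
  rate * K1 * (cost + 1) <= 1 ->
  exists n : nat, [/\ (4 <= n)%N, 15 <= n%:R `^ X,
    n%:R `^ (1 - X) * (15 * g) <= rate * y & n%:R * K1 <= K].
Proof.
move=> g /andP[X0 X1] rate0 K11 K0 y0 cost0 g1 Kn ry yc rateK1.
have X1' : 0 < 1 - X by lra.
set N0 := 5 + _ in Kn.
pose w := rate * y / (15 * g).
have gth : g * g = K `^ th by rewrite -powRDp -?splitr.
have g15 : 0 < 15 * g by lra.
have wg : w * (15 * g) = rate * y by rewrite divfK // gt_eqF.
have ry0 : 0 <= rate * y by rewrite mulr_ge0 // ltW.
have w0 : 0 <= w by rewrite divr_ge0 // ltW.
have N0w : N0 `^ (1 - X) <= w.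
  rewrite ler_pdivlMr //; apply: le_trans (ltW ry); rewrite -gth mulrA [_ * 15]mulrC.
  by rewrite ler_wpM2r // (le_trans _ g1).
have s0 : 0 <= 15 `^ X^-1 :> R by exact: powR_ge0.
have N00 : 0 <= N0 by rewrite addr_ge0.
pose n := Num.truncn (w `^ (1 - X)^-1).
have /andP[nw wn] := truncn_itv (powR_ge0 w (1 - X)^-1).
rewrite -/n in nw wn.
have N0n : N0 <= n%:R + 1.
  by rewrite -natr1 in wn; apply: le_trans (ltW wn); rewrite powR_le_inv.
have n4 : (4 <= n)%N by rewrite -(ler_nat R); move: N0n; rewrite /N0; lra.
have n1w : n%:R `^ (1 - X) <= w by rewrite -powR_le_inv.
exists n; split => //.
- have <- : (15 `^ X^-1) `^ X = 15 :> R by rewrite -powRrM mulVf ?gt_eqF // powRr1.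
  by apply: le_powR_base; [exact: ltW| |move: N0n; rewrite /N0; lra].
- by rewrite -wg ler_wpM2r // ltW.
- have K1p : 0 <= K1 by rewrite (le_trans _ K11).
  apply: (@powR_le_cancel _ (1 - X)) => //; [exact: mulr_ge0|exact: ltW|].
  rewrite powRM //.
  have K1X : K1 `^ (1 - X) <= K1 by apply: ler1_powR => //; lra.
  apply: (@le_trans _ _ (w * K1)); first by rewrite ler_pM ?powR_ge0.
  apply: (@le_trans _ _ (rate * y * K1)).
    by rewrite ler_wpM2r // -wg ler_peMr //; lra.
  rewrite mulrAC; apply: (@le_trans _ _ (rate * K1 * (cost * K `^ (1 - X)))).
    by rewrite ler_wpM2l ?(ltW yc) // mulr_ge0 // ltW.
  rewrite mulrA -[leRHS]mul1r ler_wpM2r ?powR_ge0 //.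
  by apply: le_trans rateK1; rewrite ler_wpM2l ?mulr_ge0 ?(ltW rate0) // lerDl.
Qed.

(** [M] levels of size k^X cover the deterministic cost of a block, and there are few enough of them
    for the union bound to cost only ln K per block. *)
Lemma level_count (R : realType) (X k K cost : R) :
  0 < X < 1 -> 0 < k <= K -> 1 <= K -> 0 <= cost -> cost + 2 <= K `^ X ->
  exists M : nat, cost * k `^ (1 - X) <= M%:R /\ M.+1%:R <= K.
Proof.
move=> /andP[X0 X1] /andP[k0 kK] K1 cost0 Kcost.
exists (Num.truncn (cost * k `^ (1 - X))).+1.
have /truncn_itv/andP[h1 h2] : 0 <= cost * k `^ (1 - X) by rewrite mulr_ge0 ?powR_ge0.
split; first exact: ltW.
have : cost * k `^ (1 - X) <= cost * K `^ (1 - X).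
  by rewrite ler_wpM2l // le_powR_base // ?(ltW k0) //; lra.
have KX : 1 <= K `^ (1 - X) by apply: powR_ge1 => //; lra.
have : (cost + 2) * K `^ (1 - X) <= K.
  by rewrite -[leRHS](@powR_split _ _ X) ?ler_wpM2r ?powR_ge0 //; lra.
rewrite -!natr1 mulrDl; lra.
Qed.

Lemma line_total (R : realType) (M n : nat) (X k y rate l g : R) :
  0 < X < 1 -> 1 <= k -> (0 < n)%N -> M.+1%:R <= n%:R * k -> ln (n%:R * k) <= g ->
  1 <= g -> 15 <= n%:R `^ X -> n%:R `^ (1 - X) * (15 * g) <= rate * y ->
  0 < rate -> 0 <= l -> rate * (l + 1) <= 1 -> 0 <= y ->
  M.+1%:R ^+ n *
    expR (- (rate * ((y * (n%:R * k) `^ X - n%:R * l) / k `^ X - n%:R)) / 5) <=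
  expR (- (rate * y)).
Proof.
move=> /andP[X0 X1] k1 n0 MK lng g1 nX15 n1w rate0 l0 rl y0.
have n0' : 0 < n%:R :> R by rewrite ltr0n.
have k0 : 0 < k by lra.
have nk0 : 0 < n%:R * k by rewrite mulr_gt0.
have kX1 : 1 <= k `^ X by apply: powR_ge1 => //; lra.
apply: (@le_trans _ _ (expR (n%:R * ln (n%:R * k)) *
    expR (- (rate * (y * n%:R `^ X - n%:R * l - n%:R)) / 5))).
  apply: ler_pM; rewrite ?exprn_ge0 ?expR_ge0 //.
    by rewrite expRM_natl lnK ?posrE // lerXn2r ?nnegrE // ltW.
  rewrite ler_expR ler_wpM2r ?invr_ge0 // lerN2 ler_wpM2l ?(ltW rate0) //.
  rewrite lerD2r ler_pdivlMr ?(lt_le_trans _ kX1) // mulrBl -mulrA.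
  rewrite -powRM ?(ltW k0) ?(ltW n0') // lerD2l lerN2.
  by rewrite ler_peMr // mulr_ge0 // ltW.
rewrite -expRD ler_expR.
by apply: (@tail_exponent _ _ (n%:R `^ X) (n%:R `^ (1 - X)) _ _ _ g) => //;
  rewrite powR_split.
Qed.

(** * First amplification: tails exponential in the rescaled excess *)

Section LinearTail.
Variables (R : realType) (m : nat).
Variables (u : 'rV[R]_m.+1) (b : 'I_m.+1 -> 'rV[R]_m.+1).
Hypothesis hb : orthonormal_basis b.
Hypothesis b0u : 0 < dot (b ord0) u.
Local Notation ltube := (ltube u b).
Local Notation pt := (pt u b).
Variables (dO : measure_display) (Omega : measurableType dO).
Variables (P : probability Omega R) (tau : edge m.+1 -> {RV P >-> R}) (C : R).
Hypotheses (C0 : 0 <= C) (hX : iid_weights tau C).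
Variables (T : ('I_m -> R) -> R) (T_ge0 : forall c, 0 <= T c).

Lemma prob_slow_null A x y s : (forall t, (forall e, 0 <= t e <= C) -> reach t A x y s) ->
  prob tau (slow A x y s) = 0.
Proof.
move=> rA; apply/eqP; rewrite eq_le prob_ge0 andbT.
have -> : 0 = prob tau set0 by rewrite /prob measure0.
apply: (le_prob hX); first exact: sigma_on_slowT.
  exact: (@measurable0 _ (config_space R setT)).
by move=> t /rA r nr; apply: nr.
Qed.

Lemma prob_slowS A A' x y s s' : A `<=` A' -> s <= s' ->
  prob tau (slow A' x y s') <= prob tau (slow A x y s).
Proof.
move=> AA' ss'; apply: (le_prob hX); [exact: sigma_on_slowT|exact: sigma_on_slowT|].
by move=> t _ nr r; apply: nr; exact: reachW r.
Qed.

Definition cell X c K := ltube c 0 (- (2 * K)) (2 * K) (K `^ ((X + 1) / 2)).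

(** Four blocks are asked for because of the width: the exponent [(X + 1) / 2] exceeds 1/2, and
    4^(1/2) = 2 is the widening of a line. *)
Lemma cell_line X c k n : 0 < X < 1 -> 0 < k -> (4 <= n)%N ->
  ltube c 0 (- (3 * k)) ((n%:R + 3) * k) (2 * k `^ ((X + 1) / 2)) `<=`
  cell X c (n%:R * k).
Proof.
move=> /andP[X0 X1] k0 n4; have n4' : 4 <= n%:R :> R by rewrite (ler_nat _ 4).
have nk : 4 * k <= n%:R * k by rewrite ler_wpM2r // ltW.
apply: ltubeS; [lra|rewrite mulrDl; lra|].
rewrite powRM ?(ltW k0) // ler_wpM2r ?powR_ge0 //.
apply: (@le_trans _ _ (4 `^ ((X + 1) / 2))); last by rewrite le_powR_base //; lra.
have e2 : 2 = 4 `^ (2^-1) :> R.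
  by rewrite powR12_sqrt // (_ : 4 = 2 ^+ 2 :> R) ?sqrtr_sqr ?ger0_norm //; ring.
rewrite {1}e2.
by apply: ler_powR; lra.
Qed.

Lemma cell_det X c K t y : 0 < K -> cnorm c <= 1 -> coarse u b <= K ->
  coarse u b <= K `^ ((X + 1) / 2) -> (forall e, 0 <= t e <= C) ->
  2 * link_cost u b C * K `^ (1 - X) <= y ->
  reach t (cell X c K) 0 (pt c K) (K * T c + y * K `^ X).
Proof.
move=> K0 c1 Kc Kh tC yc.
have := @reach_bounded _ _ u b hb b0u C t c 0 K (K `^ ((X + 1) / 2)) C0 tC c1 Kc Kh.
rewrite add0r; apply: reachW => //.
rewrite -[leLHS]add0r; apply: lerD; first by rewrite mulr_ge0 // ltW.
by rewrite -{1}(@powR_split _ K X) // [K `^ X * _]mulrC mulrA ler_wpM2r ?powR_ge0.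
Qed.

Lemma tail_step X c k n M y rate g : 0 < X < 1 -> cnorm c <= 1 -> 1 <= k ->
  coarse u b <= k -> coarse u b <= k `^ ((X + 1) / 2) -> (4 <= n)%N ->
  0 < rate -> rate * (link_cost u b C + 1) <= 1 -> 0 <= y -> 1 <= g ->
  ln (n%:R * k) <= g -> 15 <= n%:R `^ X ->
  n%:R `^ (1 - X) * (15 * g) <= rate * y ->
  2 * link_cost u b C * k `^ (1 - X) <= M%:R -> M.+1%:R <= n%:R * k ->
  (forall y : R, 1 <= y -> prob tau (slow (cell X c k) 0 (pt c k)
     (k * T c + y * k `^ X)) <= expR (- (rate * y))) ->
  prob tau (slow (cell X c (n%:R * k)) 0 (pt c (n%:R * k))
     (n%:R * k * T c + y * (n%:R * k) `^ X)) <= expR (- (rate * y)).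
Proof.
move=> X01 c1 k1 kc kh n4 rate0 rl y0 g1 lng nX15 n1w cM MK tail.
have k0 : 0 < k by rewrite (lt_le_trans ltr01).
have kX0 : 0 < k `^ X by rewrite powR_gt0.
have l0 : 0 <= link_cost u b C.
  by rewrite /link_cost !mulr_ge0 // (le_trans _ (D_ge1 b0u)).
have := @slow_line_bound _ _ u b hb b0u c c1 k (k `^ ((X + 1) / 2)) kc kh
  _ _ P tau C C0 hX (k `^ X) (k * T c) rate M kX0 (ltW rate0) _ _ 0 n (y * (n%:R * k) `^ X).
rewrite add0r [n%:R * (k * T c)]mulrA => hline.
apply: le_trans (le_trans (hline _ _) _).
- by apply: prob_slowS; [exact: cell_line|exact: lexx].
- by move=> z z0; apply: tail; rewrite ler1n.
- by move=> t tC; apply: cell_det.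
- by apply: (@line_total _ M n X k y rate _ g) => //; exact: leq_trans n4.
Qed.

(** Small [y] is covered by the hypothesis and large [y] by the deterministic bound; in between the
    stretch is cut into blocks, to which the induction applies. The condition on [c] passes to
    shorter blocks, since K^(-sig) decreases in K. *)
Lemma linear_tail X th sig K0 : 0 < X < 1 -> 0 < th -> 0 < sig ->
  (forall K c, K0 <= K -> cnorm c < K `^ (- sig) ->
    prob tau (slow (cell X c K) 0 (pt c K) (K * T c + K `^ X)) <= expR (- K `^ th)) ->
  exists K1 rate, [/\ 1 <= K1, 0 < rate & forall K c y, K1 <= K ->
    cnorm c < K `^ (- sig) -> 1 <= y ->
    prob tau (slow (cell X c K) 0 (pt c K) (K * T c + y * K `^ X)) <=
      expR (- (rate * y))].
Proof.
move=> X01 th0 sig0 hyp; have /andP[X0 X1] := X01.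
pose l := link_cost u b C; pose cost := 2 * l.
have D1 := D_ge1 b0u.
have l0 : 0 <= l.
  by rewrite /l /link_cost !mulr_ge0 // (le_trans _ D1).
have cost0 : 0 <= cost by rewrite /cost mulr_ge0.
have coarse8 : 8 <= coarse u b by rewrite /coarse ler_peMr // expr_ge1 // (le_trans _ D1).
have [K1 K1ge K1P] : exists2 K1, Num.max K0 (coarse u b) <= K1 & forall K, K1 <= K ->
    [/\ coarse u b <= K `^ ((X + 1) / 2),
     15 * (5 + 15 `^ X^-1) `^ (1 - X) <= K `^ (th / 2),
     1 <= K `^ (th / 2), ln K <= K `^ (th / 2) & cost + 2 <= K `^ X].
  apply: near_pinfty_ex; clear hyp D1 coarse8; near=> K.
  by split; near: K; do [apply: near_powR_ge; lra|apply: near_ln_le; lra].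
move: K1ge; rewrite ge_max => /andP[K10 K1c].
have K18 : 8 <= K1 := le_trans coarse8 K1c.
have K1_1 : 1 <= K1 by apply: le_trans K18; rewrite (ler_nat _ 1 8).
have K1_0 : 0 < K1 := lt_le_trans ltr01 K1_1.
(* The three factors keep the linking loss per block at most 1 and the blocks at least [K1] long. *)
pose rate := ((l + 1) * (cost + 1) * K1)^-1.
have l1 : 1 <= l + 1 by rewrite lerDr.
have cost1 : 1 <= cost + 1 by rewrite lerDr.
have l1' : 0 < l + 1 := lt_le_trans ltr01 l1.
have cost1' : 0 < cost + 1 := lt_le_trans ltr01 cost1.
have rate0 : 0 < rate by rewrite invr_gt0 !mulr_gt0.
have rateK1 : rate * K1 * (cost + 1) <= 1.
  rewrite /rate (_ : _ * _ = (l + 1)^-1); first by rewrite invf_le1.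
  by field; rewrite !gt_eqF.
have ratel : rate * (l + 1) <= 1.
  rewrite /rate (_ : _ * _ = ((cost + 1) * K1)^-1).
    by rewrite invf_le1 ?mulr_gt0 // mulr_ege1.
  by field; rewrite !gt_eqF.
exists K1, rate; split => //.
(* Induction on the real length [K] through integer upper bounds; blocks satisfy [4 * k <= K] and
   [1 <= k], so the bound drops by at least one. *)
suff H j : forall K c y, K < j%:R -> K1 <= K -> cnorm c < K `^ (- sig) -> 1 <= y ->
    prob tau (slow (cell X c K) 0 (pt c K) (K * T c + y * K `^ X)) <= expR (- (rate * y)).
  move=> K c y K1K; apply: (H (Num.truncn K).+1) => //.
  by have /truncn_itv/andP[] : 0 <= K by rewrite (le_trans _ K1K) // ltW.
elim: j => [K c y K0' K1K|j IH K c y Kj K1K cK y1].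
  by have := lt_le_trans K1_0 (le_trans K1K (ltW K0')); rewrite ltxx.
have [Kh Kn K1' Kln Kcost] := K1P K K1K.
have K_1 : 1 <= K := le_trans K1_1 K1K.
have K_0 : 0 < K := lt_le_trans ltr01 K_1.
have y0 : 0 <= y := le_trans ler01 y1.
have c1 : cnorm c <= 1.
  by apply: (le_trans (ltW cK)); apply: powR_le1 => //; rewrite oppr_le0 ltW.
have [ry|ry] := leP (rate * y) (K `^ th).
  apply: (@le_trans _ _ (expR (- K `^ th))); last by rewrite ler_expR lerN2.
  apply: le_trans (hyp K c (le_trans K10 K1K) cK).
  by apply: prob_slowS => //; rewrite lerD2l ler_peMl // powR_ge0.
have [yc|yc] := leP (cost * K `^ (1 - X)) y.
  rewrite prob_slow_null ?expR_ge0 // => t tC.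
  by apply: cell_det => //; exact: le_trans K1K.
have [n [n4 nX15 n1w nK1]] :=
  @tail_scale R X th K K1 y rate cost X01 rate0 K1_1 K_0 y0 cost0 K1' Kn ry yc rateK1.
have n4' : 4 <= n%:R :> R by rewrite (ler_nat _ 4).
have n0' : 0 < n%:R :> R by rewrite (lt_le_trans _ n4').
pose k := K / n%:R.
have nk : n%:R * k = K by rewrite mulrC divfK // gt_eqF.
have K1k : K1 <= k by rewrite ler_pdivlMr // mulrC.
have k0 : 0 < k := lt_le_trans K1_0 K1k.
have kK : 4 * k <= K by rewrite -[leRHS]nk ler_wpM2r // ltW.
have kK' : k <= K by apply: le_trans kK; rewrite ler_peMl ?(ltW k0) // (ler_nat _ 1).
have ck : cnorm c < k `^ (- sig).
  apply: (lt_le_trans cK); rewrite !powRN lef_pV2 ?posrE ?powR_gt0 //.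
  by apply: le_powR_base => //; exact: ltW.
have [kh _ _ _ _] := K1P k K1k.
have kK01 : 0 < k <= K by rewrite k0.
have [M [cM MK]] := @level_count R X k K cost X01 kK01 K_1 cost0 Kcost.
have kj : k < j%:R.
  rewrite -(ltrD2r 1) natr1; apply: le_lt_trans Kj; apply: le_trans kK.
  rewrite (_ : 4 * k = k + 3 * k); last by ring.
  by rewrite lerD2l mulr_ege1 ?ler1n // (le_trans K1_1).
rewrite -{1 2 3 4}nk; apply: (@tail_step X c k n M y rate (K `^ (th / 2))) => //;
  rewrite ?nk //.
- exact: le_trans K1k.
- exact: le_trans K1k.
- by move=> z z1; exact: IH.
Unshelve. all: by end_near.
Qed.

End LinearTail.

(** * Second amplification: a bundle of parallel lines between two points *)

Section Bundle.
Variables (R : realType) (m : nat).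
Variables (u : 'rV[R]_m.+1) (b : 'I_m.+1 -> 'rV[R]_m.+1).
Hypothesis hb : orthonormal_basis b.
Hypothesis b0u : 0 < dot (b ord0) u.
Local Notation D := (distortion u b).
Local Notation ltube := (ltube u b).
Local Notation pt := (pt u b).
Local Notation hvec := (hvec u b).
Local Notation "'L' x" := (of_lattice R x) (at level 8, x at level 8).
Implicit Types (c o : 'I_m -> R) (A : set (vertex m.+1)).

Lemma norm_le_max (a x y : R) : x <= a <= y -> `|a| <= Num.max `|x| `|y|.
Proof.
case/andP => w1 w2; rewrite ler_norml; apply/andP; split; last first.
  by apply: le_trans w2 _; rewrite le_max ler_norm orbT.
rewrite lerNl; apply: (@le_trans _ _ (- x)); first by rewrite lerN2.
by rewrite le_max -normrN ler_norm.
Qed.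

Lemma ltube_change c c' z a1 a2 h h' w : ltube c' z a1 a2 h w ->
  (forall j, Num.max `|a1| `|a2| * `|c j - c' j| + h <= h') ->
  ltube c z a1 a2 h' w.
Proof.
move=> [wa wl] hh'; split => // j; rewrite (lat_change _ _ c').
apply: le_trans (ler_normD _ _) _; apply: le_trans (hh' j); rewrite addrC.
by apply: lerD (wl j); rewrite normrM distrC ler_wpM2r // norm_le_max.
Qed.

Variables (c : 'I_m -> R) (N r k h hr W H : R) (n : nat).
Hypotheses (r_coarse : coarse u b <= r) (h_coarse : coarse u b <= h)
  (rN : 8 * r <= N) (k0 : 0 < k) (kN : 6 * k <= N) (nk : n%:R * k = N - 2 * r)
  (W0 : 0 <= W) (Wr : W <= r) (cW : cnorm c + m%:R * (W / r) <= 1)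
  (HW : hr + 2 * h + 5 * W <= H) (hr_coarse : 2 * coarse u b <= hr).

(** Over a length [r] this change of slope produces the lateral displacement [o]. *)
Definition tilt o c' : 'I_m -> R := fun j => c' j + o j / r.

Lemma bundle_r_gt0 : 0 < r.
Proof.
apply: lt_le_trans r_coarse; rewrite /coarse mulr_gt0 // exprn_gt0 //.
exact: lt_le_trans ltr01 (D_ge1 b0u).
Qed.

Lemma cnorm_tilt o c' : (forall j, `|o j| <= W) ->
  cnorm (tilt o c') <= cnorm c' + m%:R * (W / r).
Proof.
move=> oW; have r0 := bundle_r_gt0; have -> : m%:R * (W / r) = \sum_(j < m) W / r.
  by rewrite sumr_const card_ord -[RHS]mulr_natl.
rewrite /cnorm -big_split; apply: ler_sum => j _ /=.
apply: le_trans (ler_normD _ _) _; rewrite lerD2l normrM normfV (gtr0_norm r0).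
by rewrite ler_wpM2r ?invr_ge0 // ltW.
Qed.

Lemma tilt_diff o c' j : (forall j, `|o j| <= W) ->
  `|c' j - tilt o c' j| <= W / r.
Proof.
move=> oW; have r0 := bundle_r_gt0.
rewrite /tilt opprD addrA subrr add0r normrN normrM normfV (gtr0_norm r0).
by rewrite ler_wpM2r ?invr_ge0 // ltW.
Qed.

Lemma ltube_tilt o z h' w : (forall j, `|o j| <= W) ->
  ltube (tilt o c) z (- (2 * r)) (2 * r) h' w ->
  ltube c z (- (2 * r)) (2 * r) (h' + 2 * W) w.
Proof.
move=> oW /ltube_change; apply => j; have r0 := bundle_r_gt0.
rewrite normrN maxxx ger0_norm ?mulr_ge0 // ?(ltW r0) // addrC lerD2l.
apply: (@le_trans _ _ (2 * r * (W / r))).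
  by rewrite ler_wpM2l ?mulr_ge0 ?(ltW r0) // tilt_diff.
by rewrite -mulrA [r * _]mulrC divfK // gt_eqF.
Qed.

Lemma D2_coarse : [/\ 0 < D ^+ 2, 8 * D ^+ 2 <= r, 8 * D ^+ 2 <= h &
  16 * D ^+ 2 <= hr] /\
  [/\ 8 * r <= N, 6 * k <= N, 0 <= W, W <= r & hr + 2 * h + 5 * W <= H].
Proof.
split; split => //; first by rewrite exprn_gt0 // (lt_le_trans ltr01) ?D_ge1.
by move: hr_coarse; rewrite /coarse; lra.
Qed.

(* [start o] is where the line with lateral offset [o] begins, and [finish o]
   is the reflected point from which a translate of a path from the origin
   ends exactly at [pt c N]. *)
Definition start o := pt (tilt o c) r.
Definition finish o := pt c N - pt (tilt (\- o) c) r.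

Lemma normN_offset o : (forall j, `|o j| <= W) -> forall j, `|(\- o) j| <= W.
Proof. by move=> oW j /=; rewrite normrN. Qed.

Lemma start_near o : (forall j, `|o j| <= W) ->
  ltube c 0 (r - D ^+ 2) (r + D ^+ 2) (D ^+ 2 + 2 * W) (start o).
Proof.
move=> oW; have r0 := bundle_r_gt0; have [[D0 Dr _ _] [rN' kN' W0' Wr' HW']] := D2_coarse.
have c1 : cnorm (tilt o c) <= 1 by apply: le_trans (cnorm_tilt _ oW) cW.
have H0 := ltube_pt hb b0u r c1.
have /ltube_tilt H1 : ltube (tilt o c) 0 (- (2 * r)) (2 * r) (D ^+ 2) (start o).
  by apply: ltubeS H0; lra.
by split; [case: H0|case: (H1 oW)].
Qed.

Lemma finish_near o : (forall j, `|o j| <= W) ->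
  ltube c 0 (N - r - 2 * D ^+ 2) (N - r + 2 * D ^+ 2) (2 * D ^+ 2 + 2 * W) (finish o).
Proof.
move=> oW; have [/andP[s1 s2] sl] := start_near (normN_offset oW).
have c1 : cnorm c <= 1.
  by apply: le_trans cW; rewrite lerDl !mulr_ge0 // invr_ge0 ltW // bundle_r_gt0.
have [/andP[p1 p2] pl] := ltube_pt hb b0u N c1.
have E : L (finish o) - L 0 = (L (pt c N) - L 0) - (L (start (\- o)) - L 0).
  by rewrite /finish of_latticeB of_lattice0 !subr0.
split; first by rewrite E axD axN; apply/andP; split; lra.
move=> j; rewrite E latD latN; apply: le_trans (ler_normB _ _) _.
have := sl j; have := pl j; lra.
Qed.

Lemma hvec_tilt o c' :
  r *: hvec (tilt o c') = r *: hvec c' + \sum_j o j *: tangent b j.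
Proof.
have r0 := bundle_r_gt0.
rewrite !scalerDr -addrA; congr (_ + _).
rewrite !scaler_sumr -big_split; apply: eq_bigr => j _ /=.
by rewrite !scalerA -scalerDl /tilt mulrDr [r * (_ / r)]mulrC divfK // gt_eqF.
Qed.

(** Before rounding the two points coincide: the displacement [o] gained at the start is the one
    that the slope [\- o] removes at the end. Four roundings remain. *)
Lemma link_near o :
  norm1 (L (start o + pt c (n%:R * k)) - L (finish o)) <= 4 * D.
Proof.
rewrite nk /finish of_latticeB of_latticeD.
pose S := \sum_j o j *: tangent b j.
have SN : \sum_j (\- o) j *: tangent b j = - S.
  by rewrite /S -sumrN; apply: eq_bigr => j _; rewrite scaleNr.
have -> : L (start o) + L (pt c (N - 2 * r)) - (L (pt c N) - L (pt (tilt (\- o) c) r)) =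
  (L (start o) - r *: hvec (tilt o c)) +
  ((L (pt c (N - 2 * r)) - (N - 2 * r) *: hvec c) +
  ((L (start (\- o)) - r *: hvec (tilt (\- o) c)) - (L (pt c N) - N *: hvec c))).
  rewrite !hvec_tilt SN -/S /start; apply/rowP => i; rewrite !mxE; ring.
have := norm1_pt b0u (tilt o c) r; have := norm1_pt b0u c (N - 2 * r).
have := norm1_pt b0u (tilt (\- o) c) r; have := norm1_pt b0u c N.
rewrite -/(start o) -/(start (\- o)).
set x1 := L (pt c N) - _; set x2 := L (start (\- o)) - _.
set x3 := L (pt c (N - 2 * r)) - _; set x4 := L (start o) - _.
have := norm1D x4 (x3 + (x2 - x1)); have := norm1D x3 (x2 - x1).
have := norm1D x2 (- x1); rewrite norm1N; lra.
Qed.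

Lemma bundle_reach (C : R) (t : edge m.+1 -> R) o s1 s2 s3 : 0 <= C -> (forall e, 0 <= t e <= C) ->
  (forall j, `|o j| <= W) ->
  reach t (ltube (tilt o c) 0 (- (2 * r)) (2 * r) hr) 0 (start o) s1 ->
  reach t (ltube c (start o) (- (3 * k)) ((n%:R + 3) * k) (2 * h))
    (start o) (start o + pt c (n%:R * k)) s2 ->
  reach t (ltube (tilt (\- o) c) (finish o) (- (2 * r)) (2 * r) hr)
    (finish o) (finish o + pt (tilt (\- o) c) r) s3 ->
  reach t (ltube c 0 (- (2 * N)) (2 * N) H) 0 (pt c N)
    (s1 + s2 + 2 * link_cost u b C + s3).
Proof.
move=> C0 tC oW r1 r2 r3; have [[D0 Dr Dh Dhr] [rN' kN' W0' Wr' HW']] := D2_coarse.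
have D1 := D_ge1 b0u.
set A := ltube c 0 _ _ _.
have F := finish_near oW.
have fin : finish o + pt (tilt (\- o) c) r = pt c N by rewrite /finish subrK.
rewrite fin in r3; apply: (reach_trans (y := finish o)); last first.
  apply: reachW r3 => // w /(ltube_tilt (normN_offset oW)) wl.
  by have := ltube_trans wl F; apply: ltubeS; lra.
apply: (reach_trans (y := start o + pt c (n%:R * k))).
  apply: (reach_trans (y := start o)).
    by apply: reachW r1 => // w /(ltube_tilt oW); apply: ltubeS; lra.
  apply: reachW r2 => // w wl; have := ltube_trans wl (start_near oW).
  have nk3 : (n%:R + 3) * k = N - 2 * r + 3 * k by rewrite mulrDl nk.
  by rewrite nk3; apply: ltubeS; have := k0; lra.
have q0 : 0 <= m.+1.*2%:R * C by rewrite mulr_ge0.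
have c1 : cnorm c <= 1.
  by apply: le_trans cW; rewrite lerDl !mulr_ge0 // invr_ge0 ltW // bundle_r_gt0.
apply: (reachW _ _ (@reach_link _ _ t A C _ _ (4 * D) C0 tC (link_near o) _)) => //.
  have : 0 <= D * (m.+1.*2%:R * C) by rewrite mulr_ge0 // (le_trans _ D1).
  rewrite /link_cost; move: (m.+1.*2%:R * C) => q; lra.
move=> w wf; have wl : ltube c (finish o) (- (4 * D ^+ 2)) (4 * D ^+ 2) (4 * D ^+ 2) w.
  have := @ltube_near _ _ u b hb b0u c (finish o) 0 (4 * D) w c1.
  rewrite scale0r subr0 => /(_ wf); rewrite (_ : D * (4 * D) = 4 * D ^+ 2).
    by rewrite !add0r.
  by rewrite expr2 mulrCA.
by have := ltube_trans wl F; apply: ltubeS; lra.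
Qed.

(** The lateral coordinate of [start o] is [o] up to [2 * D ^+ 2], half of it from rounding and half
    from the axial error times the slope. The tubes have half-width [2 * h], so a separation of
    [5 * h] leaves a margin [h] above the errors. *)
Lemma line_disjoint o o' e : (forall j, `|o j| <= W) -> (forall j, `|o' j| <= W) ->
  (exists j, 5 * h <= `|o j - o' j|) ->
  edges_in (ltube c (start o) (- (3 * k)) ((n%:R + 3) * k) (2 * h)) e ->
  ~ edges_in (ltube c (start o') (- (3 * k)) ((n%:R + 3) * k) (2 * h)) e.
Proof.
have [[D0 Dr Dh Dhr] [rN' kN' W0' Wr' HW']] := D2_coarse; have r0 := bundle_r_gt0.
have key o1 : (forall j, `|o1 j| <= W) -> forall j,
    `|lat u b c j (L (start o1) - L 0) - o1 j| <= 2 * D ^+ 2.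
  move=> oW j; have c1 : cnorm (tilt o1 c) <= 1.
    by apply: le_trans (cnorm_tilt _ oW) cW.
  have [/andP[a1 a2] al] := ltube_pt hb b0u r c1.
  rewrite (lat_change _ _ (tilt o1 c)) /start.
  set a := ax _ _ _ in a1 a2 *; set x := lat _ _ _ _ _.
  have xl : `|x| <= D ^+ 2 := al j.
  have -> : x + a * (tilt o1 c j - c j) - o1 j = x + (a - r) * (o1 j / r).
    have -> : tilt o1 c j - c j = o1 j / r by rewrite /tilt; ring.
    by rewrite mulrBl [r * _]mulrC divfK ?gt_eqF // addrA.
  apply: le_trans (ler_normD _ _) _; rewrite [2 * _]mulrDl mul1r; apply: lerD => //.
  rewrite normrM -[leRHS]mulr1; apply: ler_pM => //; first by rewrite ler_norml; lra.
  rewrite normrM normfV (gtr0_norm r0) ler_pdivrMr // mul1r.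
  exact: le_trans Wr.
move=> oW oW' [j oj] [[_ el] _] [[_ el'] _].
have {}oj : 5 * h <= o j - o' j \/ 5 * h <= o' j - o j.
  by move: oj; rewrite ler_normr opprB => /orP[|]; [left|right].
move: (key o oW j) (key o' oW' j) (el j) (el' j); rewrite !latD !latN !ler_norml.
by case: oj => oj /andP[? ?] /andP[? ?] /andP[? ?] /andP[? ?]; lra.
Qed.

Variables (dO : measure_display) (Omega : measurableType dO).
Variables (P : probability Omega R) (tau : edge m.+1 -> {RV P >-> R}) (C : R).
Hypotheses (C0 : 0 <= C) (hX : iid_weights tau C).

(** If no path meets the budget, then one of the 2 * M^m end segments is slow or all the M^m lines
    are; the lines have disjoint edge sets, hence the power of [p2]. *)
Lemma bundle_bound (M : nat) (w S s2 p p2 : R) (s1 : ('I_m -> R) -> R) :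
  5 * h <= w -> w * M%:R <= W ->
  (forall c', cnorm c' <= cnorm c + m%:R * (W / r) ->
    prob tau (slow (ltube c' 0 (- (2 * r)) (2 * r) hr) 0 (pt c' r) (s1 c')) <= p) ->
  prob tau (slow (ltube c 0 (- (3 * k)) ((n%:R + 3) * k) (2 * h)) 0
    (pt c (n%:R * k)) s2) <= p2 ->
  (forall o, (forall j, `|o j| <= W) ->
    s1 (tilt o c) + s2 + 2 * link_cost u b C + s1 (tilt (\- o) c) <= S) ->
  prob tau (slow (ltube c 0 (- (2 * N)) (2 * N) H) 0 (pt c N) S) <=
  2 * (M ^ m)%:R * p + p2 ^+ (M ^ m).
Proof.
move=> hw wW ends lines budget.
have h0 : 0 <= h.
  apply: le_trans h_coarse; rewrite /coarse mulr_ge0 // exprn_ge0 //.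
  exact: le_trans ler01 (D_ge1 b0u).
have w0 : 0 <= w by apply: le_trans hw; rewrite mulr_ge0.
pose J := {ffun 'I_m -> 'I_M}.
pose off (g : J) j : R := w * (g j)%:R.
have offW g j : `|off g j| <= W.
  rewrite ger0_norm ?mulr_ge0 //; apply: le_trans wW.
  by rewrite ler_wpM2l // ler_nat ltnW.
pose E1 (g : J) := slow (ltube (tilt (off g) c) 0 (- (2 * r)) (2 * r) hr)
  0 (start (off g)) (s1 (tilt (off g) c)).
pose A2 (g : J) := ltube c (start (off g)) (- (3 * k)) ((n%:R + 3) * k) (2 * h).
pose E2 (g : J) := slow (A2 g) (start (off g)) (start (off g) + pt c (n%:R * k)) s2.
pose E3 (g : J) := slow (ltube (tilt (\- off g) c) (finish (off g)) (- (2 * r)) (2 * r) hr)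
  (finish (off g)) (finish (off g) + pt (tilt (\- off g) c) r) (s1 (tilt (\- off g) c)).
(* One index for each end segment on either side, and one for the event that all lines are slow. *)
pose B (x : ((J + J) + 'I_1)%type) := match x with
  | inl (inl g) => E1 g | inl (inr g) => E3 g
  | inr _ => [set t | forall g : J, predT g -> E2 g t] end.
have mB x : sigma_on setT (B x).
  case: x => [[g|g]|i]; try exact: sigma_on_slowT.
  apply: (sigma_on_bigcap (A := E2) (D := fun g => is_true (predT g))) => g _.
  exact: sigma_on_slowT.
apply: le_trans (prob_union hX (D := predT) (B := B) _ mB _) _.
- exact: sigma_on_slowT.
- move=> t tC St.
  have [[g E1g]|nE1] := pselect (exists g, E1 g t); first by exists (inl (inl g)).
  have [[g E3g]|nE3] := pselect (exists g, E3 g t); first by exists (inl (inr g)).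
  exists (inr ord0) => // g _ r2; apply: St.
  have r1 := contrapT (fun E1g => nE1 (ex_intro _ g E1g)).
  have r3 := contrapT (fun E3g => nE3 (ex_intro _ g E3g)).
  have := bundle_reach C0 tC (offW g) r1 r2 r3.
  by apply: reachW => //; exact: budget.
rewrite !big_sumType big_ord1 /=.
have cardJ : #|J| = (M ^ m)%N by rewrite card_ffun !card_ord.
apply: lerD.
  rewrite -mulrA [2 * _]mulrDl mul1r; apply: lerD.
    rewrite -cardJ mulr_natl -sumr_const; apply: ler_sum => g _; apply: ends.
    exact: cnorm_tilt.
  rewrite -cardJ mulr_natl -sumr_const; apply: ler_sum => g _.
  apply: le_trans (prob_slow_shift _ _ _ hX _ _ _ _ _ _) _; apply: ends.
  by apply: cnorm_tilt => j; rewrite /= normrN.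
rewrite (prob_bigcap hX (F := fun g => edges_in (A2 g))).
- rewrite -cardJ -prodr_const; apply: ler_prod => g _; rewrite prob_ge0 /=.
  exact: le_trans (prob_slow_shift _ _ _ hX _ _ _ _ _ _) lines.
- by move=> g; exact: sigma_on_slow.
- move=> g g' e _ _ gg'; apply: line_disjoint => //.
  have [j gj] : exists j, g j != g' j.
    apply/existsP; rewrite -[X in is_true X]negbK negb_exists.
    apply: contra gg' => /forallP H0; apply/eqP/ffunP => j.
    by apply/eqP; rewrite -[_ == _]negbK H0.
  exists j; rewrite -mulrBr normrM (ger0_norm w0); apply: (le_trans hw).
  have {}gj : (g j : nat) <> g' j by move=> /val_inj gjj; rewrite gjj eqxx in gj.
  rewrite ler_peMr //; have [lt|lt|//] := ltngtP (g j) (g' j).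
    by rewrite distrC -natrB ?(ltnW lt) // normr_nat ler1n subn_gt0.
  by rewrite -natrB ?(ltnW lt) // normr_nat ler1n subn_gt0.
Qed.

End Bundle.

(** * Parameters of one bundle *)

Section ScaleNumbers.
Variable R : realType.
Implicit Types (x y z : R).

Lemma truncn_half x : 1 <= x ->
  [/\ (0 < Num.truncn x)%N, (Num.truncn x)%:R <= x & x <= 2 * (Num.truncn x)%:R].
Proof.
move=> x1; have /truncn_itv/andP[h1 h2] : 0 <= x by rewrite (le_trans _ x1).
rewrite -natr1 in h2; have n0 : (0 < Num.truncn x)%N.
  by rewrite -(ltr_nat R); lra.
by split => //; have := n0; rewrite -(ler_nat R); lra.
Qed.

Lemma powR_transfer (cost zeta e f : R) : 0 < zeta <= cost -> e <= f ->
  zeta `^ f * cost `^ (e - f) <= zeta `^ e.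
Proof.
move=> /andP[z0 zc] ef; have c0 : 0 < cost := lt_le_trans z0 zc.
rewrite -[in leRHS](subrK f e) [leRHS]powRDp // mulrC ler_wpM2r ?powR_ge0 //.
rewrite -[e - f]opprB !powRN lef_pV2 ?posrE ?powR_gt0 //.
by apply: le_powR_base; rewrite ?subr_ge0 // ltW.
Qed.

(** The width is K * K^(-(1 - X) / 2) up to a factor, and K^(1 - X) is at least of order 1 / zeta.
    Thus a width of order N * sqrt(zeta) holds of order N / K blocks side by side. *)
Lemma scale_width (X kap cost zeta K k : R) : 0 < X < 1 -> 1 <= kap * (1 - X) ->
  0 < zeta <= cost -> zeta `^ (- kap) <= K -> 0 < k <= 2 * K ->
  k `^ ((X + 1) / 2) <=
    2 * K * (zeta `^ 2^-1 * cost `^ ((kap * (1 - X) - 1) / 2)).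
Proof.
move=> /andP[X0 X1] kX /andP[z0 zc] zK /andP[k0 kK].
have c0 : 0 < cost := lt_le_trans z0 zc.
have K0 : 0 < K := lt_le_trans (powR_gt0 _ z0) zK.
have K20 : 0 < 2 * K by rewrite mulr_gt0.
apply: (@le_trans _ _ ((2 * K) `^ ((X + 1) / 2))).
  by apply: le_powR_base; [lra|exact: ltW|].
rewrite (_ : (X + 1) / 2 = 1 + - ((1 - X) / 2)); last lra.
rewrite powRDp // powRr1 ?(ltW K20) // ler_wpM2l ?(ltW K20) //.
apply: (@le_trans _ _ ((zeta `^ (- kap)) `^ (- ((1 - X) / 2)))).
  rewrite !(powRN _ ((1 - X) / 2)) lef_pV2 ?posrE ?powR_gt0 //.
  apply: le_powR_base; rewrite ?powR_ge0 //; first lra.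
  by apply: (le_trans zK); rewrite ler_peMl ?(ltW K0) // ler1n.
rewrite -powRrM (_ : _ * _ = 2^-1 + (kap * (1 - X) - 1) / 2); last lra.
rewrite powRDp // ler_wpM2l ?powR_ge0 //.
by apply: le_powR_base; [lra|exact: ltW|].
Qed.

Lemma sum5_bounds (x1 x2 x3 x4 x5 y : R) : 0 <= x1 -> 0 <= x2 -> 0 <= x3 ->
  0 <= x4 -> 0 <= x5 -> x1 + x2 + (x3 + x4 + x5) <= y ->
  [/\ x1 <= y, x2 <= y, x3 <= y, x4 <= y & x5 <= y].
Proof. by move=> *; split; lra. Qed.

Lemma halve (x y z : R) : 2 * x <= y -> y <= 2 * z -> x <= z.
Proof. lra. Qed.

Lemma head_room (N r x : R) : 0 < r -> 64 * r <= N -> 12 * x <= N ->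
  x <= N - 2 * r.
Proof. lra. Qed.

Lemma quarter (N r x y : R) : 0 < r -> 64 * r <= N -> N - 2 * r <= 2 * x * y ->
  N <= 4 * (x * y).
Proof. by rewrite -mulrA; lra. Qed.

Lemma width_sum (hr h W x : R) : 0 < x -> W <= x / 32 -> hr <= x / 16 ->
  5 * h <= W -> hr + 2 * h + 5 * W <= x.
Proof. lra. Qed.

(** The block length lies between K and 2 * K for K = K2 * zeta^(-kap), so [n] and [M] are both at
    least of order N * zeta^kap; the last bound counts the blocks. *)
Lemma scale_numbers (m : nat) (X kap Ks cost Lam dl co L : R) :
  let K2 := Ks * cost `^ kap in
  0 < X < 1 -> 1 <= kap -> 1 <= kap * (1 - X) -> 1 <= Ks -> 1 <= cost ->
  8 <= Lam -> 0 < dl -> dl * Lam * cost `^ 2^-1 <= 1 -> 0 <= co -> 0 <= L ->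
  exists a Q0 : R, [/\ 0 < a, 1 <= Q0 &
  forall N zeta : R, 0 < zeta <= cost -> Q0 <= N * zeta `^ kap ->
  let s := zeta `^ 2^-1 in let r := N / Lam ^+ 2 in
  let hr := N * s / (2 * Lam) in let W := dl * N * s / (4 * m.+1%:R * Lam) in
  exists (n : nat) (k : R) (M : nat), let h := k `^ ((X + 1) / 2) in
  [/\ [/\ 0 < N, co <= r, 2 * co <= hr, 8 * r <= N & n%:R * k = N - 2 * r],
      [/\ (0 < n)%N, 6 * k <= N, Ks <= k, k `^ (- kap^-1) <= zeta &
          k <= 2 * K2 * zeta `^ (- kap)],
      [/\ 5 * h * M%:R <= W, hr + 2 * h + 5 * W <= N * s, W <= r & 16 * L <= zeta * N],
      M%:R <= N &
      a * (N * zeta `^ kap) ^+ m.+1 <= n%:R * M%:R ^+ m]].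
Proof.
move=> K2 X01 kap1 kX Ks1 cost1 Lam8 dl0 dlc co0 L0.
have kap0 : 0 < kap := lt_le_trans ltr01 kap1.
have cost0 : 0 < cost := lt_le_trans ltr01 cost1.
have ck1 : 1 <= cost `^ kap by apply: powR_ge1 => //; exact: ltW.
have K2E : K2 = Ks * cost `^ kap by [].
have K21 : 1 <= K2 by rewrite K2E mulr_ege1.
clearbody K2.
have K20 : 0 < K2 := lt_le_trans ltr01 K21.
have Lam0 : 0 < Lam by rewrite (lt_le_trans _ Lam8).
have Lam1 : 1 <= Lam by rewrite (le_trans _ Lam8) // ler1n.
have dd1 : 1 <= m.+1%:R :> R by rewrite ler1n.
have dd4 : 1 <= 4 * m.+1%:R :> R by rewrite mulr_ege1 // ler1n.
have dd0 : 0 < m.+1%:R :> R by rewrite ltr0n.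
set ce := cost `^ ((kap * (1 - X) - 1) / 2).
have ce0 : 0 < ce by rewrite powR_gt0.
(* Chosen so that [2 * a1 * (N * z)] is a lower bound for [W / (5 * h)], the number of lines per
   direction before truncation. *)
pose a1 := dl / (80 * m.+1%:R * Lam * K2 * ce).
have a1E : a1 = dl / (80 * m.+1%:R * Lam * K2 * ce) by [].
have a10 : 0 < a1 by rewrite divr_gt0 // !mulr_gt0.
clearbody a1.
(* Thresholds for [co <= r], [2 * co <= hr] and [16 * L <= zeta * N]. Since [zeta <= cost], each
   follows from a lower bound on N * zeta^kap at the price of a power of [cost]. *)
pose q1 := co * Lam ^+ 2 * cost `^ kap.
pose q2 := 4 * Lam * co * cost `^ (kap - 2^-1).
pose q3 := 16 * L * cost `^ (kap - 1).
have q10 : 0 <= q1 by rewrite !mulr_ge0 ?powR_ge0 ?exprn_ge0 // ltW.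
have q20 : 0 <= q2 by rewrite !mulr_ge0 ?powR_ge0 // ltW.
have q30 : 0 <= q3 by rewrite !mulr_ge0 ?powR_ge0.
have a1V : 0 < (2 * a1)^-1 by rewrite invr_gt0 mulr_gt0.
exists (a1 ^+ m / (4 * K2)), (12 * K2 + (2 * a1)^-1 + (q1 + q2 + q3)).
split; [by rewrite divr_gt0 ?exprn_gt0 // mulr_gt0|lra|].
move=> N zeta zc Q0Nz s r hr W.
have /andP[z0 zcost] := zc.
set z := zeta `^ kap in Q0Nz *.
have z_gt0 : 0 < z by rewrite powR_gt0.
have [Q1 Q2 Q3 Q4 Q5] : [/\ 12 * K2 <= N * z, (2 * a1)^-1 <= N * z, q1 <= N * z,
   q2 <= N * z & q3 <= N * z].
  by apply: sum5_bounds Q0Nz => //; [rewrite mulr_ge0 // ltW|exact: ltW].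
have N0 : 0 < N.
  by rewrite -(pmulr_lgt0 N z_gt0); apply: lt_le_trans Q1; rewrite mulr_gt0.
clear Q0Nz; pose K := K2 * zeta `^ (- kap).
have Kz : K * z = K2 by rewrite /K powRN -mulrA mulVf ?mulr1 // gt_eqF.
have K0 : 0 < K by rewrite mulr_gt0 // powR_gt0.
have s0 : 0 < s by rewrite powR_gt0.
have s_cost : s <= cost `^ 2^-1 by apply: le_powR_base => //; exact: ltW.
have zK : zeta `^ (- kap) <= K by rewrite ler_peMl ?powR_ge0.
have KN : 12 * K <= N by rewrite -(ler_pM2r z_gt0) -mulrA Kz.
have Lam2 : 64 <= Lam ^+ 2.
  by rewrite (_ : 64 = 8 ^+ 2) ?lerXn2r ?nnegrE ?(ltW Lam0) //; ring.
have r0 : 0 < r by rewrite divr_gt0 // exprn_gt0.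
have rN : 64 * r <= N.
  by rewrite mulrA ler_pdivrMr ?exprn_gt0 // mulrC ler_wpM2l // ltW.
have transfer e q : e <= kap -> q * cost `^ (kap - e) <= N * z -> q <= N * zeta `^ e.
  move=> ekap qz; apply: (@le_trans _ _ (N * (z * cost `^ (e - kap)))).
    rewrite mulrA -[e - kap]opprB powRN ler_pdivlMr ?powR_gt0 //.
  by rewrite ler_wpM2l ?(ltW N0) // powR_transfer.
have [n0 nY nY2] : let n := Num.truncn ((N - 2 * r) / K) in
    [/\ (0 < n)%N, n%:R <= (N - 2 * r) / K & (N - 2 * r) / K <= 2 * n%:R].
  by apply: truncn_half; rewrite ler_pdivlMr // mul1r; exact: head_room r0 rN KN.
set n := Num.truncn _ in n0 nY nY2.
have n0' : 0 < n%:R :> R by rewrite ltr0n.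
pose k := (N - 2 * r) / n%:R.
have kK : K <= k by rewrite ler_pdivlMr // mulrC -ler_pdivlMr.
have k2K : k <= 2 * K by rewrite ler_pdivrMr // mulrAC -ler_pdivrMr.
have k0 : 0 < k := lt_le_trans K0 kK.
(* The factor of [K2] that is a power of [cost] makes this hold for every [zeta <= cost]. *)
have KsK : Ks <= K.
  rewrite /K K2E -mulrA ler_peMr ?(le_trans ler01) // powRN ler_pdivlMr // mul1r.
  by apply: le_powR_base => //; exact: ltW.
have k1 : 1 <= k by rewrite (le_trans Ks1) // (le_trans KsK).
pose h := k `^ ((X + 1) / 2).
have h1 : 1 <= h.
  by apply: powR_ge1 => //; case/andP: X01 => X0 _; rewrite divr_ge0 ?addr_ge0 ?ltW.
have h0 : 0 < h := lt_le_trans ltr01 h1.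
have hw : h <= 2 * K * (s * ce).
  by apply: scale_width => //; rewrite k0.
have W0 : 0 < W by rewrite divr_gt0 ?mulr_gt0.
have Wh : 2 * a1 * (N * z) <= W / (5 * h).
  rewrite ler_pdivlMr ?mulr_gt0 //.
  apply: (@le_trans _ _ (2 * a1 * (N * z) * (5 * (2 * K * (s * ce))))).
    have h5 : 5 * h <= 5 * (2 * K * (s * ce)) by rewrite ler_wpM2l.
    by apply: ler_wpM2l h5; rewrite !mulr_ge0 ?ltW.
  rewrite (_ : _ * (5 * _) = 20 * a1 * N * (K * z) * s * ce); last by ring.
  rewrite Kz a1E /W le_eqVlt; apply/orP; left; apply/eqP; field.
  by rewrite !gt_eqF.
have Wh1 : 1 <= W / (5 * h).
  by apply: le_trans Wh; rewrite mulrC -ler_pdivrMr ?mulr_gt0 // mul1r.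
have [M0 MW MW2] := truncn_half Wh1; set M := Num.truncn _ in M0 MW MW2.
have Wr : W <= r.
  rewrite /W /r ler_pdivlMr ?exprn_gt0 // mulrAC ler_pdivrMr ?mulr_gt0 //.
  have : dl * Lam * s <= 1.
    by apply: le_trans dlc; rewrite ler_wpM2l // mulr_ge0 // ltW.
  move=> dls; apply: (@le_trans _ _ (N * (Lam * (dl * Lam * s)))).
    by rewrite le_eqVlt; apply/orP; left; apply/eqP; ring.
  rewrite ler_wpM2l ?(ltW N0) // mulrC; apply: ler_pM => //; try exact: ltW.
    by rewrite !mulr_ge0 // ltW.
  exact: le_trans dls dd4.
have W32 : W <= N * s / 32.
  rewrite /W ler_pdivrMr ?mulr_gt0 //.
  have dl1 : dl <= 1.
    apply: le_trans dlc; rewrite -mulrA ler_peMr ?(ltW dl0) // mulr_ege1 //.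
    by apply: powR_ge1.
  have Ns0 : 0 < N * s by rewrite mulr_gt0.
  have e1 : 32 <= 4 * m.+1%:R * Lam by rewrite (_ : 32 = 4 * 1 * 8) ?ler_pM //; ring.
  apply: (@le_trans _ _ (1 * (N * s))).
    by rewrite -mulrA ler_wpM2r // ltW.
  by rewrite mul1r [leRHS]mulrAC ler_pdivlMr // ler_wpM2l // ltW.
exists n, k, M; cbv zeta; rewrite -/h; split.
- split; [by []| | | |by rewrite mulrC divfK // gt_eqF].
  + rewrite /r ler_pdivlMr ?exprn_gt0 //.
    by rewrite -[N]mulr1 -(powRr0 zeta); apply: transfer; rewrite ?subr0 // ltW.
  + rewrite /hr ler_pdivlMr ?mulr_gt0 //; apply: (transfer 2^-1).
      by apply: le_trans kap1; rewrite invf_le1 // ler1n.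
    by apply: le_trans Q4; rewrite /q2 le_eqVlt; apply/orP; left; apply/eqP; ring.
  + by apply: le_trans rN; rewrite ler_wpM2r ?(ltW r0) // ler_nat.
- split=> //.
  + by apply: le_trans KN; rewrite (_ : 12 * K = 6 * (2 * K)) ?ler_wpM2l //; ring.
  + by apply: le_trans kK.
  + rewrite powRN invf_ple ?posrE ?powR_gt0 // -[leLHS](powRr1 (ltW _)) ?invr_gt0 //.
    apply: (@le_trans _ _ ((zeta `^ (- kap)) `^ kap^-1)).
      by rewrite -powRrM mulNr mulfV ?gt_eqF // powR_inv1 ?(ltW z0) // powRr1 // invr_ge0 ltW.
    by apply: le_powR_base; rewrite ?invr_ge0 ?powR_ge0 ?(ltW kap0) // (le_trans zK).
  + by rewrite -mulrA.
- split => //.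
  + by rewrite mulrC -ler_pdivlMr // mulr_gt0.
  + have : 5 * h <= W by move: Wh1; rewrite ler_pdivlMr ?mulr_gt0 // mul1r.
    have : hr <= N * s / 16.
      have Ns0 : 0 < N * s by rewrite mulr_gt0.
      rewrite /hr ler_wpM2l ?(ltW Ns0) // lef_pV2 ?posrE ?mulr_gt0 //.
      by rewrite (_ : 16 = 2 * 8) ?ler_wpM2l //; ring.
    by move=> ? ?; apply: (@width_sum hr h W (N * s)); rewrite ?mulr_gt0.
  + by rewrite [zeta * N]mulrC -[X in N * X](powRr1 (ltW z0)); exact: transfer.
- apply: (le_trans MW); rewrite ler_pdivrMr ?mulr_gt0 //.
  apply: (le_trans Wr); apply: (@le_trans _ _ N).
    by apply: le_trans rN; rewrite ler_peMl ?(ltW r0) // ler1n.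
  by rewrite ler_peMr ?(ltW N0) // mulr_ege1 // ler1n.
- have -> : a1 ^+ m / (4 * K2) * (N * z) ^+ m.+1 = (N * z / (4 * K2)) * (a1 * (N * z)) ^+ m.
    by rewrite exprS [(a1 * _) ^+ m]exprMn; move: (a1 ^+ m) ((N * z) ^+ m) => p q; ring.
  apply: ler_pM.
  + by rewrite divr_ge0 ?mulr_ge0 ?ltW.
  + by rewrite exprn_ge0 // !mulr_ge0 ?ltW.
  + rewrite -Kz ler_pdivrMr ?mulr_gt0 ?powR_gt0 //.
    have : (N - 2 * r) <= 2 * n%:R * K by rewrite -ler_pdivrMr.
    rewrite (_ : _ * (4 * _) = 4 * (n%:R * K) * z); last by ring.
    by move=> Y; rewrite ler_wpM2r ?(ltW z_gt0) //; exact: quarter r0 rN Y.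
  + apply: lerXn2r; rewrite ?nnegrE ?mulr_ge0 ?(ltW a10) ?(ltW N0) ?(ltW z_gt0) //.
    by apply: halve MW2; rewrite mulrA.
Qed.

End ScaleNumbers.

(** * Failure probability of one line, and the budget of a detour *)

Section LineSmall.
Variable R : realType.

Lemma near_line_small (rho rate l : R) : 0 < rho -> 0 < rate -> 0 <= l ->
  \forall k \near +oo, ln k + 1 <= rate * (k `^ rho / 4 - l - 1) / 5.
Proof.
move=> rho0 rate0 l0; have rho2 : 0 < rho / 2 by rewrite divr_gt0.
near=> k; have k0 : 0 < k by near: k; apply: nbhs_pinfty_gt; exact: num_real.
have lnk : ln k <= k `^ (rho / 2) by near: k; exact: near_ln_le.
have big : 40 / rate + (1 + rate * (l + 1) / 5) <= k `^ (rho / 2).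
  by near: k; exact: near_powR_ge.
rewrite (splitr rho) powRDp //.
move: lnk big; move: (k `^ (rho / 2)) (ln k) => y lnk h1 h2.
have r1 : 0 <= rate * (l + 1) / 5 by rewrite divr_ge0 ?mulr_ge0 ?addr_ge0 // ltW.
have y40 : 40 / rate <= y by move: h2; lra.
have y0 : 0 <= y by apply: le_trans y40; rewrite divr_ge0 // ltW.
have h40 : 0 <= 40 / rate by rewrite divr_ge0 // ltW.
have : 40 * y <= rate * (y * y).
  by rewrite mulrA ler_wpM2r // mulrC -ler_pdivrMr.
move: h1 h2 r1 h40; rewrite (_ : rate * (y * y / 4 - l - 1) / 5 =
  rate * (y * y) / 20 - rate * (l + 1) / 5); last by field.
move: (rate * (y * y)) (rate * (l + 1) / 5) (40 / rate) => *; lra.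
Unshelve. all: by end_near.
Qed.

(** The budget [zeta * N / 4] gives each block at least zeta * k / 4, that is k^(1 - X - 1/kap) / 4
    in units of k^X. This power of k beats the entropy ln k and leaves a factor exp(-1) per
    block. *)
Lemma line_exponent (M n : nat) (X kap k N zeta rate l : R) :
  0 < X < 1 -> 1 <= k -> n%:R * k <= N -> k `^ (- kap^-1) <= zeta ->
  M.+1%:R <= k -> 0 < rate -> 0 <= l ->
  ln k + 1 <= rate * (k `^ (1 - X - kap^-1) / 4 - l - 1) / 5 ->
  M.+1%:R ^+ n * expR (- (rate * ((zeta * N / 4 - n%:R * l) / k `^ X - n%:R)) / 5) <=
  expR (- n%:R).
Proof.
move=> /andP[X0 X1] k1 nkN kz Mk rate0 l0 lnk.
have k0 : 0 < k := lt_le_trans ltr01 k1.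
have kX1 : 1 <= k `^ X by apply: powR_ge1 => //; exact: ltW.
have kX0 : 0 < k `^ X := lt_le_trans ltr01 kX1.
have z0 : 0 <= zeta := le_trans (powR_ge0 _ _) kz.
have big : n%:R * (k `^ (1 - X - kap^-1) / 4 - l - 1) <=
    (zeta * N / 4 - n%:R * l) / k `^ X - n%:R.
  rewrite !mulrBr mulr1 lerD2r mulrBl; apply: lerB; last first.
    by rewrite ler_pdivrMr // ler_peMr // mulr_ge0.
  rewrite powRDp // mulrA ler_pdivlMr // [X in X <= _]mulrAC ler_wpM2r //.
  apply: (@le_trans _ _ (zeta * (n%:R * k))); last by rewrite ler_wpM2l.
  rewrite -[X in _ <= _ * (_ * X)](powR_split X k0).
  rewrite (_ : zeta * _ = n%:R * (k `^ (1 - X) * zeta) * k `^ X); last by ring.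
  by rewrite ler_wpM2r ?(ltW kX0) // ler_wpM2l // ler_wpM2l ?powR_ge0.
apply: (@le_trans _ _ (expR (n%:R * ln k) *
    expR (- (rate * (n%:R * (k `^ (1 - X - kap^-1) / 4 - l - 1))) / 5))).
  apply: ler_pM; rewrite ?exprn_ge0 ?expR_ge0 //.
    by rewrite expRM_natl lnK ?posrE // lerXn2r ?nnegrE // ltW.
  by rewrite ler_expR ler_wpM2r ?invr_ge0 // lerN2 ler_wpM2l ?(ltW rate0).
rewrite -expRD ler_expR.
have : n%:R * (ln k + 1) <= n%:R * (rate * (k `^ (1 - X - kap^-1) / 4 - l - 1) / 5).
  by rewrite ler_wpM2l.
move: (k `^ _) => q; rewrite mulrDr mulr1.
rewrite (_ : n%:R * (rate * (q / 4 - l - 1) / 5) = rate * (n%:R * (q / 4 - l - 1)) / 5); last by field.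
move: (rate * (n%:R * (q / 4 - l - 1))) (n%:R * ln k) => x y; lra.
Qed.

(** The total adds up exactly: three quarters of [zeta * N] for the two ends and the line, an eighth
    for the links, and a sixteenth for the curvature cost of each tilted end. *)
Lemma budget_sum (N r zeta Lam T0 Tc Tp Tm Cq dl s l : R) :
  0 < Lam -> r = N / Lam ^+ 2 -> 0 <= N -> 0 <= zeta -> zeta = s * s ->
  Tp <= T0 + Cq * (dl * s * Lam / 2) ^+ 2 -> Tm <= T0 + Cq * (dl * s * Lam / 2) ^+ 2 ->
  T0 <= Tc -> Cq * dl ^+ 2 <= 4^-1 -> 16 * l <= zeta * N ->
  r * Tp + zeta * N / 4 + ((N - 2 * r) * Tc + zeta * N / 4) + 2 * l +
    (r * Tm + zeta * N / 4) <= N * Tc + zeta * N.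
Proof.
move=> Lam0 rE N0 z0 zs hp hm hT hC hl.
have r0 : 0 <= r by rewrite rE divr_ge0 // exprn_ge0 // ltW.
have q16 : r * (Cq * (dl * s * Lam / 2) ^+ 2) <= zeta * N / 16.
  rewrite (_ : _ * _ = (Cq * dl ^+ 2) * (zeta * N / 4)).
    rewrite (_ : zeta * N / 16 = 4^-1 * (zeta * N / 4)); last by field.
    by rewrite ler_wpM2r // divr_ge0 // mulr_ge0.
  by rewrite rE zs; field; rewrite gt_eqF.
have h1 : r * Tp <= r * T0 + zeta * N / 16.
  by apply: le_trans (ler_wpM2l r0 hp) _; rewrite mulrDr lerD2l.
have h2 : r * Tm <= r * T0 + zeta * N / 16.
  by apply: le_trans (ler_wpM2l r0 hm) _; rewrite mulrDr lerD2l.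
have h3 : r * T0 <= r * Tc by rewrite ler_wpM2l.
rewrite (_ : (N - 2 * r) * Tc = N * Tc - 2 * (r * Tc)); last by ring.
move: h1 h2 h3 hl.
move: (r * Tp) (r * Tm) (r * T0) (r * Tc) (N * Tc) (zeta * N) => *; lra.
Qed.

End LineSmall.

Lemma curvature_slack (R : realType) (q : R) : 0 < q -> q <= 4^-1 * ((1 + q) * 2) ^+ 2.
Proof. by move=> q0; have := sqr_ge0 q; rewrite exprMn sqrrD; lra. Qed.

Lemma tilt_sum (R : realType) (m : nat) (cn e Lam : R) : 8 <= Lam -> 0 <= e ->
  cn <= e -> cn + m%:R * (e * Lam / (4 * m.+1%:R)) <= e * Lam / 2.
Proof.
move=> L8 e0 ce; have d0 : 0 < m.+1%:R :> R by rewrite ltr0n.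
have eL : 0 <= e * Lam / 4 by rewrite divr_ge0 ?mulr_ge0 //; lra.
have : m%:R * (e * Lam / (4 * m.+1%:R)) <= e * Lam / 4.
  rewrite (_ : _ * _ = (e * Lam / 4) * (m%:R / m.+1%:R)); last by field; rewrite gt_eqF.
  by rewrite ler_piMr // ler_pdivrMr // mul1r ler_nat.
have : e * 8 <= e * Lam by rewrite ler_wpM2l.
move: (m%:R * _) => q; lra.
Qed.

(** * One step of the recursion over scales *)

Section MainBound.
Variables (R : realType) (m : nat).
Variables (u : 'rV[R]_m.+1) (b : 'I_m.+1 -> 'rV[R]_m.+1).
Hypothesis hb : orthonormal_basis b.
Hypothesis b0u : 0 < dot (b ord0) u.
Local Notation D := (distortion u b).
Local Notation ltube := (ltube u b).
Local Notation pt := (pt u b).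
Variables (dO : measure_display) (Omega : measurableType dO).
Variables (P : probability Omega R) (tau : edge m.+1 -> {RV P >-> R}) (C : R).
Hypotheses (C0 : 0 <= C) (hX : iid_weights tau C).
Variables (T : ('I_m -> R) -> R) (T0 Cq : R).
Hypotheses (T_ge0 : forall c, 0 <= T c) (T_min : forall c, T0 <= T c).
Hypotheses (Cq0 : 0 < Cq) (T_curv : forall c, T c <= T0 + Cq * cnorm c ^+ 2).
Local Notation lk := (link_cost u b C).

(** With zeta = N^(a - 1) the excess is N^a and the half-width N^((a + 1) / 2), as in the
    theorem. *)
Definition far c (N zeta : R) : R := prob tau
  (slow (ltube c 0 (- (2 * N)) (2 * N) (N * zeta `^ 2^-1)) 0 (pt c N)
    (N * T c + zeta * N)).

Lemma link_cost_ge0 : 0 <= lk.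
Proof. by rewrite /link_cost !mulr_ge0 // (le_trans _ (D_ge1 b0u)). Qed.

Lemma sqrt_half (s : R) : 0 <= s -> s `^ 2^-1 * s `^ 2^-1 = s.
Proof. by move=> s0; rewrite powR12_sqrt // -expr2 sqr_sqrtr. Qed.

Lemma tilt_scale (zeta Lam : R) : 0 <= zeta -> 0 <= Lam ->
  (zeta * Lam ^+ 2 / 4) `^ 2^-1 = zeta `^ 2^-1 * Lam / 2.
Proof.
move=> z0 L0; have L2 : 0 <= Lam / 2 by rewrite divr_ge0.
rewrite (_ : zeta * Lam ^+ 2 / 4 = zeta * (Lam / 2) ^+ 2); last by field.
rewrite powRM // ?exprn_ge0 // -mulrA; congr (_ * _).
by rewrite powR12_sqrt ?exprn_ge0 // sqrtr_sqr ger0_norm.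
Qed.

Lemma scale_step (X kap sig rate K1 Lam cost : R) :
  0 < X < 1 -> 1 <= kap -> 1 < kap * (1 - X) -> 0 < sig -> kap * sig <= 2^-1 ->
  0 < rate -> 8 <= Lam -> 1 <= cost ->
  (forall K c y, K1 <= K -> cnorm c < K `^ (- sig) -> 1 <= y ->
    prob tau (slow (cell u b X c K) 0 (pt c K) (K * T c + y * K `^ X)) <=
      expR (- (rate * y))) ->
  exists dl a Q0 : R, [/\ 0 < dl, dl * Lam * cost `^ 2^-1 <= 1, 0 < a, 1 <= Q0 &
   forall N zeta c p, 0 < zeta <= cost -> Q0 <= N * zeta `^ kap ->
    cnorm c <= dl * zeta `^ 2^-1 ->
    (forall c', cnorm c' <= dl * (zeta * Lam ^+ 2 / 4) `^ 2^-1 ->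
      far c' (N / Lam ^+ 2) (zeta * Lam ^+ 2 / 4) <= p) ->
    far c N zeta <= 2 * N ^+ m * p + expR (- (a * (N * zeta `^ kap) ^+ m.+1))].
Proof.
move=> X01 kap1 kX sig0 ks rate0 Lam8 cost1 tail; have /andP[X0 X1] := X01.
have kap0 : 0 < kap := lt_le_trans ltr01 kap1.
have Lam0 : 0 < Lam by lra.
have cost0 : 0 < cost := lt_le_trans ltr01 cost1.
have rho0 : 0 < 1 - X - kap^-1.
  by rewrite subr_gt0 -(ltr_pM2l kap0) mulfV ?gt_eqF.
have D1 := D_ge1 b0u; have l0 := link_cost_ge0.
have co8 : 8 <= coarse u b.
  by rewrite /coarse ler_peMr // expr_ge1 // (le_trans _ D1).
have [Ks Ks1 KsP] : exists2 Ks, Num.max 1 (Num.max K1 (coarse u b)) <= Ks &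
    forall k, Ks <= k -> [/\ coarse u b <= k `^ ((X + 1) / 2),
      2 * lk + 2 <= k `^ X &
      ln k + 1 <= rate * (k `^ (1 - X - kap^-1) / 4 - lk - 1) / 5].
  apply: near_pinfty_ex; clear tail D1 co8; near=> k.
  by split; near: k; [apply: near_powR_ge; lra|exact: near_powR_ge|exact: near_line_small].
move: Ks1; rewrite !ge_max => /andP[Ks1 /andP[K1Ks coKs]].
pose K2 := Ks * cost `^ kap.
have K2_0 : 0 < K2 by rewrite mulr_gt0 ?powR_gt0 // (lt_le_trans ltr01).
(* Three limits on the slopes: [d1] bounds the tilts by 1, [d2] makes the curvature cost fit the
   budget, and [d3] keeps the direction in the range where the tail holds at length [k]. *)
pose d1 := (Lam * cost `^ 2^-1)^-1; pose d2 := ((1 + Cq) * 2)^-1.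
pose d3 := (2 * K2) `^ (- sig) * cost `^ (kap * sig - 2^-1).
have lc0 : 0 < Lam * cost `^ 2^-1 by rewrite mulr_gt0 ?powR_gt0.
have d10 : 0 < d1 by rewrite invr_gt0.
have d20 : 0 < d2 by rewrite invr_gt0 mulr_gt0 // addr_gt0.
have d30 : 0 < d3 by rewrite mulr_gt0 ?powR_gt0 // mulr_gt0.
pose dl := Num.min d1 (Num.min d2 (d3 / 2)).
have dl0 : 0 < dl by rewrite !lt_min d10 d20 divr_gt0.
have [dl1 dl2 dl3] : [/\ dl <= d1, dl <= d2 & dl < d3].
  rewrite /dl; split; rewrite ?ge_min ?lexx ?orbT //.
  by rewrite !gt_min ltr_pdivrMr // ltr_pMr // ltr1n !orbT.
have dlL : dl * Lam * cost `^ 2^-1 <= 1.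
  by rewrite -mulrA -ler_pdivlMr // mul1r.
have dlC : Cq * dl ^+ 2 <= 4^-1.
  apply: (@le_trans _ _ (Cq * d2 ^+ 2)); first by rewrite ler_wpM2l ?(ltW Cq0) // lerXn2r ?nnegrE ?(ltW dl0) ?(ltW d20).
  rewrite /d2 exprVn ler_pdivrMr ?exprn_gt0 ?mulr_gt0 ?addr_gt0 //.
  exact: curvature_slack.
clearbody dl; clear dl1 dl2 d10 d20 d1 d2.
have [a [Q0 [a0 Q01 scale]]] := @scale_numbers R m X kap Ks cost Lam dl (coarse u b) lk
  X01 kap1 (ltW kX) Ks1 cost1 Lam8 dl0 dlL (le_trans (ler0n _ 8) co8) l0.
exists dl, a, Q0; split => // N zeta c p zc Q0N cdl ends.
have [z0 zcost] := andP zc.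
have [n [k [M [[N0 co_r co_hr r8 nk] [n0 k6 Ksk kz k2K] [hM HW Wr lN] MN aM]]]] :=
  scale N zeta zc Q0N.
have [kh klk kln] := KsP k Ksk.
set s := zeta `^ 2^-1 in cdl HW hM Wr co_hr.
set r := N / Lam ^+ 2 in ends co_r r8 nk Wr.
set h := k `^ ((X + 1) / 2) in kh HW hM.
set hr := N * s / (2 * Lam) in co_hr HW.
set W := dl * N * s / (4 * m.+1%:R * Lam) in HW hM Wr.
have s0 : 0 < s by rewrite powR_gt0.
have Lam2 : 0 < Lam ^+ 2 by rewrite exprn_gt0.
have r0 : 0 < r by rewrite divr_gt0.
have k1 : 1 <= k := le_trans Ks1 Ksk.
have k0 : 0 < k := lt_le_trans ltr01 k1.
have zs : zeta = s * s by rewrite sqrt_half // ltW.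
have sr : (zeta * Lam ^+ 2 / 4) `^ 2^-1 = s * Lam / 2 by rewrite tilt_scale // ltW.
have W0 : 0 <= W by rewrite /W !mulr_ge0 ?invr_ge0 ?mulr_ge0 // ltW.
have sc : s <= cost `^ 2^-1 by apply: le_powR_base => //; exact: ltW.
have dls1 : dl * Lam * s <= 1.
  by apply: le_trans dlL; rewrite ler_wpM2l // mulr_ge0 ?ltW.
have WrE : W / r = dl * s * Lam / (4 * m.+1%:R).
  by rewrite /W /r; field; rewrite !gt_eqF // ltr0n.
have cW2 : cnorm c + m%:R * (W / r) <= dl * s * Lam / 2.
  by rewrite WrE tilt_sum // mulr_ge0 // ltW.
have cW : cnorm c + m%:R * (W / r) <= 1.
  apply: (le_trans cW2); rewrite ler_pdivrMr // mul1r mulrAC.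
  by apply: (le_trans dls1); rewrite ler1n.
have c1 : cnorm c <= 1.
  by apply: le_trans cW; rewrite lerDl mulr_ge0 // divr_ge0 // ltW.
(* Here [kap * sig <= 2^-1] matters: k^(-sig) is at least a constant times zeta^(kap * sig), which
   dominates zeta^(1/2) up to a constant. *)
have ck : cnorm c < k `^ (- sig).
  apply: (le_lt_trans cdl); apply: (@lt_le_trans _ _ (d3 * s)); first by rewrite ltr_pM2r.
  apply: (@le_trans _ _ ((2 * K2) `^ (- sig) * zeta `^ (kap * sig))).
    by rewrite /d3 -mulrA ler_wpM2l ?powR_ge0 // mulrC; exact: powR_transfer.
  rewrite (_ : _ * _ = (2 * K2 * zeta `^ (- kap)) `^ (- sig)); last first.
    have K22 : 0 <= 2 * K2 by rewrite mulr_ge0 // ltW.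
    by rewrite [RHS](powRM _ K22 (powR_ge0 _ _)) -powRrM mulrNN.
  have K2z : 0 < 2 * K2 * zeta `^ (- kap).
    by apply: mulr_gt0; [exact: mulr_gt0|exact: powR_gt0].
  rewrite !(powRN _ sig) lef_pV2 ?posrE ?powR_gt0 //.
  by apply: le_powR_base => //; exact: ltW.
have tailk y : 1 <= y -> prob tau (slow (cell u b X c k) 0 (pt c k) (k * T c + y * k `^ X)) <=
    expR (- (rate * y)) by apply: tail => //; exact: le_trans Ksk.
have kk : 0 < k <= k by rewrite k0 lexx.
have l2 : 0 <= 2 * lk by rewrite mulr_ge0.
have [M' [cM' M'k]] := @level_count R X k k (2 * lk) X01 kk k1 l2 klk.
have lines : prob tau (slow (ltube c 0 (- (3 * k)) ((n%:R + 3) * k) (2 * h)) 0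
    (pt c (n%:R * k)) (n%:R * (k * T c) + zeta * N / 4)) <= expR (- n%:R).
  have kX0 : 0 < k `^ X by rewrite powR_gt0.
  have := @slow_line_bound _ _ u b hb b0u c c1 k h (le_trans coKs Ksk) kh _ _ P tau C C0 hX
    (k `^ X) (k * T c) rate M' kX0 (ltW rate0) _ _ 0 n (zeta * N / 4).
  rewrite add0r => hline; apply: le_trans (hline _ _) _.
  - by move=> z z1; apply: tailk; rewrite ler1n.
  - by move=> t tC; apply: (cell_det hb b0u C0 T_ge0) => //; exact: le_trans Ksk.
  - apply: (@line_exponent R M' n X kap k N zeta rate lk) => //.
    by rewrite nk lerBlDr lerDl mulr_ge0 // ltW.
have h1 : 1 <= h by apply: powR_ge1 => //; rewrite divr_ge0 ?addr_ge0 ?(ltW X0).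
have h0 : 0 < h := lt_le_trans ltr01 h1.
have p0 : 0 <= p.
  apply: le_trans (ends (fun=> 0) _); first exact: prob_ge0.
  by rewrite /cnorm big1 ?mulr_ge0 ?powR_ge0 ?(ltW dl0) // => j _; rewrite normr0.
(* With the next identity, the end segments become instances of [far] at length [r] and relative
   excess [zeta * Lam ^+ 2 / 4]. *)
have rsr : r * (s * Lam / 2) = hr.
  by rewrite /r /hr; field; rewrite !gt_eqF.
have zr : zeta * Lam ^+ 2 / 4 * r = zeta * N / 4.
  by rewrite /r; field; rewrite !gt_eqF.
have := @bundle_bound _ _ u b hb b0u c N r k h hr W (N * s) n co_r kh r8 k0 k6 nk W0 Wr
  cW HW co_hr _ _ P tau C C0 hX M (5 * h) (N * T c + zeta * N)
  (n%:R * (k * T c) + zeta * N / 4) p (expR (- n%:R))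
  (fun c' => r * T c' + zeta * N / 4) (lexx _) hM _ lines.
rewrite /far => bb; apply: le_trans (bb _ _) _.
- move=> c' c'W; have := ends c'; rewrite /far sr rsr zr; apply.
  by apply: (le_trans c'W); apply: (le_trans cW2); rewrite !mulrA.
- have near_c o : (forall j, `|o j| <= W) ->
      T (tilt r o c) <= T0 + Cq * (dl * s * Lam / 2) ^+ 2.
    move=> oW; apply: le_trans (T_curv _) _; rewrite lerD2l ler_wpM2l ?(ltW Cq0) //.
    have cn := cnorm_tilt b0u co_r c oW.
    apply: lerXn2r; rewrite ?nnegrE ?cnorm_ge0 //.
      by rewrite divr_ge0 // !mulr_ge0 // ltW.
    exact: le_trans cn cW2.
  move=> o oW; rewrite [n%:R * (k * T c)]mulrA nk.
  apply: (@budget_sum R N r zeta Lam T0 (T c) _ _ Cq dl s lk) => //; try exact: ltW.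
  + exact: near_c.
  + by apply: near_c => j; rewrite /= normrN.
apply: lerD.
  rewrite natrX; apply: ler_wpM2r => //; apply: ler_wpM2l => //.
  by apply: lerXn2r; rewrite ?nnegrE ?ler0n ?(ltW N0).
rewrite -expRM_natl ler_expR mulrN lerN2 natrX [leRHS]mulrC; exact: aM.
Unshelve. all: by end_near.
Qed.

End MainBound.

(** * Recursion over scales *)

Lemma absorb (R : realType) (m : nat) (N x p e : R) : 1 <= N -> 0 <= p ->
  4 * N ^+ m <= expR x -> p <= expR (- (2 * x)) -> e <= expR (- (2 * x)) ->
  2 * N ^+ m * p + e <= expR (- x).
Proof.
move=> N1 p0 h hp he; have Nm : 1 <= N ^+ m by exact: exprn_ege1.
have E0 : 0 < expR (- x) by exact: expR_gt0.
have EE : expR (- (2 * x)) = expR (- x) * expR (- x).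
  by rewrite -expRD mulr2n mulrDl mul1r opprD.
have e4 : 4 * N ^+ m * expR (- x) <= 1.
  by rewrite expRN ler_pdivrMr ?expR_gt0 // mul1r.
have e4' : 4 * expR (- x) <= 1.
  apply: le_trans e4; rewrite ler_wpM2r ?(ltW E0) //; lra.
have h1 : 2 * N ^+ m * p <= 2 * N ^+ m * (expR (- x) * expR (- x)).
  by rewrite ler_wpM2l -?EE // mulr_ge0 // (le_trans ler01).
have h2 : 4 * N ^+ m * expR (- x) * expR (- x) <= 1 * expR (- x).
  by rewrite ler_wpM2r // ltW.
have h3 : 4 * expR (- x) * expR (- x) <= 1 * expR (- x).
  by rewrite ler_wpM2r // ltW.
rewrite EE in he; move: h1 h2 h3 he.
rewrite (_ : 4 * N ^+ m * expR (- x) * expR (- x) = 2 * (2 * N ^+ m * (expR (- x) * expR (- x)))); last by ring.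
rewrite -[4 * expR (- x) * expR (- x)]mulrA.
move: (2 * N ^+ m * (expR (- x) * expR (- x))) (expR (- x) * expR (- x)) E0 => y z; lra.
Qed.

Section Multiscale.
Variables (R : realType) (m : nat) (V : Type) (size : V -> R).
Variable far : V -> R -> R -> R.

(** N * zeta^Pw at least doubles from one scale to the next, and the doubled exponent pays for the
    sum over the lines. The assumption with [Bw] passes to the next scale too; as [Pw < Bw], it
    bounds N * zeta^Pw below by a power of N, which absorbs N^m. *)
Lemma multiscale (Lam cost kap Pw Bw dl a Q0 Nc : R) :
  1 <= cost -> 8 <= Lam -> kap <= Pw -> 1 < Pw -> Pw < Bw -> 0 < a ->
  2 * 4 `^ Pw <= (Lam ^+ 2) `^ (Pw - 1) -> 4 `^ Bw <= (Lam ^+ 2) `^ (Bw - 1) ->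
  (forall N zeta c, cost <= zeta <= cost * Lam ^+ 2 / 4 -> Nc <= N ->
    size c <= dl * zeta `^ 2^-1 -> far c N zeta = 0) ->
  (forall N zeta c p, 0 < zeta <= cost -> Q0 <= N * zeta `^ kap ->
    size c <= dl * zeta `^ 2^-1 ->
    (forall c', size c' <= dl * (zeta * Lam ^+ 2 / 4) `^ 2^-1 ->
      far c' (N / Lam ^+ 2) (zeta * Lam ^+ 2 / 4) <= p) ->
    far c N zeta <= 2 * N ^+ m * p + expR (- (a * (N * zeta `^ kap) ^+ m.+1))) ->
  exists cF N1 : R, [/\ 0 < cF, 1 <= N1 & forall N zeta c, 0 < zeta <= cost ->
    N1 * zeta `^ (- Bw) <= N -> size c <= dl * zeta `^ 2^-1 ->
    far c N zeta <= expR (- (cF * (N * zeta `^ Pw) ^+ m.+1))].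
Proof.
move=> cost1 Lam8 kP P1 PB a0 LP LB base step.
have cost0 : 0 < cost := lt_le_trans ltr01 cost1.
have B1 : 1 < Bw := lt_trans P1 PB.
have B0 : 0 < Bw := lt_trans ltr01 B1.
have P0 : 0 < Pw := lt_trans ltr01 P1.
set Y := Lam ^+ 2 in LP LB base step *.
have Y64 : 64 <= Y.
  rewrite (_ : 64 = 8 ^+ 2); last by ring.
  by apply: lerXn2r; rewrite ?nnegrE // (le_trans _ Lam8).
have Y0 : 0 < Y by lra.
have YL : Y = Lam ^+ 2 by [].
clearbody Y.
pose Z := cost * Y / 4.
have Z0 : 0 < Z by rewrite divr_gt0 ?mulr_gt0.
have costZ : cost <= Z.
  by rewrite /Z -mulrA ler_peMr ?(ltW cost0) // ler_pdivlMr //; lra.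
(* Converts the power [kap] of zeta into the power [Pw] on the range [zeta <= cost]; halving [a * g]
   provides the factor 2 in the exponents required by [absorb]. *)
pose g := (cost `^ (kap - Pw)) ^+ m.+1.
have g0 : 0 < g by rewrite exprn_gt0 // powR_gt0.
pose cF := a * g / 2.
have cF0 : 0 < cF by rewrite divr_gt0 // mulr_gt0.
pose th := 1 - Pw / Bw.
have th0 : 0 < th by rewrite subr_gt0 ltr_pdivrMr // mul1r.
have [N2 N21 N2P] : exists2 N2, Num.max 1 Nc <= N2 &
    forall N, N2 <= N -> 4 + m%:R * ln N <= cF * N `^ th.
  apply: near_pinfty_ex; clear base step Y64 LB LP; near=> N.
  have N0 : 0 < N by near: N; apply: nbhs_pinfty_gt; exact: num_real.
  have th2 : 0 <= N `^ (th / 2) by exact: powR_ge0.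
  have h1 : ln N <= N `^ (th / 2) by near: N; apply: near_ln_le; rewrite divr_gt0.
  have h2 : 4 <= N `^ (th / 2) by near: N; apply: near_powR_ge; rewrite divr_gt0.
  have h3 : (1 + m%:R) / cF <= N `^ (th / 2).
    by near: N; apply: near_powR_ge; rewrite divr_gt0.
  rewrite (splitr th) powRDp // mulrA.
  apply: (@le_trans _ _ ((1 + m%:R) * N `^ (th / 2))).
    by rewrite mulrDl mul1r lerD // ler_wpM2l.
  by rewrite ler_wpM2r // mulrC -ler_pdivrMr.
move: N21; rewrite ge_max => /andP[N21 N2c].
pose N1 := N2 * Z `^ Bw + `|Q0| * cost `^ (Bw - kap) + 1.
have ZB0 : 0 < Z `^ Bw by rewrite powR_gt0.
have N20 : 0 < N2 := lt_le_trans ltr01 N21.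
have NZ0 : 0 <= N2 * Z `^ Bw by rewrite mulr_ge0 // ltW.
have Qc0 : 0 <= `|Q0| * cost `^ (Bw - kap) by rewrite mulr_ge0 ?powR_ge0.
have [N1Z N1Q N11] : [/\ N2 * Z `^ Bw <= N1, `|Q0| * cost `^ (Bw - kap) <= N1 & 1 <= N1].
  rewrite /N1; split; first by rewrite -addrA lerDl addr_ge0.
    by rewrite addrAC lerDr addr_ge0.
  by rewrite lerDr addr_ge0.
clearbody N1; exists cF, N1; split => //.
(* [j] bounds the number of scales left, since zeta grows by the factor [Y / 4], more than 2. The
   range reaches up to [Z] because the last step may overshoot [cost]. *)
suff H j : forall N zeta c, cost <= zeta * j.+1%:R -> 0 < zeta <= Z ->
    N1 * zeta `^ (- Bw) <= N -> size c <= dl * zeta `^ 2^-1 ->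
    far c N zeta <= expR (- (cF * (N * zeta `^ Pw) ^+ m.+1)).
  move=> N zeta c /andP[z0 zc]; apply: (H (Num.truncn (cost / zeta))).
    by rewrite mulrC -ler_pdivrMr // ltW // truncnS_gt.
  by rewrite z0 (le_trans zc).
have large N zeta : 0 < zeta <= Z -> N1 * zeta `^ (- Bw) <= N ->
    N1 <= N * zeta `^ Bw /\ N2 <= N.
  move=> /andP[z0 zZ] zN; have zB0 : 0 < zeta `^ Bw by exact: powR_gt0.
  have NZ : N1 <= N * zeta `^ Bw by move: zN; rewrite powRN ler_pdivrMr.
  split => //; rewrite -(ler_pM2r zB0); apply: le_trans NZ; apply: le_trans N1Z.
  by rewrite ler_wpM2l ?(ltW N20) // le_powR_base ?(ltW B0) ?(ltW z0).
elim: j => [|j IH] N zeta c zj zZ zN cz; have [NZ NN2] := large N zeta zZ zN;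
  have /andP[z0 zZ'] := zZ.
  by rewrite base ?expR_ge0 // ?(le_trans N2c) //; move: zj; rewrite mulr1 => ->.
have [zc|zc] := leP cost zeta.
  by rewrite base ?expR_ge0 // ?(le_trans N2c) // zc.
have N_1 : 1 <= N := le_trans N21 NN2.
have N0 : 0 < N := lt_le_trans ltr01 N_1.
have zcost : 0 < zeta <= cost by rewrite z0 ltW.
have Q0N : Q0 <= N * zeta `^ kap.
  apply: (le_trans (ler_norm _)).
  have kB : kap <= Bw by apply: le_trans kP (ltW PB).
  apply: (@le_trans _ _ (N * (zeta `^ Bw * cost `^ (kap - Bw)))); last first.
    by rewrite ler_wpM2l ?(ltW N0) // powR_transfer.
  rewrite mulrA -[kap - Bw]opprB powRN ler_pdivlMr ?powR_gt0 //.
  exact: le_trans N1Q NZ.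
set q := N * zeta `^ Pw.
have q0 : 0 < q by rewrite mulr_gt0 // powR_gt0.
have qN : N `^ th <= q.
  have zNB : N^-1 <= zeta `^ Bw.
    by rewrite -(ler_pM2l N0) mulfV ?gt_eqF // (le_trans N11).
  have -> : N `^ th = N * (N^-1 `^ (Pw / Bw)).
    rewrite /th powRDp // powRr1 ?(ltW N0) // powRN; congr (_ * _).
    by rewrite -[N^-1 in RHS]powR_inv1 ?(ltW N0) // -powRrM mulN1r powRN.
  rewrite /q ler_wpM2l ?(ltW N0) //.
  have -> : zeta `^ Pw = (zeta `^ Bw) `^ (Pw / Bw).
    by rewrite -powRrM mulrC divfK // gt_eqF.
  by apply: le_powR_base; rewrite ?invr_ge0 ?(ltW N0) // divr_ge0 // ltW.
have q1 : 1 <= q by apply: le_trans qN; apply: powR_ge1 => //; exact: ltW.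
have qd : q <= q ^+ m.+1 by rewrite exprS ler_peMr ?(ltW q0) // exprn_ege1.
set x := cF * q ^+ m.+1.
have hx : 4 * N ^+ m <= expR x.
  have e4 : 4 <= expR 4 :> R by apply: le_trans (expR_ge1Dx 4); rewrite lerDr.
  rewrite -[N in N ^+ m]lnK ?posrE // -expRM_natl.
  apply: (@le_trans _ _ (expR 4 * expR (m%:R * ln N))).
    by rewrite ler_wpM2r // expR_ge0.
  rewrite -expRD ler_expR; apply: le_trans (N2P N NN2) _.
  by rewrite ler_wpM2l ?(ltW cF0) // (le_trans qN).
have hY4 : 0 < Y / 4 by rewrite divr_gt0.
set zr := zeta * Y / 4 in step *.
have zrE : zr = zeta * (Y / 4) by rewrite /zr mulrA.
have zr0 : 0 < zr by rewrite zrE mulr_gt0.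
have Y4P (e : R) : (Y / 4) `^ e = Y `^ e / 4 `^ e.
  rewrite powRM ?invr_ge0 ?(ltW Y0) // -[4^-1]powR_inv1 // -powRrM mulN1r powRN.
  by [].
have hp : expR (- (cF * (N / Y * zr `^ Pw) ^+ m.+1)) <= expR (- (2 * x)).
  rewrite ler_expR lerN2 /x mulrCA ler_wpM2l ?(ltW cF0) //.
  have q2 : 2 * q <= N / Y * zr `^ Pw.
    rewrite zrE powRM ?(ltW z0) ?(ltW hY4) // Y4P.
    rewrite (_ : N / Y * _ = q * (Y `^ Pw / Y / 4 `^ Pw)); last first.
      by rewrite /q; field; rewrite !gt_eqF ?powR_gt0.
    rewrite mulrC ler_wpM2l ?(ltW q0) // ler_pdivlMr ?powR_gt0 //.
    by apply: (le_trans LP); rewrite powRDp // powRN powRr1 ?(ltW Y0).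
  apply: (@le_trans _ _ ((2 * q) ^+ m.+1)).
    rewrite [(2 * q) ^+ _]exprMn ler_wpM2r ?exprn_ge0 ?(ltW q0) //.
    by rewrite exprS ler_peMr // exprn_ege1 // ler1n.
  by apply: lerXn2r; rewrite ?nnegrE ?mulr_ge0 ?invr_ge0 ?powR_ge0 ?(ltW q0) ?(ltW N0) ?(ltW Y0).
have he : expR (- (a * (N * zeta `^ kap) ^+ m.+1)) <= expR (- (2 * x)).
  rewrite ler_expR lerN2 /x /cF (_ : 2 * (_ * _) = a * (g * q ^+ m.+1)); last by field.
  rewrite ler_wpM2l ?(ltW a0) // /g -exprMn.
  apply: lerXn2r; rewrite ?nnegrE ?mulr_ge0 ?powR_ge0 ?(ltW q0) ?(ltW N0) //.
  by rewrite /q mulrCA ler_wpM2l ?(ltW N0) // mulrC powR_transfer.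
apply: le_trans (step N zeta c _ zcost Q0N cz _) (absorb N_1 (expR_ge0 _) hx hp he).
move=> c' hc'; apply: (IH _ zr c') => //.
- apply: (le_trans zj); rewrite zrE -mulrA ler_wpM2l ?(ltW z0) //.
  apply: (@le_trans _ _ (2 * j.+1%:R)).
    by rewrite -natrM ler_nat mul2n -addnn addSn ltnS leq_addl.
  by rewrite ler_wpM2r // ler_pdivlMr // (le_trans _ Y64) // -natrM ler_nat.
- rewrite zr0 /zr /Z /=.
  by rewrite ler_wpM2r ?invr_ge0 // ler_wpM2r ?(ltW Y0) // ltW.
- have kY : (Y / 4) `^ (- Bw) <= Y^-1.
    rewrite powRN Y4P invf_div ler_pdivrMr ?powR_gt0 // mulrC.
    by apply: (le_trans LB); rewrite powRDp // powRN powRr1 ?(ltW Y0).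
  rewrite zrE powRM ?(ltW z0) ?(ltW hY4) // mulrA; apply: ler_pM => //.
    by rewrite mulr_ge0 ?powR_ge0 // (le_trans ler01).
  exact: powR_ge0.
Unshelve. all: by end_near.
Qed.

End Multiscale.

(** * Choice of the exponents *)

Section FarBound.
Variables (R : realType) (m : nat).
Variables (u : 'rV[R]_m.+1) (b : 'I_m.+1 -> 'rV[R]_m.+1).
Hypothesis hb : orthonormal_basis b.
Hypothesis b0u : 0 < dot (b ord0) u.
Local Notation ltube := (ltube u b).
Local Notation pt := (pt u b).
Variables (dO : measure_display) (Omega : measurableType dO).
Variables (P : probability Omega R) (tau : edge m.+1 -> {RV P >-> R}) (C : R).
Hypotheses (C0 : 0 <= C) (hX : iid_weights tau C).
Variables (T : ('I_m -> R) -> R) (T0 Cq : R).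
Hypotheses (T_ge0 : forall c, 0 <= T c) (T_min : forall c, T0 <= T c).
Hypotheses (Cq0 : 0 < Cq) (T_curv : forall c, T c <= T0 + Cq * cnorm c ^+ 2).

(** The factor 2 makes up for the infimum: the absence of a path within a time only implies that the
    passage time exceeds any strictly smaller value. *)
Definition tilted_tail (chi th sig K0 : R) := forall K a c, K0 <= K -> chi <= a <= 1 ->
  cnorm c < K `^ (- sig) ->
  prob tau (slow (ltube c 0 (- (2 * K)) (2 * K) (K `^ ((a + 1) / 2))) 0 (pt c K)
    (K * T c + 2 * K `^ a)) <= expR (- K `^ (th * (a - chi))).

(** The hypothesis is used at the midpoint of [chi] and [X]: below [X], so that K^X absorbs the
    factor 2, and above [chi], so that the exponent stays positive. *)
Lemma tilted_tail_cell chi th sig K0 X : tilted_tail chi th sig K0 ->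
  0 < th -> chi < X -> X < 1 -> exists2 K1, 0 < th * ((X - chi) / 2) & forall K c,
    K1 <= K -> cnorm c < K `^ (- sig) ->
    prob tau (slow (cell u b X c K) 0 (pt c K) (K * T c + K `^ X)) <=
      expR (- K `^ (th * ((X - chi) / 2))).
Proof.
move=> hyp th0 cX X1; have X2 : 0 < (X - chi) / 2 by rewrite divr_gt0 ?subr_gt0.
have [K1 K1ge K1P] : exists2 K1, Num.max K0 1 <= K1 & forall K, K1 <= K ->
    2 <= K `^ ((X - chi) / 2).
  by apply: near_pinfty_ex; exact: near_powR_ge.
exists K1 => [|K c KK cK]; first by rewrite mulr_gt0.
move: K1ge; rewrite ge_max => /andP[K01 K11].
have K_1 : 1 <= K := le_trans K11 KK.
have K_0 : 0 < K := lt_le_trans ltr01 K_1.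
have a1 : chi <= (chi + X) / 2 <= 1 by apply/andP; split; lra.
have := hyp K _ c (le_trans K01 KK) a1 cK.
rewrite (_ : (chi + X) / 2 - chi = (X - chi) / 2); last lra.
apply: le_trans; apply: (prob_slowS hX).
  by apply: ltubeS => //; apply: ler_powR => //; lra.
have KX : K `^ X = K `^ ((X - chi) / 2) * K `^ ((chi + X) / 2).
  by rewrite -powRDp //; congr (_ `^ _); lra.
rewrite lerD2l KX.
by rewrite ler_wpM2r ?powR_ge0 // K1P.
Qed.

Lemma far_null N zeta c : cnorm c <= 1 -> coarse u b <= N -> 1 <= zeta ->
  2 * link_cost u b C <= zeta -> far u b tau T c N zeta = 0.
Proof.
move=> c1 cN z1 lz; apply: (prob_slow_null hX) => t tC.
have co8 : 0 <= coarse u b by rewrite /coarse mulr_ge0 // exprn_ge0 // (le_trans _ (D_ge1 b0u)).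
have N0 : 0 <= N := le_trans co8 cN.
have Nh : coarse u b <= N * zeta `^ 2^-1.
  by apply: (le_trans cN); rewrite ler_peMr // powR_ge1.
have := @reach_bounded _ _ u b hb b0u C t c 0 N (N * zeta `^ 2^-1) C0 tC c1 cN Nh.
rewrite add0r; apply: reachW => //.
rewrite -[leLHS]add0r; apply: lerD; first by rewrite mulr_ge0.
by rewrite ler_wpM2r.
Qed.

Lemma far_bound chi th sig K0 e : tilted_tail chi th sig K0 -> 0 < chi < 1 ->
  0 < th -> 0 < sig -> 0 < e <= 1 -> (1 + e) * sig <= (1 - chi) / 2 ->
  exists dl cF N1 : R, [/\ 0 < dl, 0 < cF, 1 <= N1 &
  forall N zeta c, 0 < zeta <= 1 ->
    N1 * zeta `^ (- ((1 + 4 * e) / (1 - chi))) <= N ->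
    cnorm c <= dl * zeta `^ 2^-1 ->
    far u b tau T c N zeta <=
      expR (- (cF * (N * zeta `^ ((1 + 2 * e) / (1 - chi))) ^+ m.+1))].
Proof.
move=> hyp /andP[chi0 chi1] th0 sig0 /andP[e0 e1] esig.
have hchi : 0 < 1 - chi by rewrite subr_gt0.
have beta1 (x : R) : 1 <= x -> 1 < (1 + x * e) / (1 - chi).
  move=> x1; have : e <= x * e by rewrite ler_peMl // ltW.
  by rewrite ltr_pdivlMr // mul1r; lra.
pose kap := (1 + e) / (1 - chi).
have kap1 : 1 < kap by have := beta1 1 (lexx _); rewrite mul1r.
(* Gives [kap * (1 - X) = 1 + e / 2], above 1, with [X] still above [chi]. *)
pose X := 1 - (1 - chi) * ((1 + e / 2) / (1 + e)).
have e10 : 0 < 1 + e by lra.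
have ratio : (1 + e / 2) / (1 + e) < 1 by rewrite ltr_pdivrMr // mul1r; lra.
have ratio0 : 0 < (1 + e / 2) / (1 + e) by rewrite divr_gt0 //; lra.
have XE : 1 - X = (1 - chi) * ((1 + e / 2) / (1 + e)) by rewrite /X opprB addrC subrK.
have cX : chi < X.
  have : (1 - chi) * ((1 + e / 2) / (1 + e)) < (1 - chi) * 1 by rewrite ltr_pM2l.
  by rewrite /X; lra.
have X1 : X < 1 by rewrite -subr_gt0 XE mulr_gt0.
have X01 : 0 < X < 1 by rewrite (lt_trans chi0).
have kX : 1 < kap * (1 - X).
  rewrite XE /kap (_ : _ * _ = 1 + e / 2); first by lra.
  by field; rewrite !gt_eqF.
have ks : kap * sig <= 2^-1.
  by rewrite /kap mulrAC ler_pdivrMr // [leRHS]mulrC.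
have [K1 th'0 cells] := tilted_tail_cell hyp th0 cX X1.
have [K2 [rate [K21 rate0 tail]]] :=
  linear_tail hb b0u C0 hX T_ge0 X01 th'0 sig0 cells.
(* Relative excesses from here on are met deterministically, by [far_null]. *)
pose cost := 2 * link_cost u b C + 1.
have l0 := link_cost_ge0 b0u C0.
have cost1 : 1 <= cost by rewrite lerDr mulr_ge0.
set Pw := (1 + 2 * e) / (1 - chi); set Bw := (1 + 4 * e) / (1 - chi).
have P1 : 1 < Pw by apply: beta1; rewrite ler1n.
have B1 : 1 < Bw by apply: beta1; rewrite ler1n.
have kP : kap <= Pw by rewrite ler_pM2r ?invr_gt0 //; lra.
have PB : Pw < Bw by rewrite ltr_pM2r ?invr_gt0 //; lra.
have [Lam Lam8 LamP] : exists2 Lam : R, 8 <= Lam & forall L, Lam <= L ->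
   [/\ 2 * 4 `^ Pw <= (L ^+ 2) `^ (Pw - 1) & 4 `^ Bw <= (L ^+ 2) `^ (Bw - 1)].
  apply: near_pinfty_ex; clear tail cells hyp; near=> L.
  have L0 : 0 <= L by near: L; apply: nbhs_pinfty_ge; exact: num_real.
  have L2 e' : (L ^+ 2) `^ e' = L `^ (2 * e') by rewrite powRrM powR_mulrn.
  by rewrite !L2; split; near: L; apply: near_powR_ge; rewrite mulr_gt0 ?subr_gt0.
have [LP LB] := LamP Lam (lexx _).
have [dl [a [Q0 [dl0 dlL a0 Q01 step]]]] := scale_step hb b0u C0 hX T_ge0 T_min Cq0 T_curv
  X01 (ltW kap1) kX sig0 ks rate0 Lam8 cost1 tail.
have cost0 : 0 < cost := lt_le_trans ltr01 cost1.
have Lam0 : 0 < Lam by lra.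
have [|cF [N1 [cF0 N11 main]]] := @multiscale R m ('I_m -> R) (@cnorm R m)
  (far u b tau T) Lam cost kap Pw Bw dl a Q0 (coarse u b)
  cost1 Lam8 kP P1 PB a0 LP LB _ step.
  move=> N zeta c /andP[cz zZ] cN cs; apply: far_null => //.
  - apply: (le_trans cs); apply: le_trans dlL; rewrite -mulrA ler_wpM2l ?(ltW dl0) //.
    apply: (@le_trans _ _ ((cost * Lam ^+ 2 / 4) `^ 2^-1)).
      by apply: le_powR_base => //; rewrite (le_trans _ cz) // ltW.
    rewrite tilt_scale ?(ltW cost0) ?(ltW Lam0) // [Lam * _]mulrC.
    by rewrite ler_pdivrMr // ler_peMr ?mulr_ge0 ?powR_ge0 ?(ltW Lam0) // ler1n.
  - exact: le_trans cz.
  - by apply: le_trans cz; rewrite /cost lerDl.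
exists dl, cF, N1; split => // N zeta c /andP[z0 z1]; apply: main.
by rewrite z0 (le_trans z1).
Unshelve. all: by end_near.
Qed.

End FarBound.

(** * From paths to extended-real passage times *)

Section PassageTime.
Variables (R : realType) (d : nat) (A : set 'rV[R]_d) (x y : 'rV[R]_d).
Implicit Types (t : edge d -> R) (s : R).
Local Notation region := [set z | A (of_lattice R z)].

Lemma lt_passage_time_slow t s : (s%:E < passage_time_in t A x y)%E ->
  slow region (lattice_floor x) (lattice_floor y) s t.
Proof.
move=> st [p [ps pA pt]]; move: st; rewrite ltNge => /negP; apply.
apply: (@le_trans _ _ (path_time t (lattice_floor x) p)%:E); last by rewrite lee_fin.
by apply: ereal_inf_lbound; exists p.
Qed.

Lemma slow_lt_passage_time t s s' : s < s' ->
  slow region (lattice_floor x) (lattice_floor y) s' t ->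
  (s%:E < passage_time_in t A x y)%E.
Proof.
move=> ss' nr; apply: (@lt_le_trans _ _ s'%:E); first by rewrite lte_fin.
apply: le_ereal_inf_tmp => _ [p [pp pA] <-]; rewrite lee_fin leNgt; apply/negP => lt.
by apply: nr; exists p; split => //; exact: ltW.
Qed.

Lemma sigma_on_lt_passage_time s :
  sigma_on setT [set t | (s%:E < passage_time_in t A x y)%E].
Proof.
rewrite (_ : mkset _ = \bigcup_n slow region (lattice_floor x) (lattice_floor y)
  (s + n.+1%:R^-1)).
  by apply: (@bigcupT_measurable _ (config_space R setT)) => n; exact: sigma_on_slowT.
apply/seteqP; split => t /=; last first.
  by move=> [n _]; apply: slow_lt_passage_time; rewrite ltrDl invr_gt0.
move=> st; have [s' ss' s't] : exists2 s', s < s' & (s'%:E < passage_time_in t A x y)%E.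
  case: (passage_time_in t A x y) st => [r| |//].
    rewrite lte_fin => sr; exists ((s + r) / 2); rewrite ?lte_fin; lra.
  by move=> _; exists (s + 1); rewrite ?ltry //; lra.
have [n ns] : exists n : nat, s + n.+1%:R^-1 <= s'.
  exists (Num.truncn (s' - s)^-1); rewrite -lerBrDl -[leRHS]invrK.
  rewrite lef_pV2 ?posrE ?invr_gt0 ?subr_gt0 //.
  by apply/ltW/truncnS_gt.
exists n => //; apply: lt_passage_time_slow; apply: le_lt_trans s't.
by rewrite lee_fin.
Qed.

Variables (dO : measure_display) (Omega : measurableType dO).
Variables (P : probability Omega R) (tau : edge d -> {RV P >-> R}).

Lemma sigma_on_joint (B : set (edge d -> R)) : sigma_on setT B ->
  measurable [set w | B (tau ^~ w)].
Proof. by move=> mB; exact: (measurable_funPTI (joint tau) mB). Qed.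

Lemma probability_passage_time_le s :
  (P [set w | s%:E < passage_time_in (fun e => tau e w) A x y] <=
   (prob tau (slow region (lattice_floor x) (lattice_floor y) s))%:E)%E.
Proof.
rewrite prob_fineK; last exact: sigma_on_slowT.
apply: le_measure; rewrite ?inE.
- exact: sigma_on_joint (sigma_on_lt_passage_time s).
- by apply: sigma_on_joint; exact: sigma_on_slowT.
- by move=> w; exact: lt_passage_time_slow.
Qed.

Lemma prob_slow_le s s' : s < s' ->
  ((prob tau (slow region (lattice_floor x) (lattice_floor y) s'))%:E <=
   P [set w | s%:E < passage_time_in (fun e => tau e w) A x y])%E.
Proof.
move=> ss'; rewrite prob_fineK; last exact: sigma_on_slowT.
apply: le_measure; rewrite ?inE.
- by apply: sigma_on_joint; exact: sigma_on_slowT.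
- exact: sigma_on_joint (sigma_on_lt_passage_time s).
- by move=> w; exact: slow_lt_passage_time.
Qed.

End PassageTime.

(** * Exponents at relative excess N^(a - 1) *)

Section FinalExponents.
Variable R : realType.
Implicit Types (h eps e s K a z : R).

Lemma budget_exponent h eps e a' : 0 < h < 1 -> 0 < eps -> 0 < e -> e <= eps / 8 ->
  0 <= a' <= h - eps -> a' * ((1 + 4 * e) / h) <= 1 - eps / 2.
Proof.
move=> /andP[h0 h1] eps0 e0 e8 /andP[a0 ah].
rewrite mulrA ler_pdivrMr //.
have h2 : a' * (1 + 4 * e) <= (h - eps) * (1 + 4 * e) by rewrite ler_wpM2r //; lra.
have h3 : e * h <= e * 1 by rewrite ler_wpM2l //; lra.
have h4 : eps * h <= eps * 1 by rewrite ler_wpM2l //; lra.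
have h5 : 0 <= e * eps by rewrite mulr_ge0 // ltW.
apply: (le_trans h2); rewrite (_ : (h - eps) * (1 + 4 * e) = h - eps + 4 * (e * h) - 4 * (e * eps)); last by ring.
rewrite (_ : (1 - eps / 2) * h = h - eps * h / 2); last by field.
lra.
Qed.

(** For [h = 1 - chi] and [s = a - chi] the right side is the exponent of N in N * zeta^((1 + 2 * e)
    / h). The margin [eps ^+ 2 / 2] serves to absorb the constant [cF]. *)
Lemma rate_exponent h eps e s : 0 < h < 1 -> 0 < eps -> 0 < e -> e <= eps ^+ 2 / 8 ->
  eps <= s <= h ->
  (1 - eps) / h * s + eps ^+ 2 / 2 <= 1 - (h - s) * ((1 + 2 * e) / h).
Proof.
move=> /andP[h0 h1] eps0 e0 e8 /andP[es sh].
rewrite -(ler_pM2r h0).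
rewrite (_ : ((1 - eps) / h * s + eps ^+ 2 / 2) * h = (1 - eps) * s + eps ^+ 2 * h / 2); last by field; rewrite gt_eqF.
rewrite (_ : (1 - (h - s) * ((1 + 2 * e) / h)) * h = s - 2 * (e * (h - s))); last by field; rewrite gt_eqF.
have h2 : eps * eps <= eps * s by rewrite ler_wpM2l // ltW.
have h3 : e * (h - s) <= e * 1 by rewrite ler_wpM2l //; lra.
have h4 : eps ^+ 2 * h <= eps ^+ 2 * 1 by rewrite ler_wpM2l ?sqr_ge0 //; lra.
have h5 : 0 <= eps * eps by rewrite mulr_ge0 // ltW.
rewrite expr2 in e8 h4 *; rewrite mulrBl mul1r; move: e8 h2 h3 h4 h5.
by move: (eps * eps * h) (eps * eps) (eps * s) (e * (h - s)) => *; lra.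
Qed.

Lemma exponent_range (chi eps a : R) : chi + eps <= a <= 1 ->
  eps <= a - chi <= 1 - chi /\ 0 <= 1 - a <= 1 - chi - eps.
Proof. by move=> /andP[? ?]; split; apply/andP; split; lra. Qed.

(** The margins in the exponents depend on [eps] alone, so the thresholds on [K] can be fixed before
    [a]. *)
Lemma near_tail_conditions (d : nat) (chi eps e dl cF N1 mm : R) :
  0 < chi < 1 -> 0 < eps -> chi + eps <= 1 -> 0 < e -> e <= eps ^+ 2 / 8 ->
  0 < dl -> 0 < cF -> 0 <= N1 -> (0 < d)%N ->
  \forall K \near +oo, 1 <= K /\ forall a, chi + eps <= a <= 1 ->
   let z := K `^ (a - 1) in
   [/\ [/\ 0 < z <= 1, z * K = K `^ a & K * z `^ 2^-1 = K `^ ((a + 1) / 2)],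
       N1 * z `^ (- ((1 + 4 * e) / (1 - chi))) <= K,
       mm * K `^ ((chi - 1 + eps / 2) / 2) <= dl * z `^ 2^-1 &
       K `^ (d%:R * (1 - eps) / (1 - chi) * (a - chi)) <=
         cF * (K * z `^ ((1 + 2 * e) / (1 - chi))) ^+ d].
Proof.
move=> /andP[chi0 chi1] eps0 ce e0 e8 dl0 cF0 N10 d0.
have h01 : 0 < 1 - chi < 1 by apply/andP; split; lra.
have e8' : e <= eps / 8.
  apply: (le_trans e8); rewrite ler_wpM2r // expr2 ler_piMl ?(ltW eps0) //; lra.
have eps2 : 0 < eps ^+ 2 / 2 by rewrite divr_gt0 // exprn_gt0.
near=> K.
have K1 : 1 <= K by near: K; apply: nbhs_pinfty_ge; exact: num_real.
have KN : N1 <= K `^ (eps / 2) by near: K; apply: near_powR_ge; rewrite divr_gt0.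
have Kd : mm / dl <= K `^ (eps / 4) by near: K; apply: near_powR_ge; rewrite divr_gt0.
have Kc : cF^-1 <= K `^ (eps ^+ 2 / 2) by near: K; exact: near_powR_ge.
have K0 : 0 < K := lt_le_trans ltr01 K1.
split => // a a12; have [a3 a4] := exponent_range a12.
have /andP[a1 a2] := a12; cbv zeta; set z := K `^ (a - 1).
have zE y : z `^ y = K `^ ((a - 1) * y) by rewrite -powRrM.
have KzE y : K * z `^ y = K `^ (1 + (a - 1) * y) by rewrite zE powRDp // powRr1 // ltW.
split; first split.
- by rewrite powR_gt0 // powR_le1 // subr_le0.
- by rewrite -[X in _ * X](powRr1 (ltW K0)) /z -powRDp // subrK.
- by rewrite KzE; congr (_ `^ _); field.
- rewrite zE; apply: (@le_trans _ _ (K `^ (eps / 2) * K `^ (1 - eps / 2))).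
    apply: ler_pM; rewrite ?powR_ge0 //; apply: ler_powR => //.
    rewrite mulrN -mulNr opprB; exact: budget_exponent.
  by rewrite -powRDp // addrC subrK powRr1 // ltW.
- rewrite zE; apply: (@le_trans _ _ (dl * (K `^ (eps / 4) * K `^ ((chi - 1 + eps / 2) / 2)))).
    by rewrite mulrA ler_wpM2r ?powR_ge0 // mulrC -ler_pdivrMr.
  rewrite ler_wpM2l ?(ltW dl0) // -powRDp //; apply: ler_powR => //; lra.
- rewrite KzE; have := @rate_exponent (1 - chi) eps e (a - chi) h01 eps0 e0 e8.
  move=> /(_ _); rewrite (_ : 1 - _ * _ = 1 + (a - 1) * ((1 + 2 * e) / (1 - chi))); last by ring.
  move=> re; have {}re := re _.
  rewrite (_ : d%:R * (1 - eps) / (1 - chi) * (a - chi) =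
    ((1 - eps) / (1 - chi) * (a - chi)) * d%:R); last by ring.
  rewrite powRrM powR_mulrn ?powR_ge0 //.
  have {}re : K `^ ((1 - eps) / (1 - chi) * (a - chi)) * K `^ (eps ^+ 2 / 2) <=
      K `^ (1 + (a - 1) * ((1 + 2 * e) / (1 - chi))).
    by rewrite -powRDp //; apply: ler_powR => //; exact: re.
  have := lerXn2r d _ _ re; rewrite ?nnegrE ?mulr_ge0 ?powR_ge0 // => /(_ isT isT) re'.
  apply: (@le_trans _ _ (cF * (K `^ ((1 - eps) / (1 - chi) * (a - chi)) * K `^ (eps ^+ 2 / 2)) ^+ d)); last first.
    by rewrite ler_wpM2l // ltW.
  have k1 : 1 <= K `^ (eps ^+ 2 / 2) by apply: powR_ge1 => //; exact: ltW.
  have := powR_ge0 K ((1 - eps) / (1 - chi) * (a - chi)).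
  move: (K `^ ((1 - eps) / (1 - chi) * (a - chi))) (K `^ (eps ^+ 2 / 2)) Kc k1.
  move=> p q Kc k1 p0; rewrite exprMn mulrCA ler_peMr ?exprn_ge0 //.
  rewrite mulrC -ler_pdivrMr // mul1r; apply: (le_trans Kc).
  by case: (d) d0 => // n _; rewrite exprS ler_peMr ?exprn_ege1 // (le_trans _ k1).
Unshelve. all: by end_near.
Qed.

End FinalExponents.

Lemma enormZ (R : realType) (n : nat) (a : R) (x : 'rV[R]_n) :
  enorm (a *: x) = `|a| * enorm x.
Proof. by rewrite /enorm dotZr dotC dotZr mulrA -expr2 sqrtrM ?sqr_ge0 // sqrtr_sqr. Qed.

(** * Tail bound for directions close to u *)

Section DirectionalTail.
Variables (R : realType) (m : nat).
Variables (dO : measure_display) (Omega : measurableType dO).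
Variables (P : probability Omega R) (tau : edge m.+1 -> {RV P >-> R}) (C : R).
Variables (mu : 'rV[R]_m.+1 -> R) (u : 'rV[R]_m.+1) (H : set 'rV[R]_m.+1).
Variables (b : 'I_m.+1 -> 'rV[R]_m.+1) (chi : R).
Hypotheses (C0 : 0 <= C) (hX : iid_weights tau C) (mu_norm : is_norm mu).
Hypotheses (hu : enorm u = 1)
  (H_supporting : supporting_hyperplane [set mu u *: x | x in unit_ball mu] u H).
Hypotheses (hb : orthonormal_basis b)
  (b_span : [set u + w | w in [set` tail_span b]] = H)
  (b0u : 0 < dot (b ord0) u) (chi01 : 0 < chi < 1).
Hypotheses (h_upper : upper_tail_concentration tau mu u H b chi)
  (h_curvature : finite_curvature mu u b).
Local Notation hvec := (hvec u b).

Lemma enorm_hvec c (K : R) : 0 <= K ->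
  enorm (K *: hvec c - K *: u) = K * enorm (\sum_j c j *: tangent b j).
Proof.
move=> K0; rewrite -scalerBr enormZ ger0_norm // /hvec.
by rewrite [u + _]addrC addrK.
Qed.

Lemma directional_tail : exists2 e0 : R, 0 < e0 & forall e, 0 < e <= e0 ->
  exists dl cF N1 : R, [/\ 0 < dl, 0 < cF, 1 <= N1 &
  forall N zeta c A, 0 < zeta <= 1 ->
    N1 * zeta `^ (- ((1 + 4 * e) / (1 - chi))) <= N ->
    cnorm c <= dl * zeta `^ 2^-1 ->
    Cyl b (hvec c) `[(- (2 * N)), 2 * N]%classic (N * zeta `^ 2^-1) `<=` A ->
    (P [set w | (N * mu (hvec c) + zeta * N)%:E <
         passage_time_in (fun e => tau e w) A 0 (N *: hvec c)] <=
     (expR (- (cF * (N * zeta `^ ((1 + 2 * e) / (1 - chi))) ^+ m.+1)))%:E)%E].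
Proof.
have /andP[chi0 chi1] := chi01.
have u0 : u != 0.
  apply/eqP => u0; have := hu; rewrite u0 /enorm dot0r sqrtr0 => /esym/eqP.
  by rewrite oner_eq0.
have T_min c := time_constant_minimum hb b_span mu_norm H_supporting u0 c.
have T_ge0 c := is_norm_ge0 mu_norm (hvec c).
have [Cq Cq0 T_curv] := time_constant_curvature hb h_curvature.
have [th [c0 [th0 c00 near_upper]]] := h_upper.
pose c1 := Num.min c0 ((1 - chi) / 2).
have c10 : 0 < c1 by rewrite lt_min c00 divr_gt0 // subr_gt0.
have c1c0 : c1 <= c0 by rewrite ge_min lexx.
have c1h : c1 <= (1 - chi) / 2 by rewrite ge_min lexx orbT.
(* K * K^(-sig) is K^((chi + 1 + c1) / 2), within the range of the hypothesis as [c1 <= c0]. Since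
   [sig] is strictly below [(1 - chi) / 2], a factor [1 + e] still fits for [e <= c1]. *)
pose sig := (1 - chi - c1) / 2.
have sig0 : 0 < sig by rewrite /sig; clearbody c1; lra.
have [K0 K01 K0P] := near_pinfty_ex 1 near_upper.
have tails : tilted_tail u b tau (mu \o hvec) chi th sig K0.
  move=> K a c KK a1 cK.
  have K1 : 1 <= K := le_trans K01 KK.
  have K_0 : 0 < K := lt_le_trans ltr01 K1.
  have close : enorm (K *: hvec c - K *: u) < K `^ ((chi + 1 + c0) / 2).
    rewrite enorm_hvec ?(ltW K_0) //.
    apply: (@lt_le_trans _ _ (K * K `^ (- sig))).
      rewrite ltr_pM2l //; apply: le_lt_trans cK; exact: enorm_tangent_sum.
    rewrite -[X in X * _](powRr1 (ltW K_0)) -powRDp //; apply: ler_powR => //.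
    by rewrite /sig; clear K0P near_upper; lra.
  have := K0P K KK a (hvec c) a1 (hyperplane_hvec hb b_span c) close.
  have lt : K * mu (hvec c) + K `^ a < K * mu (hvec c) + 2 * K `^ a.
    by rewrite ltrD2l ltr_pMl ?powR_gt0 // ltr1n.
  rewrite -lee_fin; apply: le_trans; apply: (le_trans _ (prob_slow_le _ _ _ _ lt)).
  rewrite lee_fin lattice_floor0; apply: (prob_slowS hX) => // z.
  by rewrite /= (Cyl_tube hb b0u) /ltube /= of_lattice0 subr0.
exists (Num.min c1 1); first by rewrite lt_min c10 ltr01.
move=> e /andP[e0]; rewrite le_min => /andP[ec e1].
have esig : (1 + e) * sig <= (1 - chi) / 2.
  have h1 : e * (1 - chi) <= e * 1 by rewrite ler_wpM2l //; lra.
  have h2 : 0 <= e * c1 by rewrite mulr_ge0 // ltW.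
  rewrite /sig (_ : (1 + e) * ((1 - chi - c1) / 2) =
    (1 - chi - c1 + e * (1 - chi) - e * c1) / 2); last by field.
  by clear K0P near_upper tails; move: (e * (1 - chi)) (e * c1) h1 h2 => *; lra.
have [|dl [cF [N1 [dl0 cF0 N11 main]]]] := far_bound hb b0u C0 hX T_ge0 T_min Cq0 T_curv
  tails chi01 th0 sig0 (e := e) _ esig; first by rewrite e0.
exists dl, cF, N1; split => // N zeta c A zc zN cz cylA.
have := main N zeta c zc zN cz; rewrite -lee_fin; apply: le_trans.
apply: le_trans (probability_passage_time_le _ _ _ _ _) _.
rewrite lee_fin lattice_floor0; apply: (prob_slowS hX) => // z zt /=.
by apply: cylA; rewrite (Cyl_tube hb b0u); move: zt; rewrite /ltube /= of_lattice0 subr0.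
Qed.

End DirectionalTail.

(** * Deduction of the two claims *)

Lemma limn_esup_le_near (R : realType) (v : nat -> \bar R) (l : \bar R) :
  (\forall n \near \oo, (v n <= l)%E) -> (limn_esup v <= l)%E.
Proof.
move=> vl; rewrite /limn_esup /limf_esup; apply: ge_ereal_inf.
exists (ereal_sup [set v n | n in [set n | (v n <= l)%E]]).
  by exists [set n | (v n <= l)%E].
by apply: ge_ereal_sup => _ [n nl <-].
Qed.

Lemma lne_le (R : realType) (p : \bar R) (x : R) : (0 <= p)%E ->
  (p <= (expR x)%:E)%E -> (lne p <= x%:E)%E.
Proof.
move=> p0 px; rewrite -[x in leRHS]expRK -lne_EFin ?expR_gt0 //.
by rewrite lee_lne // in_itv /= ?p0 ?leey // lee_fin expR_ge0.
Qed.

(** Since [2 * e <= eps / 2], half of the loss [eps] in the exponent is free to absorb the constant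
    [cF]. *)
Lemma rate_absorb (R : realType) (d : nat) (beta eps e cF N zeta : R) :
  0 <= beta -> 0 < e -> e <= eps / 4 -> 0 < N -> 0 < zeta <= 1 ->
  zeta `^ (d%:R * beta * (eps / 2)) <= cF ->
  (N ^+ d)^-1 * - (cF * (N * zeta `^ ((1 + 2 * e) * beta)) ^+ d) <=
    - zeta `^ ((1 + eps) * (d%:R * beta)).
Proof.
move=> beta0 e0 e4 N0 /andP[z0 z1] zc.
have Nd : 0 < N ^+ d by rewrite exprn_gt0.
rewrite mulrN lerN2; set w := zeta `^ ((1 + 2 * e) * beta).
have -> : (N ^+ d)^-1 * (cF * (N * w) ^+ d) = cF * w ^+ d.
  by rewrite exprMn mulrCA; congr (_ * _); rewrite mulrA mulVf ?gt_eqF // mul1r.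
rewrite /w.
have db : 0 <= d%:R * beta by rewrite mulr_ge0.
rewrite -powR_mulrn ?powR_ge0 // -powRrM.
have -> : (1 + eps) * (d%:R * beta) =
    (d%:R * beta) * (eps - 2 * e) + (1 + 2 * e) * beta * d%:R by ring.
rewrite powRDp // ler_wpM2r ?powR_ge0 //; apply: le_trans zc.
by apply: ger_powR; rewrite ?z0 // ler_wpM2l //; lra.
Qed.

Theorem theorem1p1 (R : realType) (d : nat) (hd : (2 <= d)%N)
  (dO : measure_display) (Omega : measurableType dO)
  (P : probability Omega R)
  (tau : edge d -> {RV P >-> R})
  (tau_ge0 : forall e w, 0 <= tau e w)
  (tau_indep : mutually_independent tau)
  (tau_id : identically_distributed tau)
  (tau_nondegenerate : forall e, ~ exists c : R, P (tau e @^-1` [set c]) = 1%E)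
  (tau_subcritical : forall e,
    (P (tau e @^-1` [set 0%R]) < (critical_probability R d)%:E)%E)
  (tau_bounded : exists C : R, 0 < C /\
    forall e, P [set w | tau e w <= C] = 1%E)
  (mu : 'rV[R]_d -> R) (mu_time_constant : is_time_constant tau mu)
  (u : 'rV[R]_d) (hu : enorm u = 1)
  (H : set 'rV[R]_d)
  (H_supporting :
    supporting_hyperplane [set mu u *: x | x in unit_ball mu] u H)
  (b : 'I_d -> 'rV[R]_d) (b_orthonormal : orthonormal_basis b)
  (b_span : [set u + w | w in [set` tail_span b]] = H)
  (b_first : forall i : 'I_d, i = 0%N :> nat -> 0 < dot (b i) u)
  (chi : R) (chi_gt0 : 0 < chi) (chi_lt1 : chi < 1)
  (h_upper_tail : upper_tail_concentration tau mu u H b chi)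
  (h_curvature : finite_curvature mu u b) :
  (forall eps : R, 0 < eps ->
    exists delta : R, 0 < delta /\
      \forall N \near \oo, forall a : R, chi + eps <= a <= 1 ->
        let bound : R := expR
          (- N%:R `^ (d%:R * (1 - eps) / (1 - chi) * (a - chi))) in
        (forall v : 'rV[R]_d, H v ->
          enorm (N%:R *: v - N%:R *: u) < N%:R `^ ((chi + 1 + delta) / 2) ->
          (P [set w | (N%:R * mu v + N%:R `^ a)%R%:E <
                passage_time_in (fun e => tau e w)
                  (Cyl b v setT (N%:R `^ ((a + 1) / 2))%R)
                  0%R (N%:R *: v)%R]
           <= bound%:E)%E) /\
        (P [set w | (N%:R * mu u + N%:R `^ a)%R%:E <
              passage_time (fun e => tau e w) 0%R (N%:R *: u)%R]
         <= bound%:E)%E) /\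
  (forall eps : R, 0 < eps ->
    \forall zeta \near 0^'+,
      (limn_esup (fun N : nat =>
         ((N%:R ^+ d)^-1)%R%:E *
         lne (P [set w | (N%:R * mu u + zeta * N%:R)%R%:E <
                passage_time (fun e => tau e w) 0%R (N%:R *: u)%R]))
       <= (- zeta `^ ((1 + eps) * (d%:R / (1 - chi))))%R%:E)%E).
Proof.
destruct d as [|m]; first by [].
have [C [C0 tC]] := tau_bounded.
have hX : iid_weights tau C by [].
have chi01 : 0 < chi < 1 by rewrite chi_gt0.
have h1 : 0 < 1 - chi by rewrite subr_gt0.
have b0u : 0 < dot (b ord0) u by exact: b_first.
have [e0 e00 main] := directional_tail (ltW C0) hX mu_time_constant.1 hu H_supporting
  b_orthonormal b_span b0u chi01 h_upper_tail h_curvature.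
have u_hvec : u = hvec u b (fun=> 0).
  by rewrite /hvec big1 ?addr0 // => j _; rewrite scale0r.
have cnorm0 : cnorm (fun _ : 'I_m => 0 : R) = 0.
  by rewrite /cnorm big1 // => j _; rewrite normr0.
split=> eps eps0.
  (* As [a] is at least [chi + eps], this leaves a factor N^(eps / 4) between the slope allowed for
     [v] and the slope needed, against the constants [m] and [dl]. *)
  exists (eps / 2); split; first by rewrite divr_gt0.
  have [ce|ce] := leP (chi + eps) 1; last first.
    by near=> N => a /andP[a1 a2]; have := lt_le_trans ce (le_trans a1 a2); rewrite ltxx.
  pose e := Num.min e0 (eps ^+ 2 / 8).
  have e_gt0 : 0 < e by rewrite lt_min e00 divr_gt0 // exprn_gt0.
  have e_le : e <= eps ^+ 2 / 8 by rewrite ge_min lexx orbT.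
  have [|dl [cF [N1 [dl0 cF0 N11 bound]]]] := main e; first by rewrite e_gt0 ge_min lexx.
  have [K0 K01 conditions] := near_pinfty_ex 1
    (@near_tail_conditions R m.+1 chi eps e dl cF N1 m%:R chi01 eps0 ce e_gt0 e_le
       dl0 cF0 (le_trans ler01 N11) isT).
  near=> N => a a1 /=.
  have NK : K0 <= N%:R by near: N; exact: nbhs_infty_ger.
  have [N_1 /(_ a a1) /= [[zc zN zh] N1z mz expo]] := conditions N%:R NK.
  have N0 : 0 < N%:R :> R := lt_le_trans ltr01 N_1.
  (* The relative excess for which [z * N] is N^a and the half-width is that of the stated
     cylinder. *)
  set z := N%:R `^ (a - 1) in zc zN zh N1z mz expo.
  have key c A : cnorm c <= dl * z `^ 2^-1 ->
      Cyl b (hvec u b c) setT (N%:R `^ ((a + 1) / 2)) `<=` A ->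
      (P [set w | (N%:R * mu (hvec u b c) + N%:R `^ a)%:E <
         passage_time_in (fun e => tau e w) A 0 (N%:R *: hvec u b c)] <=
       (expR (- N%:R `^ (m.+1%:R * (1 - eps) / (1 - chi) * (a - chi))))%:E)%E.
    move=> cz cylA; rewrite -zN; apply: (le_trans (bound N%:R z c A zc N1z cz _)).
      apply: subset_trans cylA => x; rewrite zh => -[y1 [y [_ yh xE]]].
      by exists y1, y; split.
    by rewrite lee_fin ler_expR lerN2.
  split.
    move=> v /(hyperplane_hvecP b_orthonormal b_span)[c ->] close; apply: key => //.
    apply: le_trans mz.
    apply: (@le_trans _ _ (m%:R * enorm (\sum_j c j *: tangent b j))).
      rewrite mulr_natl -[X in _ *+ X](card_ord m) -sumr_const.
      by apply: ler_sum => j _; exact: tangent_sum_enorm.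
    rewrite ler_wpM2l // -(ler_pM2l N0).
    move: close; rewrite (enorm_hvec _ _ _ (ltW N0)) => close.
    have -> : N%:R * N%:R `^ ((chi - 1 + eps / 2) / 2) =
        N%:R `^ ((chi + 1 + eps / 2) / 2).
      have -> : (chi + 1 + eps / 2) / 2 = 1 + (chi - 1 + eps / 2) / 2 by field.
      by rewrite powRDp // powRr1 // ltW.
    exact: ltW close.
  have := key (fun=> 0) setT; rewrite -u_hvec; apply => //.
  by rewrite cnorm0 mulr_ge0 ?powR_ge0 // ltW.
pose e := Num.min e0 (eps / 4).
have e_gt0 : 0 < e by rewrite lt_min e00 divr_gt0.
have e_le : e <= eps / 4 by rewrite ge_min lexx orbT.
have [|dl [cF [N1 [dl0 cF0 N11 bound]]]] := main e; first by rewrite e_gt0 ge_min lexx.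
pose q := m.+1%:R * (1 - chi)^-1 * (eps / 2).
have q0 : 0 < q by rewrite !mulr_gt0 ?invr_gt0.
near=> zeta.
have z0 : 0 < zeta by near: zeta; exact: nbhs_right_gt.
have z1 : zeta <= 1 by near: zeta; apply: nbhs_right_le; exact: ltr01.
have zq : zeta `^ q <= cF.
  rewrite -powR_le_inv ?(ltW z0) ?(ltW cF0) //.
  by near: zeta; apply: nbhs_right_le; exact: powR_gt0.
have zc : 0 < zeta <= 1 by rewrite z0.
apply: limn_esup_le_near; near=> N.
have N_1 : 1 <= N%:R :> R by near: N; exact: nbhs_infty_ger.
have N1z : N1 * zeta `^ (- ((1 + 4 * e) / (1 - chi))) <= N%:R.
  by near: N; exact: nbhs_infty_ger.
have N0 : 0 < N%:R :> R := lt_le_trans ltr01 N_1.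
have := bound N%:R zeta (fun=> 0) setT zc N1z; rewrite cnorm0 -u_hvec.
move=> /(_ _ _)/(lne_le (measure_ge0 _ _)) h.
have Nd0 : (0 <= ((N%:R ^+ m.+1)^-1)%:E :> \bar R)%E by rewrite lee_fin invr_ge0 exprn_ge0.
apply: le_trans (lee_wpmul2l Nd0 (h _ _)) _ => //.
  by rewrite mulr_ge0 ?powR_ge0 // ltW.
rewrite -EFinM lee_fin; apply: rate_absorb => //; first by rewrite invr_ge0 ltW.
Unshelve. all: by end_near.
Qed.
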